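(* Let $\mathcal P$ be the collection of all planar graphs. For neighborhood sampling with sampling ratio $p$ bounded away from one, $$\left(\left(\frac t{p^{7/3}}\wedge\frac{td}{p^2}\right)\vee\frac{td}{p}\right)\wedge t^2\ \lesssim\ \inf_{\widehat{\mathsf t}}\ \sup_{G\in\mathcal P:\ \mathsf d(G)\le d,\ \mathsf t(G)\le t}\mathbb E_G|\widehat{\mathsf t}-\mathsf t(G)|^2\ \lesssim\ \left(\left(\frac t{p^3}\wedge\frac{td}{p^2}\right)\vee\frac{td}{p}\right)\wedge t^2.$$
   Context: Graphs are finite, simple and undirected; $\mathsf d(G)$ is the maximum degree; $\mathsf t(G)$ is the number of triangles in $G$. Neighborhood sampling with ratio $p$: a random set $S\subset V(G)$ includes each vertex independently with probability $p$, and one observes the bicolored graph $\widetilde G$ with vertex set $V(G)$, edge set consisting of all edges of $G$ having at least one endpoint in $S$, and colors indicating which vertices are in $S$. $\mathbb E_G$ is expectation over the sampling with parent graph $G$. The infimum is over all estimators that are functions of the bicolored graph $\widetilde G$. $\wedge=\min$, $\vee=\max$. ''$p$ bounded away from one'' means $p\in(0,p_0]$ for a fixed $p_0<1$; $\lesssim$ means up to a constant factor, absolute up to dependence on $p_0$.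
   Formalization: The lower bound is stated for d ≥ 2 only: for d = 1 and t ≥ 1 no graph has a triangle, so the minimax risk is 0 while the left side is positive; for d = 0 the left side is 0 and the bound is trivial. d and t are natural numbers. *)

(* Defs.v *)
From HB Require Import structures.
From mathcomp Require Import all_boot all_order all_algebra.
From mathcomp Require Import all_classical all_reals all_analysis.

Set Implicit Arguments.
Unset Strict Implicit.
Unset Printing Implicit Defensive.

Import Order.TTheory GRing.Theory Num.Theory.
Import numFieldNormedType.Exports.

Local Open Scope ring_scope.

(* The edges are two-element sets of vertices, so [sgraph V] is a finType and
   graphs with the same edges are equal. *)
Record sgraph (V : finType) := SGraph {
  edges : {set {set V}};
  edges_card2 : edges \subset [set e : {set V} | #|e| == 2%N]
}.

HB.instance Definition _ (V : finType) := [isSub for @edges V].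
HB.instance Definition _ (V : finType) := [Finite of sgraph V by <:].

Definition deg (V : finType) (G : sgraph V) (x : V) : nat :=
  #|[set e in edges G | x \in e]|.

Definition maxdeg (V : finType) (G : sgraph V) : nat := \max_(x : V) deg G x.

Definition triangles (V : finType) (G : sgraph V) : {set {set V}} :=
  [set T : {set V} | (#|T| == 3%N) &&
     [forall x in T, forall y in T, (x != y) ==> ([set x; y] \in edges G)]].

Definition ntriangles (V : finType) (G : sgraph V) : nat := #|triangles G|.

(* A topological drawing: edges are simple arcs parametrized by [0, 1], meeting
   vertices and each other at their endpoints only.  The values of [arc e] outside
   [0, 1], and of [arc] outside [edges G], are irrelevant. *)
Record plane_drawing (R : realType) (V : finType) (G : sgraph V)
    (pos : V -> R * R) (arc : {set V} -> R -> R * R) : Prop := PlaneDrawing {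
  pos_inj : injective pos;
  arc_continuous : forall e, e \in edges G ->
    ({within `[0, 1], continuous (arc e)})%classic;
  arc_inj : forall e, e \in edges G -> {in `[0, 1] &, injective (arc e)};
  arc_ends : forall e, e \in edges G ->
    exists x y : V, [/\ e = [set x; y], arc e 0 = pos x & arc e 1 = pos y];
  arc_vertex : forall e (s : R) (z : V),
    e \in edges G -> 0 < s < 1 -> arc e s <> pos z;
  arc_disjoint : forall e f (s u : R),
    e \in edges G -> f \in edges G -> e != f ->
    0 < s < 1 -> 0 < u < 1 -> arc e s <> arc f u
}.

Definition planar (R : realType) (V : finType) (G : sgraph V) : Prop :=
  exists (pos : V -> R * R) (arc : {set V} -> R -> R * R),
    plane_drawing G pos arc.

(* The second component is the set of vertices colored as sampled. *)
Definition bicolored (V : finType) : Type := (sgraph V * {set V})%type.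

Lemma observed_card2 (V : finType) (G : sgraph V) (S : {set V}) :
  [set e in edges G | e :&: S != finset.set0]
    \subset [set e : {set V} | #|e| == 2%N].
Proof.
apply/fintype.subsetP => e; rewrite inE => /andP[eG _].
exact: (fintype.subsetP (edges_card2 G)).
Qed.

Definition nbhd_sample (V : finType) (G : sgraph V) (S : {set V}) :
    bicolored V :=
  (SGraph (observed_card2 G S), S).

Definition sample_prob (R : realType) (V : finType) (p : R) (S : {set V}) : R :=
  \prod_(x : V) (if x \in S then p else 1 - p).

Definition sample_expect (R : realType) (V : finType) (p : R)
    (X : {set V} -> R) : R :=
  \sum_(S : {set V}) sample_prob p S * X S.

(* Every finite graph is isomorphic to one on some ['I_n]; the vertex set is
   part of the observation, whence the argument [n]. *)
Definition estimator (R : realType) : Type := forall n : nat, bicolored 'I_n -> R.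

Definition risk (R : realType) (p : R) (est : estimator R) (n : nat)
    (G : sgraph 'I_n) : R :=
  sample_expect p
    (fun S => `|est n (nbhd_sample G S) - (ntriangles G)%:R| ^+ 2).

Definition worst_risk (R : realType) (p : R) (d t : nat) (est : estimator R) :
    \bar R :=
  ereal_sup [set r : \bar R | exists (n : nat) (G : sgraph 'I_n),
    [/\ planar R G, (maxdeg G <= d)%N, (ntriangles G <= t)%N &
        r = (risk p est G)%:E]]%classic.

Definition minimax_risk (R : realType) (p : R) (d t : nat) : \bar R :=
  ereal_inf [set worst_risk p d t est | est in [set: estimator R]%classic]%classic.

(* Main.v *)
Require Import Defs.
From HB Require Import structures.
From mathcomp Require Import all_boot all_order all_algebra.
From mathcomp Require Import fingroup perm.
From mathcomp Require Import all_classical all_reals all_analysis.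
From mathcomp Require Import ring lra zify.

Set Implicit Arguments.
Unset Strict Implicit.
Unset Printing Implicit Defensive.

Import Order.TTheory GRing.Theory Num.Theory.
Import numFieldNormedType.Exports.

Local Open Scope ring_scope.

(** Neighbourhood sampling shows all edges at a sampled vertex, hence all triangles
   on an edge with both ends in the sample.

   The upper bound is attained by one of three estimators: the constant zero,
   the inverse-probability count over sampled edges, and an unbiased count that
   treats light edges, in at most 1/p triangles, and heavy edges
   separately ([adaptive_estimator]).  The variance of the last is governed by
   pairs of triangles with a common vertex or edge.  Planarity enters through
   [link_inner_edges]: at most 2|W| edges join vertices of a set W of neighbours
   of one vertex.  So at most 2d triangles share a vertex, and at most O(tp)
   triangles have two heavy edges.  For drawings by arbitrary continuous
   arcs this rests on [planar_no_K5_minor]: the arcs are replaced by close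
   polygons in general position, and van Kampen's obstruction says that the
   intersection numbers of independent edges of K_5 have an odd sum
   ([van_kampen5_eq1]).

   The lower bound takes m disjoint copies of a planar gadget that comes in two
   shapes with different numbers of triangles; unless a copy is revealed, what
   the sample shows of it has the same law in both shapes.  The two hypotheses draw the
   shapes independently with probabilities 1/2 + eps and 1/2 - eps.  Reweighting
   revealed copies makes the two hypotheses indistinguishable, and the
   Cauchy-Schwarz inequality against the weights gives [gadget_lower_bound]: a
   gap of Delta triangles and probability rho of a revelation cost
   Delta^2 min(m / rho, m^2) up to constants.  Three gadgets are needed.

   - A book of about d triangles with or without its spine is revealed by its
     two hubs, rho ~ p, whence td/p.
   - Two triangles, or a hexagon, under random labels look alike around every
     single vertex, rho ~ p^2, whence t/p^2, enough when d is bounded.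
   - Books, windmills and loose triangles of total size l are combined so that
     all pairs of vertices but the boundedly many pairs of hubs look alike in
     the two shapes ([fan_type]).  A revelation takes a sampled pair of hubs or
     three sampled vertices, rho ~ p^2 + (lp)^3, and the gap is of order l, the
     degree of the hubs.  The choice of l as the least of d and p^(-1/3) gives
     min(td/p^2, t/p^(7/3)).

   All gadgets are planar because they have book embeddings with two pages. *)

(** * Intersection numbers of polygonal curves *)

Section Crossing.

Variables (R : realFieldType) (I : eqType) (q : I -> R * R).

Definition det3 (a b c : R * R) : R :=
  (b.1 - a.1) * (c.2 - a.2) - (b.2 - a.2) * (c.1 - a.1).

Definition orient (a b c : I) : bool := 0 < det3 (q a) (q b) (q c).

(** Each of the two segments separates the endpoints of the other. *)
Definition seg_cross (a b c d : I) : bool :=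
  (orient a b c (+) orient a b d) && (orient c d a (+) orient c d b).

Definition in_triangle (a b c d : I) : bool :=
  (orient a b d == orient b c d) && (orient b c d == orient c a d).

Lemma det3_cyc a b c : det3 b c a = det3 a b c.
Proof. rewrite /det3; ring. Qed.

Lemma det3_swap a b c : det3 b a c = - det3 a b c.
Proof. rewrite /det3; ring. Qed.

Lemma orient_cyc a b c : orient b c a = orient a b c.
Proof. by rewrite /orient det3_cyc. Qed.

Lemma orient_diag a c : orient a a c = false.
Proof. by rewrite /orient /det3 !subrr !mul0r subrr ltxx. Qed.

Lemma seg_crossC a b c d : seg_cross a b c d = seg_cross c d a b.
Proof. by rewrite /seg_cross andbC. Qed.

Lemma seg_cross_diag a d e : seg_cross a a d e = false.
Proof. by rewrite /seg_cross !orient_diag. Qed.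

Definition general_position : Prop :=
  forall a b c, a != b -> b != c -> a != c -> det3 (q a) (q b) (q c) != 0.

Hypothesis gen : general_position.

Lemma orient_swap a b c :
  a != b -> b != c -> a != c -> orient b a c = ~~ orient a b c.
Proof.
move=> ab bc ac; rewrite /orient det3_swap oppr_gt0 -leNgt lt_neqAle.
by rewrite gen.
Qed.

Lemma signs_sum4 (x y z w : R) : x != 0 -> y != 0 -> z != 0 -> w != 0 ->
  x + z = y + w ->
  ~~ [&& 0 < x, ~~ (0 < y), 0 < z & ~~ (0 < w)] &&
  ~~ [&& ~~ (0 < x), 0 < y, ~~ (0 < z) & 0 < w].
Proof.
move=> /negPf x0 /negPf y0 /negPf z0 /negPf w0 E.
by do 4! case: ltrgt0P => //= ?; (exfalso; lra) || (subst; rewrite eqxx in x0 y0 z0 w0).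
Qed.

Lemma signs_prod3 (x y z x' y' z' : R) :
  x != 0 -> y != 0 -> z != 0 -> x' != 0 -> y' != 0 -> z' != 0 ->
  x * x' + z * z' = y * y' ->
  ~~ [&& (0 < x) == (0 < x'), (0 < y) != (0 < y') & (0 < z) == (0 < z')] &&
  ~~ [&& (0 < x) != (0 < x'), (0 < y) == (0 < y') & (0 < z) != (0 < z')].
Proof.
have sgM (u v : R) : u != 0 -> v != 0 -> ((0 < u) == (0 < v)) = (0 < u * v).
  move=> u0 v0; case: (ltrgt0P v) v0 => // v0 _.
    by rewrite pmulr_lgt0 // eqb_id.
  by rewrite nmulr_lgt0 // ltNge le_eqVlt (negPf u0) /= eqbF_neg negbK.
move=> x0 y0 z0 x'0 y'0 z'0; rewrite !sgM //.
move: (mulf_neq0 x0 x'0) (mulf_neq0 y0 y'0) (mulf_neq0 z0 z'0).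
set X := x * x'; set Y := y * y'; set Z := z * z' => X0 Y0 Z0 E.
case: (ltrgt0P X) X0; case: (ltrgt0P Y) Y0; case: (ltrgt0P Z) Z0 => //=.
all: by move=> *; lra.
Qed.

(** The sign conditions that the affine relation on each four points and the
   Grassmann-Pluecker relation at each of the five points impose on the ten
   orientations. *)
Definition chirotope5 (abc abd abe acd ace ade bcd bce bde cde : bool) : bool :=
  let alt x y z w := ~~ [&& x, ~~ y, z & ~~ w] && ~~ [&& ~~ x, y, ~~ z & w] in
  let gp x x' y y' z z' := ~~ [&& x == x', y != y' & z == z'] &&
                           ~~ [&& x != x', y == y' & z != z'] in
  [&& alt abc abd acd bcd, alt abc abe ace bce, alt abd abe ade bde,
      alt acd ace ade cde & alt bcd bce bde cde] &&
  [&& gp abc ade abd ace abe acd, gp (~~ abc) bde (~~ abd) bce (~~ abe) bcd,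
      gp abc cde acd bce ace bcd, gp abd (~~ cde) acd (~~ bde) (~~ ade) bcd &
      gp abe cde ace bde ade bce].

Lemma orient_chirotope a b c d e : uniq [:: a; b; c; d; e] ->
  chirotope5 (orient a b c) (orient a b d) (orient a b e) (orient a c d)
    (orient a c e) (orient a d e) (orient b c d) (orient b c e)
    (orient b d e) (orient c d e).
Proof.
rewrite /= !inE !negb_or => /and5P[/and4P[ab ac ad ae] /and3P[bc bd be]
  /andP[cd ce] de _].
have [nab nac nad nae nbc] : [/\ b != a, c != a, d != a, e != a & c != b].
  by split; rewrite eq_sym.
have [nbd nbe ncd nce nde] : [/\ d != b, e != b, d != c, e != c & e != d].
  by split; rewrite eq_sym.
have A4 x y z w : x != y -> x != z -> x != w -> y != z -> y != w -> z != w ->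
  let alt x y z w := ~~ [&& x, ~~ y, z & ~~ w] && ~~ [&& ~~ x, y, ~~ z & w] in
  alt (orient x y z) (orient x y w) (orient x z w) (orient y z w).
  by move=> *; apply: signs_sum4; rewrite ?gen // /det3; ring.
have G5 p x y z w : p != x -> p != y -> p != z -> p != w ->
    x != y -> x != z -> x != w -> y != z -> y != w -> z != w ->
  let gp x x' y y' z z' := ~~ [&& x == x', y != y' & z == z'] &&
                           ~~ [&& x != x', y == y' & z != z'] in
  gp (orient p x y) (orient p z w) (orient p x z) (orient p y w)
     (orient p x w) (orient p y z).
  by move=> *; apply: signs_prod3; rewrite ?gen // /det3; ring.
rewrite /chirotope5; apply/andP; split; first by apply/and5P; split; exact: A4.
have mid x y z : x != y -> y != z -> x != z -> orient y x z = ~~ orient x y z.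
  exact: orient_swap.
have rot x y z : orient z x y = orient x y z by rewrite (orient_cyc z).
have neg (x y : bool) : (~~ x == ~~ y) = (x == y) by rewrite (inj_eq negb_inj).
apply/and5P; split; first exact: G5.
- by rewrite -!mid //; apply: G5.
- have := G5 c a b d e nac nbc cd ce ab ad ae bd be de.
  by rewrite /= !(rot a b c) !(mid a c _, mid b c _) // !neg.
- have := G5 d a b c e nad nbd ncd de ab ac ae bc be ce.
  rewrite /= !(rot a b d) !(rot a c d) !(rot b c d) !(mid c d e) //.
  by rewrite !(mid b d e) // !(mid a d e).
- have := G5 e a b c d nae nbe nce nde ab ac ad bc bd cd.
  by rewrite /= !(rot a b e) !(rot a c e) !(rot b c e) !(rot c d e) !(rot b d e) !(rot a d e).
Qed.

(** A segment crosses the boundary of a triangle an even or an odd number of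
   times according as its endpoints are on the same side or not. *)
Lemma segment_triangle_parity a b c d e :
  a != d -> a != e -> b != d -> b != e -> c != d -> c != e ->
  seg_cross a b d e (+) seg_cross b c d e (+) seg_cross a c d e =
  in_triangle a b c d (+) in_triangle a b c e.
Proof.
have flip x y z : x != y -> y != z -> x != z -> orient y x z = ~~ orient x y z.
  exact: orient_swap.
have rot x y z : orient z x y = orient x y z by rewrite (orient_cyc z).
have [->|de] := eqVneq d e.
  by move=> *; rewrite /seg_cross !addbb.
move=> ad ae bd be cd ce.
have flipc x y : x != d -> x != e -> y != d -> y != e ->
    seg_cross x y d e = seg_cross y x d e.
  move=> xd xe yd ye; have [->//|xy] := eqVneq x y.
  rewrite /seg_cross (addbC (orient d e y)) !(flip x y) //; congr (_ && _).
  by case: (orient x y d); case: (orient x y e).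
have notb : forall x : bool, (x == ~~ x) = false by case.
have ind x y z : x != y -> x != z -> y != z ->
    [/\ in_triangle x x y z = false, in_triangle x y y z = false
      & in_triangle x y x z = false].
  move=> xy xz yz; rewrite /in_triangle !orient_diag !(flip x y z) // !notb.
  by case: (orient x y z).
have [ab|ab] := eqVneq a b.
  rewrite -ab seg_cross_diag addFb addbb; have [->|ac] := eqVneq a c.
    by rewrite /in_triangle !orient_diag.
  by have [-> _ _] := ind a c d ac ad cd; have [-> _ _] := ind a c e ac ae ce.
have [bc|bc] := eqVneq b c.
  rewrite -bc seg_cross_diag addbF addbb.
  by have [_ -> _] := ind a b d ab ad bd; have [_ -> _] := ind a b e ab ae be.
have [ac|ac] := eqVneq a c.
  rewrite -ac seg_cross_diag addbF (flipc b a) // addbb.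
  by have [_ _ ->] := ind a b d ab ad bd; have [_ _ ->] := ind a b e ab ae be.
have := @orient_chirotope a b c d e; rewrite /= !inE !negb_or.
rewrite ab ac ad ae bc bd be cd ce de /= => /(_ isT).
rewrite /seg_cross /in_triangle.
have -> : orient d e a = orient a d e by rewrite (orient_cyc a).
have -> : orient d e b = orient b d e by rewrite (orient_cyc b).
have -> : orient d e c = orient c d e by rewrite (orient_cyc c).
rewrite !(flip a c) //.
move: (orient a b c) (orient a b d) (orient a b e) (orient a c d)
  (orient a c e) (orient a d e) (orient b c d) (orient b c e)
  (orient b d e) (orient c d e).
by do 10! case.
Qed.

(** Five points in general position with straight edges: the number of crossings
   is 1, 3 or 5, depending on the size of the convex hull. *)
Lemma seg_cross_K5 a b c d e : uniq [:: a; b; c; d; e] ->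
  let x := seg_cross in
  x a b c d (+) x a b c e (+) x a b d e (+)
  (x a c b d (+) x a c b e (+) x a c d e) (+)
  (x a d b c (+) x a d b e (+) x a d c e) (+)
  (x a e b c (+) x a e b d (+) x a e c d) (+)
  (x b c d e (+) x b d c e (+) x b e c d).
Proof.
move=> U; have := orient_chirotope U; move: U.
rewrite /= !inE !negb_or => /and5P[/and4P[ab ac ad ae] /and3P[bc bd be]
  /andP[cd ce] de _].
have rot x y z : orient y z x = orient x y z by rewrite (orient_cyc x).
have mid x y z : x != y -> y != z -> x != z -> orient x z y = ~~ orient x y z.
  by move=> xy yz xz; rewrite -(orient_swap xy yz xz) (orient_cyc y).
rewrite /seg_cross.
rewrite !(rot a b c) !(rot a b d) !(rot a b e) !(rot a c d) !(rot a c e) !(rot a d e) !(rot b c d) !(rot b c e) !(rot b d e) !(rot c d e).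
rewrite !(mid a b c) // !(mid a b d) // !(mid a b e) // !(mid a c d) // !(mid a c e) // !(mid a d e) // !(mid b c d) // !(mid b c e) // !(mid b d e) // !(mid c d e) //.
move: (orient a b c) (orient a b d) (orient a b e) (orient a c d)
  (orient a c e) (orient a d e) (orient b c d) (orient b c e)
  (orient b d e) (orient c d e).
by do 10! case.
Qed.

Fixpoint seg_path_cross (a b y : I) (s : seq I) : 'F_2 :=
  if s is z :: s' then (seg_cross a b y z)%:R + seg_path_cross a b z s' else 0.

Fixpoint path_cross (x : I) (p : seq I) (y : I) (s : seq I) : 'F_2 :=
  if p is z :: p' then seg_path_cross x z y s + path_cross z p' y s else 0.

Lemma F2_addb (x y : bool) : (x (+) y)%:R = x%:R + y%:R :> 'F_2.
Proof. by case: x; case: y; apply/val_inj. Qed.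

Lemma F2_double (x : 'F_2) : x + x = 0.
Proof. by rewrite -mulr2n -mulr_natl pchar_Fp_0 ?mul0r. Qed.

Lemma path_cross_nil x p y : path_cross x p y [::] = 0.
Proof. by elim: p x => //= z p IH x; rewrite IH addr0. Qed.

Lemma path_crossC x p y s : path_cross x p y s = path_cross y s x p.
Proof.
have cons_r z s' : path_cross x p y (z :: s') =
    seg_path_cross y z x p + path_cross x p z s'.
  elim: p x => [|w p IH] x /=; first by rewrite addr0.
  by rewrite IH seg_crossC; ring.
elim: s y cons_r => [|z s IH] y cons_r; first by rewrite path_cross_nil.
rewrite cons_r /= IH // => w s'.
elim: p x {cons_r IH} => [|w' p IH] x /=; first by rewrite addr0.
by rewrite IH seg_crossC; ring.
Qed.

Lemma seg_path_cross_triangle a b c y s :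
  a \notin y :: s -> b \notin y :: s -> c \notin y :: s ->
  seg_path_cross a b y s + seg_path_cross b c y s =
  seg_path_cross a c y s
    + ((in_triangle a b c y)%:R + (in_triangle a b c (last y s))%:R).
Proof.
elim: s y => [|z s IH] y /=.
  by rewrite -F2_addb addbb !addr0.
rewrite !(inE, negb_or) => /and3P[ay az ai] /and3P[by_ bz bi] /and3P[cy cz ci].
have := IH z; rewrite !(inE, negb_or) az bz cz ai bi ci => /(_ isT isT isT).
have := segment_triangle_parity ay az by_ bz cy cz.
move/(congr1 (fun x : bool => x%:R : 'F_2)); rewrite !F2_addb.
move: (seg_path_cross a b z s) (seg_path_cross b c z s) => A B.
move: (seg_path_cross a c z s) (in_triangle a b c (last z s))%:R => C i3.
move: (seg_cross a b y z)%:R (seg_cross b c y z)%:R => x1 x2.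
move: (seg_cross a c y z)%:R (in_triangle a b c y)%:R => x3 i1.
move: (in_triangle a b c z)%:R => i2 E1 E2.
have -> : x1 + A + (x2 + B) = (x1 + x2 + x3) + (A + B) - x3 by ring.
rewrite E1 E2; apply/eqP; rewrite -subr_eq0; apply/eqP.
have -> : i1 + i2 + (C + (i2 + i3)) - x3 - (x3 + C + (i1 + i3)) =
  (i2 + i2) - (x3 + x3) by ring.
by rewrite !F2_double subr0.
Qed.

(** The curve made of three polygonal arcs u -> v -> w <- u is closed, so its
   intersection number with a polygonal arc depends on the ends of that arc
   only. *)
Lemma closed_path_cross x p (u v w : I) s1 s2 s3 :
  last u s1 = v -> last v s2 = w -> last u s3 = w ->
  (forall z, z \in x :: p ->
     [/\ z \notin u :: s1, z \notin v :: s2 & z \notin u :: s3]) ->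
  path_cross x p u s1 + path_cross x p v s2 + path_cross x p u s3 =
  path_cross x [:: last x p] u s1 + path_cross x [:: last x p] v s2
    + path_cross x [:: last x p] u s3.
Proof.
move=> l1 l2 l3 dis.
pose F a b :=
  seg_path_cross a b u s1 + seg_path_cross a b v s2 + seg_path_cross a b u s3.
have Fd a : F a a = 0.
  have d y s : seg_path_cross a a y s = 0.
    by elim: s y => //= z s IH y; rewrite seg_cross_diag IH addr0.
  by rewrite /F !d !addr0.
have FD a b c : a \in x :: p -> b \in x :: p -> c \in x :: p ->
    F a b + F b c = F a c.
  move=> /dis[a1 a2 a3] /dis[b1 b2 b3] /dis[c1 c2 c3].
  have E1 := seg_path_cross_triangle a1 b1 c1.
  have E2 := seg_path_cross_triangle a2 b2 c2.
  have E3 := seg_path_cross_triangle a3 b3 c3.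
  rewrite l1 l2 l3 in E1 E2 E3.
  rewrite /F addrACA (addrACA (seg_path_cross a b u s1)) E1 E2 E3.
  move: (in_triangle a b c u)%:R (in_triangle a b c v)%:R => iu iv.
  move: (in_triangle a b c w)%:R => iw; apply/eqP; rewrite -subr_eq0; apply/eqP.
  rewrite -[RHS](F2_double (iu + iv + iw)); ring.
suff H r y : y \in x :: p -> {subset r <= x :: p} ->
    path_cross y r u s1 + path_cross y r v s2 + path_cross y r u s3 =
    F y (last y r).
  rewrite (H p x) ?mem_head //=; first by rewrite !addr0.
  by move=> z zp; rewrite inE zp orbT.
elim: r y => [|z r IH] y yp qp /=; first by rewrite Fd !addr0.
have zp : z \in x :: p by apply: qp; rewrite mem_head.
have qp' : {subset r <= x :: p} by move=> t tq; apply: qp; rewrite inE tq orbT.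
rewrite -(FD y z) //; last first.
  by have := mem_last z r; rewrite inE => /orP[/eqP->//|/qp'].
by rewrite -IH // /F; ring.
Qed.

Definition cross_of (b : nat -> I) (P : nat -> nat -> seq I) i j k l : 'F_2 :=
  path_cross (b i) (P i j) (b k) (P k l).

(** Intersection numbers modulo 2 of the fifteen pairs of independent edges in
   a polygonal drawing of K_5, added up: van Kampen's obstruction. *)
Definition van_kampen5 (b : nat -> I) (P : nat -> nat -> seq I) : 'F_2 :=
  let X := cross_of b P in
   X 0 1 2 3 +
   X 0 1 2 4 +
   X 0 1 3 4 +
   X 0 2 1 3 +
   X 0 2 1 4 +
   X 0 2 3 4 +
   X 0 3 1 2 +
   X 0 3 1 4 +
   X 0 3 2 4 +
   X 0 4 1 2 +
   X 0 4 1 3 +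
   X 0 4 2 3 +
   X 1 2 3 4 +
   X 1 3 2 4 +
   X 1 4 2 3.

Definition straighten (b : nat -> I) (P : nat -> nat -> seq I) (e : nat * nat) :=
  fun i j => if (i, j) == e then [:: b j] else P i j.

Definition K5_drawing (b : nat -> I) (P : nat -> nat -> seq I) : Prop :=
  (forall i j, (i < j < 5)%N -> last (b i) (P i j) = b j) /\
  (forall i j k l, (i < j < 5)%N -> (k < l < 5)%N -> uniq [:: i; j; k; l] ->
     forall z, z \in b i :: P i j -> z \notin b k :: P k l).

Lemma K5_drawing_straighten b P e : (e.1 < e.2 < 5)%N ->
  K5_drawing b P -> K5_drawing b (straighten b P e).
Proof.
case: e => i0 j0 /= e5 [Pl Pd]; split=> [i j ij|i j k l ij kl U z].
  by rewrite /straighten; case: eqP => //= _; apply: Pl.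
have sub i1 j1 : (i1 < j1 < 5)%N ->
    {subset b i1 :: straighten b P (i0, j0) i1 j1 <= b i1 :: P i1 j1}.
  move=> ij1 t; rewrite /straighten; case: eqP => // _.
  rewrite !inE => /orP[->//|/eqP->].
  by rewrite -(Pl i1 j1 ij1) -in_cons mem_last.
move=> /(sub _ _ ij) zP; apply/negP => /(sub _ _ kl); apply/negP.
exact: (Pd _ _ _ _ ij kl U).
Qed.

(** The three edges of K_5 independent of a given edge form a triangle, hence
   a closed curve, and only the ends of the given edge matter. *)
Lemma cross_of_straighten b P i j k l m :
  (i < j < 5)%N -> (k < l)%N -> (l < m < 5)%N -> uniq [:: i; j; k; l; m] ->
  K5_drawing b P ->
  let X := cross_of b P in let Y := cross_of b (straighten b P (i, j)) in
  X i j k l + X i j l m + X i j k m = Y i j k l + Y i j l m + Y i j k m.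
Proof.
move=> ij kl lm U [Pl Pd] X Y.
have [ij' kl' km' lm'] : [/\ (i < j < 5)%N, (k < l < 5)%N, (k < m < 5)%N
  & (l < m < 5)%N] by split; lia.
have ne a c : (a < c)%N -> ((a, c) == (i, j)) = (a == i) && (c == j) by [].
have [ki li] : k == i = false /\ l == i = false.
  by move: U; rewrite /= !inE !negb_or; lia.
rewrite /X /Y /cross_of /straighten !xpair_eqE ki li !eqxx /=.
rewrite (@closed_path_cross _ _ (b k) (b l) (b m)) ?Pl //.
move=> z zP; split; apply: (Pd i j) zP => //.
- by move: U; rewrite /= !inE !negb_or; lia.
- by move: U; rewrite /= !inE !negb_or; lia.
- by move: U; rewrite /= !inE !negb_or; lia.
Qed.

Lemma cross_ofC b P i j k l : cross_of b P i j k l = cross_of b P k l i j.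
Proof. exact: path_crossC. Qed.

Lemma van_kampen5_straighten b P e : (e.1 < e.2 < 5)%N -> K5_drawing b P ->
  van_kampen5 b P = van_kampen5 b (straighten b P e).
Proof.
case: e => i j /= ij dP.
have flip i' j' k l Q : cross_of b Q i' j' k l = cross_of b Q k l i' j'.
  exact: cross_ofC.
have sub0 (x y x' y' : 'F_2) : x = y -> x - y = x' - y' -> x' = y'.
  by move=> -> E; apply/eqP; rewrite -subr_eq0 -E subrr.
Ltac vk := rewrite /van_kampen5 /cross_of /straighten /=;
  move/sub0; apply; ring.
have : (i, j) \in [:: (0, 1); (0, 2); (0, 3); (0, 4); (1, 2); (1, 3); (1, 4);
    (2, 3); (2, 4); (3, 4)]%N.
  move: ij; rewrite andbC.
  by case: j => [|[|[|[|[|j]]]]] //; case: i => [|[|[|[|[|i]]]]].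
rewrite !inE => /orP[/eqP[-> ->]|/orP[/eqP[-> ->]|/orP[/eqP[-> ->]|/orP[/eqP[-> ->]|/orP[/eqP[-> ->]|/orP[/eqP[-> ->]|/orP[/eqP[-> ->]|/orP[/eqP[-> ->]|/orP[/eqP[-> ->]|/eqP[-> ->]]]]]]]]]].
- have := @cross_of_straighten b P 0 1 2 3 4 isT isT isT isT dP.
  by vk.
- have := @cross_of_straighten b P 0 2 1 3 4 isT isT isT isT dP.
  by vk.
- have := @cross_of_straighten b P 0 3 1 2 4 isT isT isT isT dP.
  by vk.
- have := @cross_of_straighten b P 0 4 1 2 3 isT isT isT isT dP.
  by vk.
- have := @cross_of_straighten b P 1 2 0 3 4 isT isT isT isT dP.
  by rewrite /= !(flip 1 2 0 3) !(flip 1 2 0 4); vk.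
- have := @cross_of_straighten b P 1 3 0 2 4 isT isT isT isT dP.
  by rewrite /= !(flip 1 3 0 2) !(flip 1 3 0 4); vk.
- have := @cross_of_straighten b P 1 4 0 2 3 isT isT isT isT dP.
  by rewrite /= !(flip 1 4 0 2) !(flip 1 4 0 3); vk.
- have := @cross_of_straighten b P 2 3 0 1 4 isT isT isT isT dP.
  by rewrite /= !(flip 2 3 0 1) !(flip 2 3 1 4) !(flip 2 3 0 4); vk.
- have := @cross_of_straighten b P 2 4 0 1 3 isT isT isT isT dP.
  by rewrite /= !(flip 2 4 0 1) !(flip 2 4 1 3) !(flip 2 4 0 3); vk.
- have := @cross_of_straighten b P 3 4 0 1 2 isT isT isT isT dP.
  by rewrite /= !(flip 3 4 0 1) !(flip 3 4 1 2) !(flip 3 4 0 2); vk.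
Qed.

Theorem van_kampen5_eq1 b P : uniq [:: b 0; b 1; b 2; b 3; b 4]%N ->
  K5_drawing b P -> van_kampen5 b P = 1.
Proof.
move=> U dP.
pose es := [:: (0, 1); (0, 2); (0, 3); (0, 4); (1, 2); (1, 3); (1, 4); (2, 3); (2, 4); (3, 4)]%N.
have [E _] : van_kampen5 b P = van_kampen5 b (foldl (straighten b) P es) /\
    K5_drawing b (foldl (straighten b) P es).
  have: all (fun e : nat * nat => e.1 < e.2 < 5)%N es by [].
  elim: es P dP => //= e es IH P dP /andP[e5 /IH] H.
  have [|<- ?] := H (straighten b P e); first exact: K5_drawing_straighten.
  by split=> //; apply: van_kampen5_straighten.
have := seg_cross_K5 U; rewrite E /van_kampen5 /cross_of /= => K.
move/(congr1 (fun x : bool => x%:R : 'F_2)): K.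
by rewrite !F2_addb !addr0 => K; rewrite -[RHS]K; ring.
Qed.

Lemma path_crossP x p y s : path_cross x p y s != 0 ->
  exists i j, [/\ (i < size p)%N, (j < size s)%N &
    seg_cross (nth x (x :: p) i) (nth x p i) (nth y (y :: s) j) (nth y s j)].
Proof.
elim: p x => [|z p IH] x //=.
have [->|] := eqVneq (seg_path_cross x z y s) 0.
  rewrite add0r => /IH[i [j [ip js C]]]; exists i.+1, j; split=> //=.
  move: C; rewrite (set_nth_default x z) ?(set_nth_default x z ip) //=.
  by rewrite ltnS ltnW.
move=> nz _; exists 0%N.
suff [j [js C]] : exists j, (j < size s)%N /\
    seg_cross x z (nth y (y :: s) j) (nth y s j) by exists j.
elim: s y nz {IH} => [|w s IH] y //=.
have [C _|_] := boolP (seg_cross x z y w); first by exists 0%N.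
rewrite mulr0n add0r => /IH[j [js C]]; exists j.+1; split=> //=.
move: C; rewrite (set_nth_default y w) ?(set_nth_default y w js) //=.
by rewrite ltnS ltnW.
Qed.

(** Two segments that cross in the sense of orientations meet. *)
Lemma seg_cross_meet a b c d : seg_cross a b c d ->
  exists s t : R, [/\ 0 <= s <= 1, 0 <= t <= 1,
    (q a).1 + s * ((q b).1 - (q a).1) = (q c).1 + t * ((q d).1 - (q c).1) &
    (q a).2 + s * ((q b).2 - (q a).2) = (q c).2 + t * ((q d).2 - (q c).2)].
Proof.
have opp (x y : R) : (0 < x) (+) (0 < y) -> x - y != 0 /\ 0 <= x / (x - y) <= 1.
  have [x0|x0] := ltrP 0 x; have [y0|y0] //= := ltrP 0 y; move=> _.
    have p : 0 < x - y by lra.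
    by rewrite gt_eqF // divr_ge0 ?(ltW p) ?(ltW x0) //= ler_pdivrMr //; split=> //; lra.
  have p : x - y < 0 by lra.
  rewrite lt_eqF //; split=> //; rewrite -[x / _]mulrNN -invrN.
  by rewrite divr_ge0 /= ?ler_pdivrMr; lra.
case/andP=> /opp[n1 s1] /opp[n2 s2].
exists (det3 (q c) (q d) (q a) / (det3 (q c) (q d) (q a) - det3 (q c) (q d) (q b))).
exists (det3 (q a) (q b) (q c) / (det3 (q a) (q b) (q c) - det3 (q a) (q b) (q d))).
split=> //; move: n1 n2 {s1 s2}; rewrite /det3 => n1 n2; field.
  by rewrite n1 n2.
by rewrite n1 n2.
Qed.

End Crossing.

(** * Disjoint arcs, and points in general position *)

Section ArcsApart.

Local Open Scope classical_set_scope.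

Variable R : realType.
Implicit Types (f g : R -> R * R).

(** Continuity within the unit interval is continuity of a function that is
   constant outside it. *)
Lemma clamp_continuous f : {within `[0, 1], continuous f} ->
  exists2 g, continuous g & forall x, 0 <= x <= 1 -> f x = g x.
Proof.
move=> cf; pose k (x : R) : R := Num.min (Num.max x 0) 1.
have k01 x : (`[0, 1] : set R) (k x).
  by rewrite /= in_itv /= /k le_min ge_min le_max !lexx ler01 !orbT.
have ck : continuous k.
  move=> x; apply: (@continuous_min R R (fun x => Num.max x 0) (fun=> 1)).
    by apply: (@continuous_max R R id (fun=> 0)); [exact: cvg_id|exact: cvg_cst].
  exact: cvg_cst.
exists (f \o k) => [x|x].
  have /subspace_continuousP/(_ (k x) (k01 x)) cfx := cf.
  apply: cvg_comp cfx => U HU.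
  have : nbhs x (fun y => (`[0, 1] : set R) (k y) -> U (k y)) := ck x _ HU.
  by apply: filterS => y /(_ (k01 y)).
by move=> /andP[x0 x1]; rewrite /k /= max_l // min_l.
Qed.

Lemma arcs_apart f g : continuous f -> continuous g ->
  (forall s u, 0 <= s <= 1 -> 0 <= u <= 1 -> f s <> g u) ->
  exists2 e : R, 0 < e &
    forall s u, 0 <= s <= 1 -> 0 <= u <= 1 -> e <= `|f s - g u|.
Proof.
move=> cf cg dis.
pose h (z : R * R) : R := `|f z.1 - g z.2|.
have ch : continuous h.
  move=> z; apply: cvg_norm; apply: cvgB.
    by apply: cvg_comp; [exact: cvg_fst|exact: cf].
  by apply: cvg_comp; [exact: cvg_snd|exact: cg].
have [|||c] := @compact_EVT_min _ R h (`[0, 1] `*` `[0, 1]).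
- by exists (0, 0); split; rewrite /= in_itv /= lexx ler01.
- by apply: compact_setX; exact: segment_compact.
- exact: continuous_subspaceT.
rewrite inE => -[/= c1 c2] hc; exists (h c).
  by rewrite normr_gt0 subr_eq0; apply/eqP; apply: dis; [move: c1|move: c2]; rewrite in_itv.
by move=> s u s01 u01; apply: (hc (s, u)); rewrite inE.
Qed.

Lemma arc_unif_continuous f (e : R) : continuous f -> 0 < e ->
  exists2 d : R, 0 < d & forall s u, 0 <= s <= 1 -> 0 <= u <= 1 ->
    `|s - u| < d -> `|f s - f u| < e.
Proof.
move=> cf e0.
pose h (z : R * R) : R := `|f z.1 - f z.2|.
have ch : continuous h.
  move=> z; apply: cvg_norm; apply: cvgB.
    by apply: cvg_comp; [exact: cvg_fst|exact: cf].
  by apply: cvg_comp; [exact: cvg_snd|exact: cf].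
pose A := (`[0, 1] `*` `[0, 1]) `&` (h @^-1` [set x | e <= x]) : set (R * R).
have cA : compact A.
  apply: compact_closedI.
    by apply: compact_setX; exact: segment_compact.
  by apply: closed_comp => [z _|]; [exact: ch|exact: closed_ge].
have [/set0P A0|/negP/negbNE/eqP A0] := pselect (A != set0); last first.
  exists 1 => // s u s01 u01 _; rewrite ltNge; apply/negP => su.
  have : A (s, u) by split=> //; split; rewrite /= in_itv.
  by rewrite A0.
have cd : continuous (fun z : R * R => `|z.1 - z.2| : R).
  by move=> z; apply: cvg_norm; apply: cvgB; [exact: cvg_fst|exact: cvg_snd].
have [//|c] := @compact_EVT_min _ R (fun z => `|z.1 - z.2|) A A0 cA.
  exact: continuous_subspaceT.
rewrite inE => -[_ /= hc] dc; exists `|c.1 - c.2|.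
  rewrite normr_gt0 subr_eq0; apply/eqP => c12; move: hc.
  by rewrite /h c12 subrr normr0 leNgt e0.
move=> s u s01 u01; rewrite !ltNge => /negP su; apply/negP => hsu; apply: su.
by apply: (dc (s, u)); rewrite inE; split=> //; split; rewrite /= in_itv.
Qed.

End ArcsApart.

Section Perturbation.

Variables (R : realType) (I : finType).

Lemma common_radius (P : I -> R -> Prop) :
  (forall i, exists2 e, 0 < e & P i e) ->
  (forall i e e', P i e -> 0 < e' <= e -> P i e') ->
  exists2 e, 0 < e & forall i, P i e.
Proof.
move=> ex mono.
have /choice[e eP] : forall i, exists e, 0 < e /\ P i e.
  by move=> i; have [e ? ?] := ex i; exists e.
pose m := \big[Num.min/1]_i e i.
have m0 : 0 < m.
  by rewrite /m; elim/big_ind: _ => // [x y|i _]; [rewrite lt_min => -> ->|case: (eP i)].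
exists m => // i; apply: (mono i (e i)); first by case: (eP i).
by rewrite m0 /m (bigD1 i) //= ge_min lexx.
Qed.

Lemma small_nonroot (p : {poly R}) (d : R) : p != 0 -> 0 < d ->
  exists2 h, 0 < h <= d & p.[h] != 0.
Proof.
move=> p0 d0.
pose s := [seq d / k.+1%:R | k <- iota 0 (size p)].
have us : uniq s.
  rewrite map_inj_uniq ?iota_uniq // => i j /(mulfI (lt0r_neq0 d0))/invr_inj.
  by move/eqP; rewrite eqr_nat => /eqP[].
have : ~~ all (root p) s.
  apply/negP => /(max_poly_roots p0)/(_ us).
  by rewrite size_map size_iota ltnn.
case/allPn => h /mapP[k _ ->] hk; exists (d / k.+1%:R) => //.
by rewrite divr_gt0 ?ltr0n //= ler_pdivrMr ?ltr0n // ler_peMr ?ler1n // ltW.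
Qed.

(** Moving the i-th point along the i-th point of a parabola makes every
   triangle area a polynomial in the displacement whose leading coefficient is
   a Vandermonde determinant, so all small displacements but finitely many
   bring the points to general position. *)
Lemma perturb_general_position (q0 : I -> R * R) (e : R) : 0 < e ->
  exists2 q, general_position q & forall i, `|q i - q0 i| < e.
Proof.
move=> e0; pose r (i : I) : R := (enum_rank i)%:R.
have r_neq i j : i != j -> r j - r i != 0.
  move=> ij; rewrite subr_eq0 eqr_nat; apply: contraNneq ij => /val_inj.
  by move/enum_rank_inj ->.
pose q h i := ((q0 i).1 + h * r i, (q0 i).2 + h * r i ^+ 2).
pose lin (x y : R) : {poly R} := x%:P + y *: 'X.
pose p a b c := lin ((q0 b).1 - (q0 a).1) (r b - r a)
    * lin ((q0 c).2 - (q0 a).2) (r c ^+ 2 - r a ^+ 2)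
  - lin ((q0 b).2 - (q0 a).2) (r b ^+ 2 - r a ^+ 2)
    * lin ((q0 c).1 - (q0 a).1) (r c - r a).
have pE a b c h : (p a b c).[h] = det3 (q h a) (q h b) (q h c).
  by rewrite /p /lin /det3 /q !hornerE /=; ring.
have p_neq a b c : a != b -> b != c -> a != c -> p a b c != 0.
  move=> ab bc ac; apply/eqP => p0.
  have := congr1 (fun p => p.[1] + p.[-1] - 2 * p.[0]) p0.
  rewrite !pE !horner0 mulr0 addr0 subr0 => E.
  have : 2 * ((r b - r a) * (r c - r b) * (r c - r a)) = 0.
    by rewrite -[RHS]E /det3 /q /=; ring.
  apply/eqP; rewrite !mulf_neq0 ?r_neq ?pnatr_eq0 //.
pose P := \prod_(t : I * I * I |
  [&& t.1.1 != t.1.2, t.1.2 != t.2 & t.1.1 != t.2]) p t.1.1 t.1.2 t.2.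
have P0 : P != 0.
  by apply/prodf_neq0 => -[[a b] c] /= /and3P[*]; apply: p_neq.
pose N : R := #|I|%:R.
have N0 : 0 <= N by rewrite ler0n.
have rN i : 0 <= r i <= N by rewrite ler0n ler_nat ltnW.
have [||h /andP[h0 hd] Ph] := @small_nonroot P (e / (2 * (1 + N + N ^+ 2))) => //.
  by rewrite divr_gt0 // mulr_gt0 // -addrA ltr_wpDr // addr_ge0 // exprn_ge0.
exists (q h) => [a b c ab bc ac|i].
  rewrite -pE; move: Ph; rewrite /P horner_prod => /prodf_neq0.
  by move/(_ (a, b, c)); rewrite /= ab bc ac => /(_ isT).
have big0 : 0 < 2 * (1 + N + N ^+ 2) by nra.
move: hd; rewrite ler_pdivlMr // => hd.
rewrite prod_normE /= ; have /andP[r0 rN'] := rN i.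
rewrite gt_max !(addrC (_ i).1) !(addrC (_ i).2) !addrK !normrM.
rewrite !ger0_norm ?exprn_ge0 ?(ltW h0) //.
have h1 : h * r i <= h * N by rewrite ler_wpM2l // ltW.
have h2 : h * r i ^+ 2 <= h * N ^+ 2 by rewrite ler_wpM2l ?lerXn2r ?nnegrE // ltW.
have hN : 0 <= h * N by rewrite mulr_ge0 // ltW.
have hN2 : 0 <= h * N ^+ 2 by rewrite mulr_ge0 ?exprn_ge0 // ltW.
by apply/andP; split; lra.
Qed.

End Perturbation.

(** * Planar graphs have no K_5 minor *)

Definition adj (V : finType) (G : sgraph V) : rel V :=
  fun x y => [set x; y] \in edges G.

Lemma adj_sym (V : finType) (G : sgraph V) : symmetric (adj G).
Proof. by move=> x y; rewrite /adj finset.setUC. Qed.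

Lemma adj_neq (V : finType) (G : sgraph V) x y : adj G x y -> x != y.
Proof.
move=> /(fintype.subsetP (edges_card2 G)); rewrite inE cards2.
by case: (x != y).
Qed.

Section NoK5.

Variables (R : realType) (V : finType) (G : sgraph V).
Variables (pos : V -> R * R) (arc : {set V} -> R -> R * R).
Hypothesis dr : plane_drawing G pos arc.

Lemma disjoint_arcs e f : e \in edges G -> f \in edges G -> [disjoint e & f] ->
  forall s u, 0 <= s <= 1 -> 0 <= u <= 1 -> arc e s <> arc f u.
Proof.
move=> eG fG ef.
have dxy x y : x \in e -> y \in f -> x != y.
  by move=> xe yf; apply: contraTneq yf => <-; rewrite (disjointFr ef xe).
have [x [y [eE e0 e1]]] := arc_ends dr eG.
have [z [w [fE f0 f1]]] := arc_ends dr fG.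
have [xe ye zf wf] : [/\ x \in e, y \in e, z \in f & w \in f].
  by rewrite eE fE !inE !eqxx !orbT.
have ne : e != f.
  by apply: contraTneq xe => ->; apply/negP => xf; have := dxy x x; rewrite eqxx eE !inE eqxx xf => /(_ isT isT).
have ep t : 0 <= t <= 1 -> [\/ t = 0, t = 1 | 0 < t < 1].
  case/andP; rewrite !le_eqVlt => /orP[/eqP<-|t0]; first by constructor 1.
  by case/orP=> [/eqP->|t1]; [constructor 2|constructor 3; rewrite t0].
have pi a b : a != b -> pos a <> pos b by move=> ab /(pos_inj dr)/eqP; apply/negP.
move=> s u /ep[->|->|s01] /ep[->|->|u01].
- by rewrite e0 f0; apply/pi/dxy.
- by rewrite e0 f1; apply/pi/dxy.
- by rewrite e0 => /esym; apply: (arc_vertex dr).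
- by rewrite e1 f0; apply/pi/dxy.
- by rewrite e1 f1; apply/pi/dxy.
- by rewrite e1 => /esym; apply: (arc_vertex dr).
- by rewrite f0; apply: (arc_vertex dr).
- by rewrite f1; apply: (arc_vertex dr).
- exact: (arc_disjoint dr).
Qed.

Lemma independent_arcs_apart : exists2 r : R, 0 < r &
  forall e f s u, e \in edges G -> f \in edges G -> [disjoint e & f] ->
    0 <= s <= 1 -> 0 <= u <= 1 -> r <= `|arc e s - arc f u|.
Proof.
pose P (ef : {set V} * {set V}) (r : R) := forall s u,
  ef.1 \in edges G -> ef.2 \in edges G -> [disjoint ef.1 & ef.2] ->
    0 <= s <= 1 -> 0 <= u <= 1 -> r <= `|arc ef.1 s - arc ef.2 u|.
have [[e f]|ef r r' Pr|r r0 Pr] := @common_radius R _ P.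
- have [/and3P[eG fG d]|nef] := boolP [&& e \in edges G, f \in edges G & [disjoint e & f]].
    have [a ca ea] := clamp_continuous (arc_continuous dr eG).
    have [b cb fb] := clamp_continuous (arc_continuous dr fG).
    have [s u s01 u01|r r0 rP] := arcs_apart ca cb.
      by rewrite -ea // -fb //; apply: disjoint_arcs.
    by exists r => // s u _ _ _ s01 u01; rewrite ea // fb //; apply: rP.
  by exists 1 => // s u /= eG fG d; rewrite eG fG d in nef.
- by case/andP=> _ rr s u eG fG d s01 u01; apply: le_trans rr _; apply: Pr.
- by exists r => // e f s u; apply: (Pr (e, f)).
Qed.

Lemma arcs_equicontinuous (r : R) : 0 < r -> exists2 d : R, 0 < d &
  forall e s u, e \in edges G -> 0 <= s <= 1 -> 0 <= u <= 1 -> `|s - u| < d ->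
    `|arc e s - arc e u| < r.
Proof.
move=> r0; pose P (e : {set V}) (d : R) := forall s u, e \in edges G ->
  0 <= s <= 1 -> 0 <= u <= 1 -> `|s - u| < d -> `|arc e s - arc e u| < r.
have [e|e d d' Pd|d d0 Pd] := @common_radius R _ P.
- have [eG|neG] := boolP (e \in edges G); last first.
    by exists 1 => // s u eG; rewrite eG in neG.
  have [a ca ea] := clamp_continuous (arc_continuous dr eG).
  have [d d0 dP] := arc_unif_continuous ca r0.
  by exists d => // s u _ s01 u01; rewrite !ea //; apply: dP.
- by case/andP=> _ dd s u eG s01 u01 su; apply: Pd => //; apply: lt_le_trans dd.
- by exists d => // e s u; apply: Pd.
Qed.

(** The graph subdivided at [N] points of every edge: [inr (e, k)] is the point
   of the arc of [e] at parameter [(k + 1) / (N + 1)]. *)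
Variable N : nat.
Local Notation I := (V + {set V} * 'I_N)%type.

Definition sample_point (i : I) : R * R :=
  match i with inl x => pos x | inr (e, k) => arc e (k.+1%:R / N.+1%:R) end.

Definition support_set (i : I) : {set V} :=
  match i with inl x => [set x] | inr (e, _) => e end.

Definition lift_edge (x y : V) : seq I :=
  let s := [seq inr ([set x; y], k) | k <- enum 'I_N] in
  rcons (if `[< arc [set x; y] 0 = pos x >] then s else rev s) (inl y).

Fixpoint lift_path (x : V) (p : seq V) : seq I :=
  if p is y :: p' then lift_edge x y ++ lift_path y p' else [::].

Lemma last_lift_path x p : last (inl x) (lift_path x p) = inl (last x p).
Proof. by elim: p x => //= y p IH x; rewrite last_cat last_rcons IH. Qed.

Lemma mem_lift_path x p i : path (adj G) x p -> i \in inl x :: lift_path x p ->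
  support_set i \subset [set z in x :: p] /\ support_set i != finset.set0.
Proof.
elim: p x => [|y p IH] x /=.
  move=> _; rewrite inE => /eqP -> /=; split.
    by rewrite finset.sub1set !inE.
  by rewrite -card_gt0 cards1.
case/andP=> xy yp; rewrite inE mem_cat mem_rcons => /orP[/eqP->|].
  by rewrite /= finset.sub1set !inE eqxx -card_gt0 cards1.
have mono (A : {set V}) : A \subset [set z in y :: p] -> A \subset [set z in x :: y :: p].
  by move=> Ay; apply/fintype.subsetP => z /(fintype.subsetP Ay); rewrite !inE => ->; rewrite orbT.
rewrite inE => /orP[/orP[/eqP->|]|ip]; last 1 first.
- by have [|/mono] := IH y yp; rewrite ?inE ?ip ?orbT.
- by rewrite /= finset.sub1set !inE eqxx orbT -card_gt0 cards1.
have -> : (i \in (if `[< arc [set x; y] 0 = pos x >]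
  then [seq inr ([set x; y], k) | k <- enum 'I_N]
  else rev [seq inr ([set x; y], k) | k <- enum 'I_N])) =
    (i \in [seq inr ([set x; y], k) | k <- enum 'I_N]).
  by case: ifP => // _; rewrite mem_rev.
case/mapP => k _ -> /=; split.
  by apply/fintype.subsetP => z; rewrite !inE orbA => ->.
by rewrite -card_gt0 cards2.
Qed.

(** Consecutive points of a subdivided walk inside [A] are close together on
   the arc of an edge inside [A]. *)
Definition arc_step (A : {set V}) : rel I := fun i j =>
  `[< exists e s u, [/\ e \in edges G, e \subset A, 0 <= s <= 1, 0 <= u <= 1 &
     [/\ `|s - u| <= N.+1%:R^-1, sample_point i = arc e s
       & sample_point j = arc e u]] >].

Lemma path_lift_edge (A : {set V}) x y : adj G x y -> x \in A -> y \in A ->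
  path (arc_step A) (inl x) (lift_edge x y).
Proof.
move=> xy xA yA; apply/(pathP (inl x)) => i.
have N0 : 0 < N.+1%:R :> R by rewrite ltr0n.
pose m : seq I := [seq inr ([set x; y], k) | k <- enum 'I_N].
pose s := if `[< arc [set x; y] 0 = pos x >] then m else rev m.
have sm : size m = N by rewrite size_map size_enum_ord.
have sz : size s = N by rewrite /s; case: ifP => _; rewrite ?size_rev sm.
rewrite {1}/lift_edge -/s size_rcons sz ltnS => iN.
suff [f [fE f01 fd]] : exists f : nat -> R, [/\ forall j, (j <= N.+1)%N ->
    sample_point (nth (inl x) (inl x :: lift_edge x y) j) = arc [set x; y] (f j),
    forall j, (j <= N.+1)%N -> 0 <= f j <= 1 &
    forall j, `|f j - f j.+1| <= N.+1%:R^-1].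
  apply/asboolP; exists [set x; y], (f i), (f i.+1); split; rewrite ?f01 // 1?ltnW //.
    by apply/fintype.subsetP => z; rewrite !inE => /orP[] /eqP->.
  by split=> //; rewrite -fE // ltnW.
have dist (j : nat) : `|j%:R / N.+1%:R - j.+1%:R / N.+1%:R| <= N.+1%:R^-1 :> R.
  rewrite -mulrBl -natr1 opprD addrA subrr sub0r mulN1r normrN.
  by rewrite gtr0_norm ?lexx ?invr_gt0.
have in01 (j : nat) : (j <= N.+1)%N -> 0 <= (j%:R / N.+1%:R : R) <= 1.
  by move=> jN; rewrite divr_ge0 ?ler0n //= ler_pdivrMr // mul1r ler_nat.
have nthE j : (j <= N.+1)%N -> nth (inl x) (inl x :: lift_edge x y) j =
    if j == 0%N then inl x else if j == N.+1 then inl y else nth (inl x) s j.-1.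
  case: j => //= j jN; rewrite /lift_edge -/s nth_rcons sz eqSS.
  by have [//|jg|//] := ltngtP j N; move: jg; rewrite ltnNge -ltnS jN.
have [xy0|xy0] := boolP `[< arc [set x; y] 0 = pos x >].
  have sE : s = m by rewrite /s xy0.
  move/asboolP: xy0 => xy0.
  have xy1 : arc [set x; y] 1 = pos y.
    have [x' [y' [E e0 e1]]] := arc_ends dr xy.
    have xx' : x = x' by apply: (pos_inj dr); rewrite -xy0 -e0.
    rewrite e1; congr pos; have : y' \in [set x; y] by rewrite E !inE eqxx orbT.
    rewrite !inE => /orP[/eqP y'x|/eqP//]; have := adj_neq xy.
    have : y \in [set x; y] by rewrite !inE eqxx orbT.
    by rewrite E -xx' y'x !inE orbb => /eqP ->; rewrite eqxx.
  exists (fun j => j%:R / N.+1%:R); split=> // j jN; rewrite nthE //.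
  case: eqP => [->|/eqP j0]; first by rewrite mul0r /= xy0.
  case: eqP => [->|/eqP jN']; first by rewrite divff ?lt0r_neq0 //= xy1.
  have jlt : (j.-1 < N)%N by lia.
  rewrite sE /m (nth_map (Ordinal jlt)) ?size_enum_ord //=.
  by rewrite nth_enum_ord // prednK // lt0n.
have sE : s = rev m.
  by rewrite /s (negPf xy0).
move/asboolPn: xy0 => xy0.
have [xy1 xy0'] : arc [set x; y] 1 = pos x /\ arc [set x; y] 0 = pos y.
  have [x' [y' [E e0 e1]]] := arc_ends dr xy.
  have : x' \in [set x; y] by rewrite E !inE eqxx.
  rewrite !inE => /orP[/eqP x'x|/eqP x'y]; first by rewrite e0 x'x in xy0.
  rewrite e0 e1 x'y; split=> //; congr pos.
  have : x \in [set x; y] by rewrite !inE eqxx.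
  by rewrite E x'y !inE (negPf (adj_neq xy)) => /eqP.
exists (fun j => 1 - j%:R / N.+1%:R); split=> [j jN|j jN|j].
- rewrite nthE //.
  case: eqP => [->|/eqP j0]; first by rewrite mul0r subr0 /= xy1.
  case: eqP => [->|/eqP jN']; first by rewrite divff ?lt0r_neq0 // subrr /= xy0'.
  have jlt : (j.-1 < N)%N by lia.
  have rlt : (N - j.-1.+1 < N)%N by lia.
  rewrite sE nth_rev ?sm // (nth_map (Ordinal rlt)) ?size_enum_ord //=.
  rewrite nth_enum_ord //; congr (arc _ _).
  have -> : (N - j.-1.+1).+1 = (N.+1 - j)%N by lia.
  by rewrite natrB // mulrBl divff // lt0r_neq0.
- by have /andP[h1 h2] := in01 j jN; rewrite subr_ge0 h2 lerBlDr lerDl h1.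
- by rewrite opprB addrC addrA subrK distrC dist.
Qed.

Lemma path_lift_path (A : {set V}) x p : path (adj G) x p ->
  {subset x :: p <= A} -> path (arc_step A) (inl x) (lift_path x p).
Proof.
elim: p x => //= y p IH x /andP[xy yp] sub.
have sub' : {subset y :: p <= A} by move=> z zp; apply: sub; rewrite inE zp orbT.
rewrite cat_path last_rcons IH // andbT path_lift_edge //.
  by apply: sub; rewrite mem_head.
by apply: sub'; rewrite mem_head.
Qed.

Lemma prod_norm_ltP (z : R * R) (r : R) :
  (`|z| < r) = (`|z.1| < r) && (`|z.2| < r).
Proof. by rewrite prod_normE gt_max. Qed.

Lemma dist_lt_half (W : normedZmodType R) (m x y : W) (r : R) :
  `|m - x| < r / 2 -> `|m - y| < r / 2 -> `|x - y| < r.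
Proof.
rewrite distrC => h1 h2; apply: le_lt_trans (ler_distD m _ _) _.
by rewrite [ltRHS]splitr ltrD.
Qed.

Lemma segment_near (a b z s r : R) : 0 <= s <= 1 ->
  `|a - z| < r -> `|b - z| < r -> `|a + s * (b - a) - z| < r.
Proof.
move=> /andP[s0 s1]; rewrite !ltr_norml => /andP[a1 a2] /andP[b1 b2].
have conv (x y : R) : 0 < x -> 0 < y -> 0 < (1 - s) * x + s * y.
  move=> x0 y0; have [s_lt1|s_ge1] := ltrP s 1.
    by apply: ltr_pwDl; rewrite ?mulr_gt0 ?subr_gt0 // mulr_ge0 // ltW.
  have -> : s = 1 by apply/eqP; rewrite eq_le s1.
  by rewrite subrr mul0r add0r mul1r.
have := conv (a - z + r) (b - z + r); have := conv (r - (a - z)) (r - (b - z)).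
by move=> h1 h2; apply/andP; split; nra.
Qed.

End NoK5.

(** Polygonal curves close enough to the arcs of vertex-disjoint walks do not
   meet, whereas van Kampen's obstruction forces two of them to cross.  Only
   walks for independent edges of K_5 have to be disjoint, so any five
   connected pairwise adjacent vertex sets give such walks. *)
Theorem planar_no_K5_walks (R : realType) (V : finType) (G : sgraph V)
    (b : nat -> V) (P : nat -> nat -> seq V) : planar R G ->
  uniq [:: b 0; b 1; b 2; b 3; b 4]%N ->
  (forall i j, (i < j < 5)%N -> path (adj G) (b i) (P i j)) ->
  K5_drawing b P -> False.
Proof.
case=> pos [arc dr] bU wP [Pl Pd].
have [r r0 apart] := independent_arcs_apart dr.
have r4 : 0 < r / 4 by lra.
have [d d0 dP] := arcs_equicontinuous dr r4.
pose N := Num.bound (d^-1).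
have Nd : N.+1%:R^-1 < d.
  rewrite invf_plt ?posrE ?ltr0n //; apply: lt_trans (archi_boundP _) _.
    by rewrite invr_ge0 ltW.
  by rewrite ltr_nat.
pose I := (V + {set V} * 'I_N)%type.
have [q gen qP] := perturb_general_position (@sample_point R V pos arc N) r4.
pose b' i : I := inl (b i).
pose P' i j : seq I := lift_path pos arc N (b i) (P i j).
have dr' : K5_drawing b' P'.
  split=> [i j ij|i j k l ij kl U z].
    by rewrite /b' /P' last_lift_path Pl.
  move=> /(mem_lift_path (wP i j ij))[zi z0]; apply/negP.
  move=> /(mem_lift_path (wP k l kl))[zk _]; case/set0Pn: z0 => y yz.
  have := fintype.subsetP zi y yz; have := fintype.subsetP zk y yz.
  by rewrite ![y \in finset _]inE => yk yi; have := Pd _ _ _ _ ij kl U y yi; rewrite yk.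
have bU' : uniq [:: b' 0; b' 1; b' 2; b' 3; b' 4]%N.
  by have := bU; rewrite -(map_inj_uniq (f := inl : V -> I)) // => x y [].
suff nocross i j k l : (i < j < 5)%N -> (k < l < 5)%N -> uniq [:: i; j; k; l] ->
    cross_of q b' P' i j k l = 0.
  have := van_kampen5_eq1 gen bU' dr'.
  by rewrite /van_kampen5 !nocross // !addr0 => /eqP; rewrite eq_sym oner_eq0.
move=> ij kl U; apply/eqP/negPn/negP => /path_crossP[m [n [mP nP]]].
case/seg_cross_meet => s [t [s01 t01 E1 E2]].
have sub (x : V) (p : seq V) : {subset x :: p <= [set z in x :: p]}.
  by move=> y yp; rewrite finset.in_set.
have /(pathP (b' i))/(_ m mP)/asboolP := path_lift_path dr N (wP i j ij) (sub _ _).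
case=> e [s0 [s1 [eG eA s001 s101 [ss e0 e1]]]].
have /(pathP (b' k))/(_ n nP)/asboolP := path_lift_path dr N (wP k l kl) (sub _ _).
case=> f [u0 [u1 [fG fA u001 u101 [uu f0 f1]]]].
have ef : [disjoint e & f].
  rewrite disjoint_subset; apply/fintype.subsetP => z ze; rewrite !inE.
  apply/negP => zf; have := fintype.subsetP eA z ze; have := fintype.subsetP fA z zf.
  by rewrite !finset.in_set => zk zi; have := Pd _ _ _ _ ij kl U z zi; rewrite zk.
have nearseg g v0 v1 (x y : I) : g \in edges G -> 0 <= v0 <= 1 -> 0 <= v1 <= 1 ->
    `|v0 - v1| <= N.+1%:R^-1 -> sample_point pos arc x = arc g v0 ->
    sample_point pos arc y = arc g v1 ->
    `|q x - arc g v0| < r / 2 /\ `|q y - arc g v0| < r / 2.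
  move=> gG v00 v10 vv xE yE; have := qP x; have := qP y.
  have := dP g v0 v1 gG v00 v10 (le_lt_trans vv Nd).
  have r42 : r / 4 = (r / 2) / 2 by rewrite -mulrA -invfM -natrM.
  rewrite xE yE r42 => h1 h2 h3; split; first by apply: lt_trans h3 _; lra.
  by rewrite distrC (dist_lt_half (m := arc g v1)) // distrC.
have [a0 a1] := nearseg _ _ _ _ _ eG s001 s101 ss e0 e1.
have [c0 c1] := nearseg _ _ _ _ _ fG u001 u101 uu f0 f1.
have := apart e f s0 u0 eG fG ef s001 u001; apply/negP; rewrite -ltNge.
move: a0 a1 c0 c1; rewrite !prod_norm_ltP /=.
move=> /andP[a01 a02] /andP[a11 a12] /andP[c01 c02] /andP[c11 c12].
have := segment_near s01 a01 a11; have := segment_near s01 a02 a12.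
have := segment_near t01 c01 c11; have := segment_near t01 c02 c12.
by rewrite E1 E2 => h1 h2 h3 h4; rewrite (dist_lt_half h3 h1) (dist_lt_half h4 h2).
Qed.

(** The branch sets [B i] need not be connected themselves: walks between the
   chosen vertices inside the unions of two branch sets suffice. *)
Lemma planar_no_K5_minor (R : realType) (V : finType) (G : sgraph V)
    (b : nat -> V) (B : nat -> {set V}) (P : nat -> nat -> seq V) :
  planar R G ->
  (forall i, (i < 5)%N -> b i \in B i) ->
  (forall i j, (i < 5)%N -> (j < 5)%N -> i != j -> [disjoint B i & B j]) ->
  (forall i j, (i < j < 5)%N ->
     [/\ path (adj G) (b i) (P i j), last (b i) (P i j) = b j &
         {subset P i j <= B i :|: B j}]) ->
  False.
Proof.
move=> pG bB Bd PP.
have bd i j : (i < 5)%N -> (j < 5)%N -> i != j -> b i != b j.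
  move=> i5 j5 ij; apply: contraTneq (bB j j5) => <-.
  by rewrite (disjointFr (Bd _ _ i5 j5 ij)) ?bB.
apply: (planar_no_K5_walks (b := b) (P := P)) pG _ _ _.
- by rewrite /= !inE !negb_or !bd.
- by move=> i j /PP[].
- split=> [i j /PP[]//|i j k l ij kl U z].
  have sub i' j' : (i' < j' < 5)%N -> z \in b i' :: P i' j' -> z \in B i' :|: B j'.
    move=> ij'; have [_ _ s] := PP _ _ ij'; rewrite inE => /orP[/eqP->|/s//].
    by rewrite !inE bB //; lia.
  move=> /(sub _ _ ij) zi; apply/negP => /(sub _ _ kl) zk.
  move: U; rewrite /= !inE !negb_or => /and4P[/and3P[ij' ik il] /andP[jk jl] kl' _].
  have [i5 [j5 [k5 l5]]] : (i < 5 /\ j < 5 /\ k < 5 /\ l < 5)%N by lia.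
  move: zi zk; rewrite !inE => /orP[] zi.
    by rewrite !(disjointFr (Bd i _ _ _ _) zi).
  by rewrite !(disjointFr (Bd j _ _ _ _) zi).
Qed.

(** * Edges between the neighbours of a vertex *)

Section LinkBound.

Variables (V : finType) (G : sgraph V).

Definition inner_edges (W : {set V}) : {set {set V}} :=
  [set e in edges G | e \subset W].

Definition outer_nbrs (W U : {set V}) : {set V} :=
  [set x in W :\: U | [exists u in U, adj G u x]].

Definition set_connected (U : {set V}) : Prop :=
  forall x y, x \in U -> y \in U ->
    exists p, [/\ path (adj G) x p, last x p = y & {subset p <= U}].

Lemma set_connected1 x : set_connected [set x].
Proof. by move=> y z; rewrite !inE => /eqP-> /eqP->; exists [::]. Qed.

Lemma set_connectedU1 U w : set_connected U -> (exists2 u, u \in U & adj G u w) ->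
  set_connected (w |: U).
Proof.
move=> cU [u uU uw].
have toU x : x \in w |: U -> exists p, [/\ path (adj G) x p, last x p = u &
    {subset p <= w |: U}].
  rewrite !inE => /orP[/eqP->|xU].
    exists [:: u]; split=> //=; first by rewrite adj_sym uw.
    by move=> y; rewrite !inE => /eqP->; rewrite uU orbT.
  have [p [pp pl ps]] := cU _ _ xU uU; exists p; split=> // y /ps yU.
  by rewrite !inE yU orbT.
have fromU y : y \in w |: U -> exists p, [/\ path (adj G) u p, last u p = y &
    {subset p <= w |: U}].
  rewrite !inE => /orP[/eqP->|yU].
    exists [:: w]; split=> //=; first by rewrite uw.
    by move=> z; rewrite !inE => /eqP->; rewrite eqxx.
  have [p [pp pl ps]] := cU _ _ uU yU; exists p; split=> // z /ps zU.
  by rewrite !inE zU orbT.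
move=> x y /toU[p [pp pl ps]] /fromU[q [qp ql qs]].
exists (p ++ q); split; first by rewrite cat_path pp pl.
  by rewrite last_cat pl.
by move=> z; rewrite mem_cat => /orP[/ps|/qs].
Qed.

Definition nbrs_in (A : {set V}) (w : V) : {set V} := [set x in A | adj G w x].

(** Edges inside [A] at [w] are counted by their other end. *)
Lemma card_inner_edges_remove (A : {set V}) w :
  (#|inner_edges A| <= #|inner_edges (A :\ w)| + #|nbrs_in A w|)%N.
Proof.
rewrite -(cardsID (inner_edges (A :\ w))) leq_add //.
  by apply: subset_leq_card; apply: finset.subsetIr.
apply: leq_trans (leq_imset_card (fun x => [set w; x]) _).
apply: subset_leq_card; apply/fintype.subsetP => e.
rewrite !inE => /andP[nA /andP[eG eA]]; rewrite eG /= in nA.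
have we : w \in e.
  apply: contraNT nA => we; apply/fintype.subsetP => x xe.
  by rewrite !inE (fintype.subsetP eA) // andbT; apply: contraNneq we => <-.
have := fintype.subsetP (edges_card2 G) e eG; rewrite inE => /cards2P[x [y [xy E]]].
have [z zE] : exists z, e = [set w; z].
  move: we; rewrite E !inE => /orP[/eqP->|/eqP->]; first by exists y.
  by exists x; rewrite finset.setUC.
apply/imsetP; exists z => //; rewrite inE /adj -zE eG andbT.
by apply: (fintype.subsetP eA); rewrite zE !inE eqxx orbT.
Qed.

(** In a finite set where every vertex has two neighbours, the first vertex of
   a longest path sees two other vertices of that path, whence a cycle. *)
Lemma min_degree2_cycle (N : {set V}) : N != finset.set0 ->
  (forall w, w \in N -> (1 < #|nbrs_in N w|)%N) ->
  exists x y p z, [/\ path (adj G) x (y :: rcons p z), uniq (x :: y :: rcons p z),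
    adj G x z & {subset x :: y :: rcons p z <= N}].
Proof.
move=> /set0Pn[w0 w0N] deg2.
pose good n := `[< exists x p, [/\ path (adj G) x p, uniq (x :: p),
  {subset x :: p <= N} & size p = n] >].
have good0 : exists n, good n.
  exists 0%N; apply/asboolP; exists w0, [::]; split=> //.
  by move=> y; rewrite inE => /eqP->.
have bnd n : good n -> (n <= #|V|)%N.
  move=> /asboolP[x [p [_ /= /andP[_ up] _ <-]]].
  by rewrite -(card_uniqP up) max_card.
have [n /asboolP[x [p [xp up sp szp]]] maxn] := ex_maxnP good0 bnd.
have xN : x \in N by apply: sp; rewrite mem_head.
have inp w : w \in nbrs_in N x -> w \in p.
  rewrite inE => /andP[wN xw]; apply: contraT => wp.
  suff /maxn : good n.+1 by rewrite ltnn.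
  apply/asboolP; exists w, (x :: p); split => /=; last by rewrite szp.
  - by rewrite adj_sym xw.
  - by move: up => /= ->; rewrite inE negb_or wp !andbT eq_sym (adj_neq xw).
  - by move=> y; rewrite inE => /orP[/eqP->|/sp].
case: p xp up sp inp {szp} => [|y p] xp up sp inp.
  have /card_gt0P[w /inp//] : (0 < #|nbrs_in N x|)%N by apply: ltnW; apply: deg2.
have [z] : exists2 z, z \in nbrs_in N x & z != y.
  have /card_gt1P[a [c [aN cN ac]]] := deg2 x xN.
  have [ay|] := eqVneq a y; last by exists a.
  by exists c => //; rewrite -ay eq_sym.
move=> zN zy; have := inp z zN; rewrite inE (negPf zy) /= => zp.
case/splitPr: zp xp up sp {inp} => p1 p2 xp up sp.
exists x, y, p1, z; split.
- by move: xp; rewrite /= cat_path rcons_path /= => /and3P[-> -> /andP[-> _]].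
- have : subseq (x :: y :: rcons p1 z) (x :: y :: p1 ++ z :: p2).
    by rewrite /= !eqxx -cat_rcons prefix_subseq.
  by move/subseq_uniq; apply.
- by move: zN; rewrite inE => /andP[].
- move=> t; rewrite 2!inE => tp; apply: sp; rewrite -cat_rcons 2!inE mem_cat.
  by case/or3P: tp => ->; rewrite ?orbT.
Qed.

(** Contract a connected part of the link as long as the number of edges stays
   above twice the number of vertices.  When this stops, every vertex next to
   the contracted part [U] has two neighbours next to [U]; a cycle among these
   together with [U] and the apex [v] is a K_5 minor. *)
Theorem link_inner_edges (R : realType) v (W : {set V}) : planar R G ->
  (forall w, w \in W -> adj G v w) -> (#|inner_edges W| <= 2 * #|W|)%N.
Proof.
move=> pG; move: {2}#|W| (leqnn #|W|) => n; elim: n W => [|n IH] W.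
  rewrite leqn0 cards_eq0 => /eqP-> _; rewrite cards0 muln0 leqn0 cards_eq0.
  apply/eqP/setP => e; rewrite !inE finset.subset0; apply/negP => /andP[eG /eqP e0].
  by have := fintype.subsetP (edges_card2 G) e eG; rewrite inE e0 cards0.
move=> Wn vW; rewrite leqNgt; apply/negP => dense.
pose f U := (#|inner_edges (W :\: U)| + #|outer_nbrs W U|)%N.
pose good (U : {set V}) := `[< [/\ U != finset.set0, U \subset W, set_connected U &
  (2 * (#|W :\: U| + 1) < f U)%N] >].
have [w0 w0W] : exists w, w \in W.
  apply/set0Pn; apply: contraTneq dense => ->; rewrite -leqNgt.
  rewrite (_ : inner_edges _ = finset.set0) ?cards0 //.
  apply/setP => e; rewrite !inE finset.subset0; apply/negP => /andP[eG /eqP e0].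
  by have := fintype.subsetP (edges_card2 G) e eG; rewrite inE e0 cards0.
have nbrs1 : outer_nbrs W [set w0] = nbrs_in W w0.
  apply/setP => x; rewrite !inE; apply/andP/andP.
    by move=> [/andP[_ ->] /existsP[u]]; rewrite !inE => /andP[/eqP-> ->].
  move=> [xW w0x]; split; first by rewrite xW andbT eq_sym (adj_neq w0x).
  by apply/existsP; exists w0; rewrite !inE eqxx.
have good1 : good [set w0].
  apply/asboolP; split; rewrite ?finset.sub1set //.
  - by rewrite -card_gt0 cards1.
  - exact: set_connected1.
  - have := card_inner_edges_remove W w0; rewrite /f nbrs1.
    by have := cardsD1 w0 W; rewrite w0W; lia.
have [U /asboolP[U0 UW cU fU] Umax] : exists2 U, good U &
    forall U', good U' -> (#|U'| <= #|U|)%N.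
  by case: (arg_maxnP (fun U : {set V} => #|U|) good1) => U gU mU; exists U.
pose N := outer_nbrs W U.
have NW x : x \in N -> [/\ x \in W, x \notin U & exists2 u, u \in U & adj G u x].
  rewrite !inE => /andP[/andP[-> ->] /existsP[u /andP[uU ux]]].
  by split=> //; exists u.
have ltWU : (#|W :\: U| < #|W|)%N.
  rewrite ltn_neqAle subset_leq_card ?finset.subsetDl // andbT.
  have := cardsID U W; rewrite (finset.setIidPr UW) => <-.
  by rewrite -[X in X != _]add0n eqn_add2r eq_sym -lt0n card_gt0.
have N0 : N != finset.set0.
  apply/eqP => N0; move: fU; rewrite /f -/N N0 cards0 addn0.
  have := IH (W :\: U); have -> : (#|W :\: U| <= n)%N by lia.
  move=> /(_ isT) h h'.
  have : (#|inner_edges (W :\: U)| <= 2 * #|W :\: U|)%N.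
    by apply: h => w; rewrite inE => /andP[_ /vW].
  by lia.
have deg2 w : w \in N -> (1 < #|nbrs_in N w|)%N.
  move=> wN; have [wW wU [u uU uw]] := NW w wN.
  have small : (f (w |: U) <= 2 * (#|W :\: (w |: U)| + 1))%N.
    rewrite leqNgt; apply/negP => big.
    have : good (w |: U).
      apply/asboolP; split=> //.
      - by apply/set0Pn; exists w; rewrite !inE eqxx.
      - by rewrite finset.subUset finset.sub1set wW.
      - by apply: set_connectedU1 => //; exists u.
    by move/Umax; rewrite cardsU1 wU ltnn.
  have E1 : W :\: (w |: U) = (W :\: U) :\ w.
    by apply/setP => x; rewrite !inE negb_or andbA.
  have E2 : #|W :\: U| = #|(W :\: U) :\ w|.+1.
    by rewrite (cardsD1 w (W :\: U)) !inE wW wU.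
  have E3 := card_inner_edges_remove (W :\: U) w.
  have E4 : outer_nbrs W (w |: U) =
      (N :\ w) :|: (nbrs_in (W :\: U) w :\: nbrs_in N w).
    apply/setP => x; rewrite !inE negb_or.
    have -> : [exists u0 in w |: U, adj G u0 x] =
        adj G w x || [exists u0 in U, adj G u0 x].
      apply/existsP/orP => [[y]|[wx|/existsP[y /andP[yU yx]]]].
      - rewrite !inE => /andP[/orP[/eqP-> ->|yU yx]]; first by left.
        by right; apply/existsP; exists y; rewrite yU.
      - by exists w; rewrite !inE eqxx.
      - by exists y; rewrite !inE yU orbT.
    move: [exists u0 in U, adj G u0 x] => ex.
    case wx: (adj G w x); rewrite ?andbT ?andbF ?orbF /=; last first.
      by case: (x == w); case: (x \in W); case: (x \in U); case: ex.
    have xw : x != w by rewrite eq_sym (adj_neq wx).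
    by rewrite xw /=; case: (x \in W); case: (x \in U); case: ex.
  have E5 : #|outer_nbrs W (w |: U)| =
      (#|N :\ w| + (#|nbrs_in (W :\: U) w| - #|nbrs_in N w|))%N.
    rewrite E4 cardsU (cardsD (nbrs_in _ _)).
    rewrite (_ : nbrs_in (W :\: U) w :&: nbrs_in N w = nbrs_in N w); last first.
      apply/finset.setIidPr; apply/fintype.subsetP => x; rewrite !inE.
      by move=> /andP[/andP[-> _] ->].
    rewrite (_ : _ :&: _ = finset.set0) ?cards0 ?subn0 //.
    apply/setP => x; rewrite !inE; move: [exists u0 in U, adj G u0 x] => ex.
    apply/negP; case: (x \in W); case: (x \in U); case: (adj G w x); rewrite ?andbF //=.
    by case: ex; rewrite ?andbF.
  have E6 : #|N| = #|N :\ w|.+1 by rewrite (cardsD1 w N) wN.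
  have E7 : (#|nbrs_in N w| <= #|nbrs_in (W :\: U) w|)%N.
    by apply: subset_leq_card; apply/fintype.subsetP => x; rewrite !inE => /andP[/andP[-> _] ->].
  move: fU small; rewrite /f -/N E5 E1 E2 E6.
  move: E3 E7; clear; lia.
have [x [y [p [z [xp up xz sN]]]]] := min_degree2_cycle N0 deg2.
have [u0 u0U] := set0Pn _ U0.
have toN w : w \in N -> exists q, [/\ path (adj G) u0 (rcons q w), {subset q <= U}
    & last u0 (rcons q w) = w].
  move=> /NW[wW wU [u uU uw]]; have [q [pq lq sq]] := cU _ _ u0U uU.
  by exists q; rewrite rcons_path pq lq last_rcons.
have [xN yN zN] : [/\ x \in N, y \in N & z \in N].
  by split; apply: sN; rewrite !inE ?mem_rcons ?inE ?eqxx ?orbT.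
have [qx [qx1 qx2 qx3]] := toN x xN; have [qy [qy1 qy2 qy3]] := toN y yN.
have [qz [qz1 qz2 qz3]] := toN z zN.
pose b := nth v [:: v; u0; x; y; z].
pose B := nth finset.set0 [:: [set v]; U; [set x]; [set t in y :: p]; [set z]].
pose P i j := nth [::] (nth [::] [:: [:: [::]; [:: u0]; [:: x]; [:: y]; [:: z]];
  [:: [::]; [::]; rcons qx x; rcons qy y; rcons qz z];
  [:: [::]; [::]; [::]; [:: y]; [:: z]];
  [:: [::]; [::]; [::]; [::]; rcons p z]] i) j.
have vNW w : w \in W -> v != w by move=> /vW/adj_neq.
have subW w : w \in U -> w \in W by apply: fintype.subsetP.
have pN w : w \in y :: p -> w \in N.
  move=> wp; apply: sN; rewrite 2!inE mem_rcons inE.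
  by move: wp; rewrite inE => /orP[]->; rewrite !orbT.
apply: (planar_no_K5_minor (b := b) (B := B) (P := P)) pG _ _ _.
- by case=> [|[|[|[|[|]]]]] //= _; rewrite ?inE ?eqxx.
- suff dis i j : (i < j < 5)%N -> [disjoint B i & B j].
    move=> i j i5 j5; rewrite neq_ltn => /orP[] ij; last rewrite disjoint_sym.
      by apply: dis; rewrite ij.
    by apply: dis; rewrite ij.
  move: up; rewrite /= !inE !mem_rcons !inE !negb_or rcons_uniq.
  move=> /and3P[/and3P[xy xz' xp'] /andP[yz yp] /andP[zp _]].
  have Uout w : w \in N -> w \notin U by move=> /NW[].
  have NinW w : w \in N -> w \in W by move=> /NW[].
  have d1 (A : {set V}) w : w \notin A -> [disjoint A & [set w]].
    by move=> wA; rewrite disjoint_sym disjoints1.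
  move=> ij; rewrite disjoint_sym.
  have vout w : w \in N -> v != w by move=> /NinW/vNW.
  have vU : v \notin U by apply/negP => /subW/vNW; rewrite eqxx.
  have vp : v \notin p.
    apply/negP => vp; have vyp : v \in y :: p by rewrite inE vp orbT.
    by have := vNW _ (NinW _ (pN _ vyp)); rewrite eqxx.
  have Up : [disjoint [set t in y :: p] & U].
    rewrite disjoint_subset; apply/fintype.subsetP => t; rewrite inE => /pN/Uout.
    by rewrite inE.
  case: i j ij => [|[|[|[|i]]]] [|[|[|[|[|j]]]]] //= ij; rewrite /B /=.
  all: try (apply: d1 || (rewrite disjoint_sym; apply: d1)).
  all: rewrite ?inE ?negb_or ?vout ?(Uout x xN) ?(Uout z zN) ?vU ?xy ?xz' ?xp' //.
  - by rewrite eq_sym yz.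
  - by move: ij; rewrite andbC.
- move: xp; rewrite /= rcons_path => /and3P[xy yp pz].
  have m1 (w : V) (A : {set V}) : w \in A -> {subset [:: w] <= A}.
    by move=> wA t; rewrite inE => /eqP->.
  have m2 (q : seq V) (w : V) (A : {set V}) : {subset q <= U} -> w \in A ->
      {subset rcons q w <= U :|: A}.
    move=> qU wA t; rewrite mem_rcons !inE => /orP[/eqP->|/qU->//].
    by rewrite wA orbT.
  move=> i j; rewrite andbC.
  case: i j => [|[|[|[|[|i]]]]] [|[|[|[|[|j]]]]] //= _; split=> //=;
    rewrite ?last_rcons ?vW ?andbT //; try by [case: (NW x xN)|case: (NW y yN)|case: (NW z zN)].
  all: try by apply: m1; rewrite !inE ?mem_head ?eqxx ?u0U ?orbT.
  all: try by apply: m2; rewrite ?inE ?eqxx.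
  all: try by rewrite subW.
  all: try by rewrite rcons_path yp.
  move=> t; rewrite mem_rcons !inE => /orP[/eqP->|->]; rewrite ?eqxx ?orbT //.
Qed.

End LinkBound.

(** * Moments of inclusion indicators *)

Section Sampling.

Variables (R : realType) (V : finType) (p : R).
Implicit Types (X Y : {set V} -> R) (A B S : {set V}).

Lemma expectD X Y : sample_expect p (fun S => X S + Y S) =
  sample_expect p X + sample_expect p Y.
Proof. by rewrite -big_split; apply: eq_bigr => S _; rewrite mulrDr. Qed.

Lemma expectZ (c : R) X :
  sample_expect p (fun S => c * X S) = c * sample_expect p X.
Proof. by rewrite mulr_sumr; apply: eq_bigr => S _; rewrite mulrCA. Qed.

Lemma expect_sum (J : finType) (Q : pred J) (X : J -> {set V} -> R) :
  sample_expect p (fun S => \sum_(j | Q j) X j S) =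
  \sum_(j | Q j) sample_expect p (X j).
Proof.
rewrite /sample_expect exchange_big /=; apply: eq_bigr => S _.
by rewrite mulr_sumr.
Qed.

Lemma eq_expect X Y : X =1 Y -> sample_expect p X = sample_expect p Y.
Proof. by move=> XY; apply: eq_bigr => S _; rewrite XY. Qed.

Lemma expect_subset A : sample_expect p (fun S => (A \subset S)%:R) = p ^+ #|A|.
Proof.
rewrite /sample_expect.
under eq_bigr => S _.
  have -> : sample_prob p S * (A \subset S)%:R =
      \prod_x (if x \in S then p else (1 - p) * (x \notin A)%:R).
    have [AS|/fintype.subsetPn[x xA xS]] := boolP (A \subset S); last first.
      by rewrite mulr0 (bigD1 x) //= (negPf xS) xA mulr0 mul0r.
    rewrite mulr1; apply: eq_bigr => x _; case: ifPn => // xS.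
    by rewrite (contra (fintype.subsetP AS x) xS) mulr1.
  over.
rewrite -[LHS]/(\sum_(S in {set V}) _) -bigA_distr /= (bigID (mem A)) /=.
rewrite [X in X * _](eq_bigr (fun=> p)) => [|x ->]; last by rewrite mulr0 addr0.
rewrite [X in _ * X]big1 ?mulr1 => [|x ->]; last by rewrite mulr1 addrC subrK.
by rewrite prodr_const.
Qed.

Lemma expect_cst (c : R) : sample_expect p (fun _ : {set V} => c) = c.
Proof.
have /= := expect_subset finset.set0; rewrite cards0 expr0 => E.
rewrite -[RHS]mulr1 -E -expectZ; apply: eq_expect => S.
by rewrite finset.sub0set mulr1.
Qed.

Hypothesis p01 : 0 < p <= 1.

Lemma sample_prob_ge0 S : 0 <= sample_prob p S.
Proof.
case/andP: p01 => p0 p1; apply: prodr_ge0 => x _.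
by case: ifP; rewrite ?subr_ge0 // ltW.
Qed.

Lemma ler_expect X Y : (forall S, X S <= Y S) ->
  sample_expect p X <= sample_expect p Y.
Proof. by move=> XY; apply: ler_sum => S _; rewrite ler_wpM2l ?sample_prob_ge0. Qed.

(** Covariances of rescaled inclusion indicators vanish for disjoint sets and
   are at most this kernel otherwise. *)
Definition overlap A B : R := if [disjoint A & B] then 0 else p ^- #|A :&: B|.

(** The covariance of two rescaled indicators is [p ^- #|A :&: B| - 1]. *)
Lemma variance_horvitz_thompson (J : finType) (Q : pred J) (c : J -> R)
    (A : J -> {set V}) (k : R) : (forall j, Q j -> `|c j| <= k) ->
  sample_expect p (fun S =>
    (\sum_(j | Q j) c j * ((A j \subset S)%:R / p ^+ #|A j|)
       - \sum_(j | Q j) c j) ^+ 2) <=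
  k ^+ 2 * \sum_(i | Q i) \sum_(j | Q j) overlap (A i) (A j).
Proof.
move=> ck; have [p0 p1] := andP p01.
have pn0 : p != 0 by rewrite gt_eqF.
pose Z j S : R := (A j \subset S)%:R / p ^+ #|A j| - 1.
have -> : sample_expect p (fun S =>
    (\sum_(j | Q j) c j * ((A j \subset S)%:R / p ^+ #|A j|)
       - \sum_(j | Q j) c j) ^+ 2) =
    \sum_(i | Q i) \sum_(j | Q j) (c i * c j) * sample_expect p (fun S => Z i S * Z j S).
  under [RHS]eq_bigr => i _ do under eq_bigr => j _ do rewrite -expectZ.
  under [RHS]eq_bigr => i _ do rewrite -expect_sum.
  rewrite -expect_sum; apply: eq_expect => S.
  rewrite -sumrB; under eq_bigr => j _ do rewrite -[X in _ - X]mulr1 -mulrBr -/(Z j S).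
  rewrite expr2 mulr_suml; apply: eq_bigr => i _; rewrite mulr_sumr.
  by apply: eq_bigr => j _; rewrite mulrACA.
have EZ i j : sample_expect p (fun S => Z i S * Z j S) =
    p ^- #|A i :&: A j| - 1.
  have -> : sample_expect p (fun S => Z i S * Z j S) =
      sample_expect p (fun S => (p ^- #|A i| * p ^- #|A j|) * (A i :|: A j \subset S)%:R
        + (- p ^- #|A i|) * (A i \subset S)%:R
        + ((- p ^- #|A j|) * (A j \subset S)%:R + 1)).
    apply: eq_expect => S; rewrite finset.subUset /Z.
    by case: (A i \subset S); case: (A j \subset S); rewrite /= ?mul0r ?mulr0 ?mulr1; ring.
  rewrite !expectD !expectZ !expect_subset expect_cst !mulNr !mulVf ?expf_neq0 //.
  have /(congr1 (fun n => p ^+ n)) := cardsUI (A i) (A j); rewrite !exprD => E.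
  have -> : p ^+ #|A i :|: A j| = p ^+ #|A i| * p ^+ #|A j| * p ^- #|A i :&: A j|.
    by rewrite -E mulfK // expf_neq0.
  rewrite mulrA [X in X * _]mulrACA !mulVf ?expf_neq0 // !mul1r; ring.
rewrite mulr_sumr; apply: ler_sum => i Qi; rewrite mulr_sumr; apply: ler_sum => j Qj.
have pinv n : 1 <= p ^- n by rewrite -exprVn exprn_ege1 // invf_ge1.
rewrite EZ /overlap; case: ifPn => [dis|_].
  have -> : A i :&: A j = finset.set0 by apply/eqP; rewrite setI_eq0.
  by rewrite cards0 expr0 invr1 subrr !mulr0.
have k0 : 0 <= k by apply: le_trans (ck i Qi); apply: normr_ge0.
apply: le_trans (_ : k ^+ 2 * (p ^- #|A i :&: A j| - 1) <= _).
  apply: ler_wpM2r; first by rewrite subr_ge0.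
  apply: le_trans (ler_norm _) _; rewrite normrM expr2.
  by apply: ler_pM => //; apply: ck.
by rewrite ler_wpM2l ?exprn_ge0 // gerBl.
Qed.

End Sampling.

(** * Triangles of planar graphs *)

Section TriangleCounts.

Variables (V : finType) (G : sgraph V).
Implicit Types (x y z : V) (e T : {set V}).

Lemma card_edge e : e \in edges G -> #|e| = 2%N.
Proof. by move/(fintype.subsetP (edges_card2 G)); rewrite inE => /eqP. Qed.

Lemma pair_eq e x y : #|e| = 2%N -> x \in e -> y \in e -> x != y -> e = [set x; y].
Proof.
move=> e2 xe ye xy; apply/esym/eqP; rewrite eqEcard e2 cards2 xy andbT.
by apply/fintype.subsetP => z; rewrite !inE => /orP[]/eqP->.
Qed.

Lemma triangleP T : reflect (#|T| = 3%N /\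
  forall e, e \subset T -> #|e| = 2%N -> e \in edges G) (T \in triangles G).
Proof.
rewrite inE; apply: (iffP andP) => [[/eqP T3 H]|[T3 H]]; split; rewrite ?T3 //.
- move=> e eT /eqP/cards2P[x [y [xy E]]]; move: eT; rewrite E finset.subUset !finset.sub1set.
  move=> /andP[xT yT]; have /forall_inP/(_ x xT)/forall_inP/(_ y yT) := H.
  by rewrite xy.
- apply/forall_inP => x xT; apply/forall_inP => y yT; apply/implyP => xy.
  by apply: H; rewrite ?cards2 ?xy // finset.subUset !finset.sub1set xT.
Qed.

Definition tri_edges T : {set {set V}} := inner_edges G T.

Lemma card_tri_edges T : T \in triangles G -> #|tri_edges T| = 3%N.
Proof.
case/triangleP => T3 H; rewrite -[RHS]/('C(3, 2)) -T3 -cards_draws.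
apply: eq_card => e; rewrite !inE.
have [eT|] := boolP (e \subset T); rewrite ?andbT ?andbF //=.
apply/idP/eqP => [eG|e2]; first by rewrite card_edge.
exact: H.
Qed.

Definition codeg e : nat := #|[set T in triangles G | e \subset T]|.

Lemma deg_le_maxdeg x : (deg G x <= maxdeg G)%N.
Proof. exact: leq_bigmax. Qed.

Lemma setD1_inj x T T' : x \in T -> x \in T' -> T :\ x = T' :\ x -> T = T'.
Proof. by move=> xT xT' E; rewrite -(finset.setD1K xT) E finset.setD1K. Qed.

Lemma card_triangleD1 T x : T \in triangles G -> x \in T -> T :\ x \in edges G.
Proof.
case/triangleP => T3 H xT; apply: H; first exact: finset.subD1set.
by move: T3; rewrite (cardsD1 x) xT => -[].
Qed.

Lemma codeg_le_maxdeg e : e \in edges G -> (codeg e <= maxdeg G)%N.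
Proof.
move=> eG; have /eqP/cards2P[x [y [xy E]]] := card_edge eG.
apply: leq_trans (deg_le_maxdeg x).
have sub T : T \in [set T in triangles G | e \subset T] ->
    [/\ T \in triangles G, x \in T & y \in T].
  by rewrite inE E finset.subUset !finset.sub1set => /and3P[].
rewrite /codeg -(card_in_imset (f := fun T : {set V} => T :\ y)); last first.
  by move=> T T' /sub[_ _ yT] /sub[_ _ yT']; apply: setD1_inj.
apply: subset_leq_card; apply/fintype.subsetP => _ /imsetP[T /sub[TG xT yT] ->].
by rewrite inE card_triangleD1 // !inE xy.
Qed.

Definition nbrs x : {set V} := [set y | adj G x y].

Lemma card_nbrs_in_edges x (H : {set {set V}}) : H \subset edges G ->
  (#|[set y | [set x; y] \in H]| <= #|[set e in H | x \in e]|)%N.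
Proof.
move=> HG; rewrite -(card_in_imset (f := fun y => [set x; y])).
  apply: subset_leq_card; apply/fintype.subsetP => _ /imsetP[y yH ->].
  by move: yH; rewrite !inE eqxx => ->.
move=> y z; rewrite !inE => /(fintype.subsetP HG) yH _ E.
have : y \in [set x; z] by rewrite -E !inE eqxx orbT.
by rewrite !inE => /orP[/eqP yx|/eqP//]; have := adj_neq yH; rewrite yx eqxx.
Qed.

Lemma sum_edge_triangles : (\sum_(e in edges G) codeg e = 3 * ntriangles G)%N.
Proof.
rewrite /codeg; under eq_bigr => e _ do rewrite -sum1dep_card.
rewrite (exchange_big_dep (mem (triangles G))) /=; last by move=> e T _ /andP[].
rewrite /ntriangles -sum1_card big_distrr /=; apply: eq_bigr => T TG.
rewrite -(card_tri_edges TG) -sum1_card muln1; apply: eq_bigl => e.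
by rewrite TG finset.in_set.
Qed.

Variable R : realType.
Hypothesis pG : planar R G.

(** Triangles at [x] are edges between neighbours of [x]. *)
Lemma triangles_at_le x :
  (#|[set T in triangles G | x \in T]| <= 2 * maxdeg G)%N.
Proof.
rewrite -(card_in_imset (f := fun T : {set V} => T :\ x)); last first.
  by move=> T T'; rewrite !inE => /andP[_ xT] /andP[_ xT']; apply: setD1_inj.
apply: (@leq_trans #|inner_edges G (nbrs x)|).
  apply: subset_leq_card; apply/fintype.subsetP => _ /imsetP[T + ->].
  rewrite [_ \in finset _]inE => /andP[TG xT]; rewrite inE card_triangleD1 //=.
  apply/fintype.subsetP => y; rewrite !inE => /andP[yx yT].
  have [_ H] := triangleP _ TG; rewrite /adj; apply: H.
    by rewrite finset.subUset !finset.sub1set xT.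
  by rewrite cards2 eq_sym yx.
apply: leq_trans (link_inner_edges (v := x) pG _) _.
  by move=> w; rewrite inE.
rewrite leq_mul2l /=; apply: leq_trans (deg_le_maxdeg x).
exact: card_nbrs_in_edges.
Qed.

(** Two marked edges of a triangle share a vertex [x], and the third edge is
   an edge between neighbours of [x] along marked edges. *)
Lemma triangles_two_marked (H : {set {set V}}) : H \subset edges G ->
  (#|[set T in triangles G | (1 < #|[set e in H | e \subset T]|)%N]|
     <= 4 * #|H|)%N.
Proof.
move=> HG; pose W x := [set y | [set x; y] \in H].
pose F x := [set T in triangles G | (x \in T) && (T :\ x \in inner_edges G (W x))].
apply: (@leq_trans #|\bigcup_x F x|).
  apply: subset_leq_card; apply/fintype.subsetP => T.
  rewrite [_ \in finset _]inE => /andP[TG /card_gt1P[e [f []]]].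
  rewrite !inE => /andP[eH eT] /andP[fH fT] ef.
  have e2 := card_edge (fintype.subsetP HG _ eH).
  have f2 := card_edge (fintype.subsetP HG _ fH).
  have [T3 _] := triangleP _ TG.
  have efT : e :|: f \subset T by rewrite finset.subUset eT.
  have := subset_leq_card efT; have := cardsUI e f; rewrite e2 f2 T3 => cUI c3.
  have cI1 : (#|e :&: f| < 2)%N.
    rewrite ltnNge; apply: contra ef => ge2.
    have /eqP <- : e :&: f == e by rewrite eqEcard finset.subsetIl e2.
    by rewrite eqEcard finset.subsetIr f2.
  have : (0 < #|e :&: f|)%N by lia.
  case/card_gt0P => x; rewrite inE => /andP[xe xf].
  have efE : e :|: f = T.
    by apply/eqP; rewrite eqEcard efT T3; move: cUI c3 cI1; clear; lia.
  have xT : x \in T by rewrite -efE !inE xe.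
  apply/bigcupP; exists x => //; rewrite inE TG xT inE card_triangleD1 //=.
  apply/fintype.subsetP => y; rewrite in_setD1 -efE finset.in_setU.
  move=> /andP[yx /orP[ye|yf]]; rewrite inE.
    by rewrite -(pair_eq e2 xe ye) // eq_sym.
  by rewrite -(pair_eq f2 xf yf) // eq_sym.
apply: leq_trans (_ : \sum_x #|F x| <= _)%N.
  elim/big_rec2: _ => [|x m A _ h]; first by rewrite cards0.
  by apply: leq_trans (leq_card_setU _ _) _; rewrite leq_add2l.
apply: (@leq_trans (\sum_x 2 * #|[set e in H | x \in e]|)).
  apply: leq_sum => x _.
  rewrite -(card_in_imset (f := fun T : {set V} => T :\ x)); last first.
    move=> T T'; rewrite !inE => /and3P[_ xT _] /and3P[_ xT' _].
    exact: setD1_inj.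
  apply: (@leq_trans #|inner_edges G (W x)|).
    apply: subset_leq_card; apply/fintype.subsetP => _ /imsetP[T + ->].
    by rewrite inE => /and3P[].
  apply: leq_trans (link_inner_edges (v := x) pG _) _.
    by move=> w; rewrite inE => /(fintype.subsetP HG).
  by rewrite leq_mul2l /= card_nbrs_in_edges.
rewrite -big_distrr /= -(mulnA 2 2) leq_mul2l /=.
under eq_bigr => x _ do rewrite -sum1dep_card.
rewrite (exchange_big_dep (mem H)) /=; last by move=> x e _ /andP[].
rewrite -sum1_card big_distrr /=; apply: leq_sum => e eH.
rewrite muln1 (_ : (\sum_(i | _) 1)%N = #|e|).
  by rewrite (card_edge (fintype.subsetP HG _ eH)).
by rewrite -sum1_card; apply: eq_bigl => x; rewrite eH.
Qed.

End TriangleCounts.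

(** * Estimators from sampled edges and triangles *)

Section Estimator.

Variables (R : realType) (V : finType) (p : R).
Variables (L : pred nat) (a : R) (w : nat -> R).
Implicit Types (G O : sgraph V) (S e T : {set V}) (j : {set V} * {set V}).

(** An edge is light when the number of triangles on it satisfies [L]. *)
Definition heavy_edges G : {set {set V}} := [set e in edges G | ~~ L (codeg G e)].

Definition num_heavy G T : nat := #|[set e in heavy_edges G | e \subset T]|.

Definition light_flag G : pred ({set V} * {set V}) := fun j =>
  [&& j.1 \in triangles G, j.2 \in edges G, j.2 \subset j.1 & L (codeg G j.2)].

(** Triangles seen through a sampled light edge, plus a correction, according to
   the number of heavy edges, by the fully sampled triangles. *)
Definition triangle_count O S : R :=
  \sum_(j | light_flag O j) a * ((j.2 \subset S)%:R / p ^+ #|j.2|) +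
  \sum_(T | T \in triangles O) w (num_heavy O T) * ((T \subset S)%:R / p ^+ #|T|).

Lemma observed_edge G S e : e \in edges G -> e \subset S ->
  e \in edges (nbhd_sample G S).1.
Proof.
move=> eG eS; rewrite inE eG /= (finset.setIidPl eS) -card_gt0.
by rewrite (card_edge eG).
Qed.

Lemma observed_edges_sub G S e : e \in edges (nbhd_sample G S).1 -> e \in edges G.
Proof. by rewrite inE => /andP[]. Qed.

(** Every edge of a triangle meets every other, so a triangle with a sampled edge
   is observed entirely. *)
Lemma observed_triangle G S e T : #|e| = 2%N -> e \subset S -> e \subset T ->
  (T \in triangles (nbhd_sample G S).1) = (T \in triangles G).
Proof.
move=> e2 eS eT; apply/triangleP/triangleP => -[T3 H]; split=> // f fT f2.
  exact: observed_edges_sub (H f fT f2).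
rewrite inE H //=; have efT : e :|: f \subset T by rewrite finset.subUset eT.
have : (0 < #|e :&: f|)%N.
  by have := subset_leq_card efT; have := cardsUI e f; rewrite e2 f2 T3; lia.
case/card_gt0P => x; rewrite inE => /andP[xe xf].
by apply/set0Pn; exists x; rewrite inE xf (fintype.subsetP eS).
Qed.

Lemma observed_codeg G S e : e \in edges G -> e \subset S ->
  codeg (nbhd_sample G S).1 e = codeg G e.
Proof.
move=> eG eS; apply: eq_card => T; rewrite finset.in_set [RHS]finset.in_set.
have [eT|] := boolP (e \subset T); last by rewrite !andbF.
by rewrite (observed_triangle _ (card_edge eG) eS eT).
Qed.

Lemma observed_num_heavy G S T : T \subset S ->
  num_heavy (nbhd_sample G S).1 T = num_heavy G T.
Proof.
move=> TS; apply: eq_card => e; rewrite !finset.in_set.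
have [eT|] := boolP (e \subset T); last by rewrite !andbF.
have eS := fintype.subset_trans eT TS.
have [eG|neG] := boolP (e \in edges G).
  by rewrite observed_codeg //; have := observed_edge eG eS; rewrite inE eG /= => ->.
by [].
Qed.

(** Hence the count depends on the observation only, although its weights refer
   to numbers of triangles on edges. *)
Lemma triangle_count_observed G S :
  triangle_count (nbhd_sample G S).1 S = triangle_count G S.
Proof.
congr (_ + _).
  rewrite big_mkcond [RHS]big_mkcond; apply: eq_bigr => -[T e] _ /=.
  have [eS|] := boolP (e \subset S); last by rewrite !mul0r !mulr0 !if_same.
  rewrite /light_flag /=; have [eG|neG] := boolP (e \in edges G); last first.
    by rewrite (contraNF (@observed_edges_sub G S e) neG) !andbF.
  rewrite (observed_edge eG eS) observed_codeg //=.
  have [eT|] := boolP (e \subset T); last by rewrite !andbF.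
  by rewrite (observed_triangle _ (card_edge eG) eS eT).
rewrite big_mkcond [RHS]big_mkcond; apply: eq_bigr => T _.
have [TS|] := boolP (T \subset S); last by rewrite !mul0r !mulr0 !if_same.
rewrite observed_num_heavy //.
have [T2|T2] := leqP 2 #|T|; last first.
  have noT O : (T \in triangles O) = false.
    by apply/negP => /triangleP[T3]; rewrite T3 in T2.
  by rewrite !noT.
have /card_gt1P[x [y [xT yT xy]]] := T2.
have xyT : [set x; y] \subset T by rewrite finset.subUset !finset.sub1set xT.
by rewrite (@observed_triangle G S [set x; y]) ?cards2 ?xy // (fintype.subset_trans xyT).
Qed.

Lemma num_light_heavy G T : T \in triangles G ->
  (#|[set e in edges G | (e \subset T) && L (codeg G e)]| + num_heavy G T = 3)%N.
Proof.
move=> TG; rewrite -(card_tri_edges TG) -[RHS](cardsID [set e | L (codeg G e)]).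
congr (_ + _)%N; apply: eq_card => e; rewrite !finset.in_set.
  by rewrite andbA.
by case: (L _); case: (e \in _); case: (e \subset T).
Qed.

Hypothesis unbiased : forall k, (k <= 3)%N -> a * (3 - k)%:R + w k = 1.

(** A triangle with [k] heavy edges is counted once for each of its [3 - k] light
   edges with weight [a], and with weight [w k] by itself. *)
Lemma triangle_count_weights G :
  \sum_(j | light_flag G j) a + \sum_(T | T \in triangles G) w (num_heavy G T) =
  (ntriangles G)%:R.
Proof.
have -> : \sum_(j | light_flag G j) a = \sum_(T | T \in triangles G)
    \sum_(e | (e \in edges G) && ((e \subset T) && L (codeg G e))) a.
  by rewrite pair_big_dep; apply: eq_bigl => -[T e].
rewrite -big_split /= /ntriangles -sum1_card natr_sum; apply: eq_bigr => T TG.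
rewrite -(unbiased (k := num_heavy G T)); last by rewrite -(num_light_heavy TG) leq_addl.
rewrite -(num_light_heavy TG) addnK -sum1dep_card natr_sum mulr_sumr.
by congr (_ + _); apply: eq_bigr => e _; rewrite mulr1.
Qed.

End Estimator.

Lemma sumr_const_card (R : pzSemiRingType) (J : finType) (P : pred J) (c : R) :
  \sum_(j | P j) c = #|[set j | P j]|%:R * c.
Proof.
by rewrite -sum1dep_card natr_sum mulr_suml; apply: eq_bigr => j _; rewrite mul1r.
Qed.

Lemma sumr_indicator (R : pzSemiRingType) (J : finType) (P Q : pred J) :
  \sum_(j | P j) (Q j)%:R = #|[set j | P j && Q j]|%:R :> R.
Proof.
rewrite -sum1dep_card natr_sum big_mkcondr /=.
by apply: eq_bigr => j _; case: (Q j).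
Qed.

(** * Variances *)

Section OverlapBounds.

Variables (R : realType) (V : finType) (p : R) (G : sgraph V).
Hypothesis p01 : 0 < p <= 1.
Hypothesis pG : planar R G.
Local Notation d := ((maxdeg G)%:R : R).
Local Notation t := ((ntriangles G)%:R : R).
Implicit Types (T : {set V}) (F : {set {set V}}).

Let p_gt0 : 0 < p. Proof. by case/andP: p01. Qed.

Let pV_ge0 k : 0 <= p ^- k. Proof. by rewrite invr_ge0 exprn_ge0 // ltW. Qed.

Lemma triangles_meeting_le T : #|T| = 3%N ->
  (#|[set T' in triangles G | ~~ [disjoint T & T']]| <= 6 * maxdeg G)%N.
Proof.
move=> T3; apply: (@leq_trans (\sum_(x in T) #|[set T' in triangles G | x \in T']|)).
  apply: leq_trans (_ : #|\bigcup_(x in T) [set T' in triangles G | x \in T']| <= _)%N.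
    apply: subset_leq_card; apply/fintype.subsetP => T'.
    rewrite [_ \in finset _]inE => /andP[T'G /pred0Pn[x /andP[xT xT']]].
    by apply/bigcupP; exists x => //; rewrite inE T'G.
  elim/big_rec2: _ => [|x m A _ h]; first by rewrite cards0.
  by apply: leq_trans (leq_card_setU _ _) _; rewrite leq_add2l.
apply: leq_trans (leq_sum _ (fun x _ => triangles_at_le pG x)) _.
by rewrite sum_nat_const T3 mulnA.
Qed.

Lemma overlap_flag_le (e e' T T' : {set V}) : #|e| = 2%N -> #|e'| = 2%N ->
  e \subset T -> e' \subset T' ->
  overlap p e e' <= (e == e')%:R * p ^- 2 + (~~ [disjoint T & T'])%:R * p^-1.
Proof.
move=> e2 e'2 eT e'T'; rewrite /overlap.
have pV0 : 0 <= p^-1 by rewrite invr_ge0 ltW.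
case: ifPn => [_|]; first by rewrite addr_ge0 // mulr_ge0.
case/pred0Pn => x /andP[/= xe xe'].
have -> : ~~ [disjoint T & T'].
  by apply/pred0Pn; exists x; rewrite /= (fintype.subsetP eT) // (fintype.subsetP e'T').
have [<-|ne] := eqVneq e e'.
  by rewrite finset.setIid e2 !mul1r lerDl invr_ge0 ltW.
have -> : #|e :&: e'| = 1%N.
  apply/eqP; rewrite eqn_leq andbC; apply/andP; split.
    by apply/card_gt0P; exists x; rewrite inE xe.
  rewrite -ltnS ltnNge; apply: contra ne => ge2.
  have /eqP <- : e :&: e' == e by rewrite eqEcard finset.subsetIl e2.
  by rewrite eqEcard finset.subsetIr e'2.
by rewrite mul0r add0r mul1r expr1.
Qed.

(** Flags on the same light edge number at most [lam], and flags of triangles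
   with a common vertex are controlled by planarity. *)
Lemma overlap_light_flags (L : pred nat) (lam : R) : 0 <= lam ->
  (forall e, e \in edges G -> L (codeg G e) -> (codeg G e)%:R <= lam) ->
  \sum_(i | light_flag L G i) \sum_(j | light_flag L G j) overlap p i.2 j.2 <=
  3 * t * (lam * p ^- 2 + 18 * d * p^-1).
Proof.
move=> lam0 Llam.
pose K := lam * p ^- 2 + 18 * d * p^-1.
have pV0 : 0 <= p^-1 by rewrite invr_ge0 ltW.
have K0 : 0 <= K by rewrite addr_ge0 // ?mulr_ge0 ?ler0n.
have flagE (F : {set V} -> {set V} -> R) :
    \sum_(j | light_flag L G j) F j.1 j.2 = \sum_(T | T \in triangles G)
      \sum_(e | (e \in edges G) && ((e \subset T) && L (codeg G e))) F T e.
  by rewrite pair_big_dep; apply: eq_bigl => -[T e].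
have card_flags T : T \in triangles G ->
    #|[set e in edges G | (e \subset T) && L (codeg G e)]|%:R <= 3 :> R.
  by move=> TG; rewrite ler_nat -(num_light_heavy L TG) leq_addr.
apply: le_trans (_ : \sum_(i | light_flag L G i) K <= _); last first.
  rewrite (flagE (fun _ _ => K)) -[3 * t]/(3 * _) mulrAC mulrC /ntriangles.
  rewrite -sum1_card natr_sum mulr_suml; apply: ler_sum => T TG.
  by rewrite mul1r sumr_const_card ler_wpM2r // card_flags.
apply: ler_sum => -[T e] /and4P[/= TG eG eT Le].
have [T3 _] := triangleP _ _ TG.
apply: le_trans (_ : \sum_(j | light_flag L G j)
    ((e == j.2)%:R * p ^- 2 + (~~ [disjoint T & j.1])%:R * p^-1) <= _).
  apply: ler_sum => -[T' e'] /and4P[/= T'G e'G e'T' _].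
  by apply: overlap_flag_le => //; rewrite (card_edge (G := G)).
rewrite big_split /=; apply: lerD.
  rewrite -mulr_suml; apply: ler_wpM2r => //; apply: le_trans (Llam e eG Le).
  rewrite sumr_indicator ler_nat /codeg.
  rewrite -(card_in_imset (f := fun j : {set V} * {set V} => j.1)).
    apply: subset_leq_card; apply/fintype.subsetP => _ /imsetP[[T' e'] + ->].
    rewrite finset.in_set => /andP[/and4P[/= T'G _ e'T' _] /eqP ee'].
    by rewrite finset.in_set T'G ee'.
  move=> [T1 e1] [T2 e2]; rewrite !finset.in_set /=.
  by move=> /andP[_ /eqP<-] /andP[_ /eqP<-] /= ->.
rewrite -mulr_suml; apply: ler_wpM2r => //.
rewrite (flagE (fun T' _ => (~~ [disjoint T & T'])%:R)).
apply: le_trans (_ : \sum_(T' in triangles G) 3 * (~~ [disjoint T & T'])%:R <= _).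
  apply: ler_sum => T' T'G; rewrite sumr_const_card ler_wpM2r //.
  exact: card_flags.
rewrite -mulr_sumr sumr_indicator -natrM -[18 * _]natrM ler_nat.
by rewrite -[18%N]/(3 * 6)%N -mulnA leq_mul2l /= triangles_meeting_le.
Qed.

Lemma overlap_triangle_le T T' : T \in triangles G -> T' \in triangles G ->
  overlap p T T' <= (T == T')%:R * p ^- 3 +
    (\sum_(e in tri_edges G T) (e \subset T')%:R) * p ^- 2 +
    (~~ [disjoint T & T'])%:R * p^-1.
Proof.
move=> TG T'G; have [T3 TH] := triangleP _ _ TG; have [T'3 _] := triangleP _ _ T'G.
have pV0 : 0 <= p^-1 by rewrite invr_ge0 ltW.
have s0 : 0 <= (\sum_(e in tri_edges G T) (e \subset T')%:R) * p ^- 2.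
  by rewrite mulr_ge0 // sumr_ge0.
rewrite /overlap; case: ifPn => [_|nd]; first by rewrite ?addr_ge0 // mulr_ge0.
have c3 : (#|T :&: T'| <= 3)%N by rewrite -T3 subset_leq_card ?finset.subsetIl.
have [TT|TT] := eqVneq T T'.
  move: s0; rewrite -TT finset.setIid T3 mul1r => s0.
  by rewrite -addrA lerDl addr_ge0 // mulr_ge0.
rewrite mul0r add0r mul1r.
have c2 : (#|T :&: T'| < 3)%N.
  rewrite ltn_neqAle c3 andbT; apply: contra TT => /eqP c.
  have /eqP <- : T :&: T' == T by rewrite eqEcard finset.subsetIl T3 c.
  by rewrite eqEcard finset.subsetIr T'3 c.
have : (0 < #|T :&: T'|)%N.
  by move: nd; rewrite -setI_eq0 card_gt0.
case E : #|T :&: T'| c2 => [|[|[|//]]] _ //= _; first by rewrite expr1 lerDr.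
apply: ler_wpDr => //; rewrite -[leLHS]mul1r ler_wpM2r //.
rewrite (bigD1 (T :&: T')) /= ?finset.subsetIr ?lerDl ?sumr_ge0 //.
by rewrite finset.in_set finset.subsetIl andbT TH // finset.subsetIl.
Qed.

Lemma overlap_triangles (F : {set {set V}}) (mu : R) : F \subset triangles G ->
  (forall T e, T \in F -> e \in tri_edges G T ->
     #|[set T' in F | e \subset T']|%:R <= mu) ->
  \sum_(T in F) \sum_(T' in F) overlap p T T' <=
  #|F|%:R * (p ^- 3 + 3 * mu * p ^- 2 + 6 * d * p^-1).
Proof.
move=> FG Fmu; have pV0 : 0 <= p^-1 by rewrite invr_ge0 ltW.
rewrite -sum1_card natr_sum mulr_suml; apply: ler_sum => T TF; rewrite mul1r.
have TG := fintype.subsetP FG T TF; have [T3 _] := triangleP _ _ TG.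
apply: le_trans (ler_sum _ (fun T' T'F =>
  overlap_triangle_le TG (fintype.subsetP FG T' T'F))) _.
rewrite !big_split /=; apply: lerD; first apply: lerD.
- rewrite -mulr_suml -[leRHS]mul1r ler_wpM2r // sumr_indicator lern1.
  rewrite -(cards1 T) subset_leq_card //; apply/fintype.subsetP => T'.
  by rewrite finset.in_set => /andP[_ /eqP->]; rewrite finset.set11.
- rewrite -mulr_suml ler_wpM2r // exchange_big /=.
  apply: le_trans (_ : \sum_(e in tri_edges G T) mu <= _).
    apply: ler_sum => e eT; rewrite sumr_indicator.
    exact: Fmu TF eT.
  by rewrite sumr_const (card_tri_edges TG) mulr_natl.
- rewrite -mulr_suml ler_wpM2r // sumr_indicator -natrM ler_nat.
  apply: leq_trans (triangles_meeting_le T3); apply: subset_leq_card.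
  apply/fintype.subsetP => T'; rewrite finset.in_set => /andP[T'F nd].
  rewrite finset.in_set nd.
  by rewrite andbT; apply: (fintype.subsetP FG).
Qed.

End OverlapBounds.

Section Risks.

Variables (R : realType) (p : R).
Hypothesis p01 : 0 < p <= 1.

Let p_gt0 : 0 < p. Proof. by case/andP: p01. Qed.

Definition flag_estimator (L : pred nat) (a : R) (w : nat -> R) : estimator R :=
  fun n O => triangle_count p L a w O.1 O.2.

Lemma risk_flag_estimator L a w n (G : sgraph 'I_n) :
  risk p (flag_estimator L a w) G =
  sample_expect p (fun S => (triangle_count p L a w G S - (ntriangles G)%:R) ^+ 2).
Proof.
apply: eq_expect => S; rewrite /flag_estimator triangle_count_observed.
by rewrite -normrX ger0_norm // sqr_ge0.
Qed.

Definition ht_estimator : estimator R :=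
  flag_estimator xpredT (1 / 3) (fun k => k%:R / 3).

(** All edges are light, and at most [maxdeg G] triangles share an edge. *)
Lemma risk_ht n (G : sgraph 'I_n) : planar R G ->
  risk p ht_estimator G <=
  7 * ((ntriangles G)%:R * (maxdeg G)%:R / p ^+ 2).
Proof.
move=> pG; rewrite risk_flag_estimator.
have unb k : (k <= 3)%N -> 1 / 3 * (3 - k)%:R + k%:R / 3 = 1 :> R.
  by move=> k3; rewrite natrB //; field.
set X := fun S : {set 'I_n} => \sum_(j | light_flag xpredT G j)
  (1 / 3 : R) * ((j.2 \subset S)%:R / p ^+ #|j.2|).
have h0 T : num_heavy xpredT G T = 0%N.
  by apply: eq_card0 => e; rewrite !inE andbF.
have -> : sample_expect p (fun S => (triangle_count p xpredT (1 / 3)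
    (fun k => k%:R / 3) G S - (ntriangles G)%:R) ^+ 2) =
    sample_expect p (fun S => (X S - \sum_(j | light_flag xpredT G j) (1 / 3)) ^+ 2).
  apply: eq_expect => S; rewrite -(triangle_count_weights xpredT unb).
  rewrite /triangle_count [X in _ + X - _]big1 ?addr0 => [|T _]; last first.
    by rewrite h0 !mul0r.
  by rewrite [X in _ - (_ + X)]big1 ?addr0 // => T _; rewrite h0 mul0r.
apply: le_trans (variance_horvitz_thompson p01 (k := 1 / 3) _ _) _.
  by move=> j _; rewrite ger0_norm // divr_ge0.
set t := (ntriangles G)%:R; set d := (maxdeg G)%:R.
have [d0 t0] : 0 <= d :> R /\ 0 <= t :> R by rewrite !ler0n.
have H : \sum_(i | light_flag xpredT G i)
    \sum_(j | light_flag xpredT G j) overlap p i.2 j.2 <=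
    3 * t * (d * p ^- 2 + 18 * d * p^-1).
  by apply: overlap_light_flags => // e eG _; rewrite ler_nat codeg_le_maxdeg.
apply: le_trans (ler_wpM2l _ H) _; first by rewrite exprn_ge0 // divr_ge0.
have pV : p^-1 <= p ^- 2.
  have [_ p1] := andP p01; rewrite -exprVn expr2 ler_peMr ?invr_ge0 ?(ltW p_gt0) //.
  by rewrite invf_ge1.
have td0 : 0 <= t * d by rewrite mulr_ge0.
have h : t * d * p^-1 <= t * d * p ^- 2 by rewrite ler_wpM2l.
have : 0 <= t * d * p ^- 2 by rewrite mulr_ge0 // invr_ge0 exprn_ge0 // ltW.
by move: h; move: (p ^- 2) (p^-1) => v u; lra.
Qed.

(** An edge is light when it lies in at most [1 / p] triangles, so that in the
   variance it contributes no more than the [t / p ^ 3] of a fully sampled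
   triangle.  Light edges alone count a triangle with [k] heavy edges
   [(3 - k) / 2] times. *)
Definition adaptive_estimator : estimator R :=
  flag_estimator (fun c => c%:R * p <= 1) (1 / 2) (fun k => (k%:R - 1) / 2).

(** The light edges and the triangles without heavy edges have variance of order
   [t / p ^ 3 + t d / p].  Triangles with one heavy edge have weight zero, and
   those with two heavy edges or more may share an edge with as many as [d]
   others, but by planarity there are only about [t p] of them. *)
Lemma risk_adaptive n (G : sgraph 'I_n) : planar R G ->
  risk p adaptive_estimator G <=
  200 * ((ntriangles G)%:R / p ^+ 3 + (ntriangles G)%:R * (maxdeg G)%:R / p).
Proof.
move=> pG; rewrite risk_flag_estimator.
set L := fun c : nat => c%:R * p <= 1.
have unb k : (k <= 3)%N -> 1 / 2 * (3 - k)%:R + (k%:R - 1) / 2 = 1 :> R.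
  by move=> k3; rewrite natrB //; field.
pose Y (A S : {set 'I_n}) : R := (A \subset S)%:R / p ^+ #|A|.
pose F0 := [set T in triangles G | num_heavy L G T == 0%N].
pose F2 := [set T in triangles G | (1 < num_heavy L G T)%N].
have mF0 T : (T \in F0) = (T \in triangles G) && (num_heavy L G T == 0%N).
  by rewrite [LHS]finset.in_set.
have mF2 T : (T \in F2) = (T \in triangles G) && (1 < num_heavy L G T)%N.
  by rewrite [LHS]finset.in_set.
pose w T : R := ((num_heavy L G T)%:R - 1) / 2.
pose X1 S := \sum_(j | light_flag L G j) (1 / 2 : R) * Y j.2 S.
pose X2 S := \sum_(T in F0) (- (1 / 2) : R) * Y T S.
pose X3 S := \sum_(T in F2) w T * Y T S.
pose c1 := \sum_(j | light_flag L G j) (1 / 2 : R).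
pose c2 := \sum_(T in F0) (- (1 / 2) : R).
pose c3 := \sum_(T in F2) w T.
have split3 (f : {set 'I_n} -> R) : \sum_(T | T \in triangles G) w T * f T =
    \sum_(T in F0) (- (1 / 2)) * f T + \sum_(T in F2) w T * f T.
  rewrite (bigID (mem F0)) /=; congr (_ + _).
    rewrite (eq_bigl (fun T => T \in F0)) => [|T]; last first.
      by rewrite mF0; case: (_ \in triangles G).
    apply: eq_bigr => T; rewrite mF0 /w => /andP[_ /eqP->].
    by congr (_ * _); field.
  rewrite (bigID (mem F2)) /= [X in _ + X]big1 ?addr0 => [|T].
    apply: eq_bigl => T; rewrite mF0 mF2; case: (_ \in triangles G) => //=.
    by case: (num_heavy L G T) => [|[]].
  rewrite mF0 mF2 => /andP[/andP[-> /=]].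
  by rewrite /w; case: (num_heavy L G T) => [|[|]] // _ _; rewrite subrr !mul0r.
have -> : sample_expect p (fun S => (triangle_count p L (1 / 2)
      (fun k => (k%:R - 1) / 2) G S - (ntriangles G)%:R) ^+ 2) =
    sample_expect p (fun S => ((X1 S - c1) + (X2 S - c2) + (X3 S - c3)) ^+ 2).
  apply: eq_expect => S; rewrite -(triangle_count_weights L unb).
  rewrite /triangle_count (split3 (fun T => Y T S)).
  have := split3 (fun=> 1); under eq_bigr do rewrite mulr1.
  under [X in _ = X + _]eq_bigr do rewrite mulr1.
  under [X in _ = _ + X]eq_bigr do rewrite mulr1.
  by rewrite -/c2 -/c3 => ->; rewrite -/(X1 S) -/(X2 S) -/(X3 S) -/c1; congr (_ ^+ 2); ring.
have sq3 (x y z : R) : (x + y + z) ^+ 2 <= 3 * (x ^+ 2 + (y ^+ 2 + z ^+ 2)).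
  by have := sqr_ge0 (x - y); have := sqr_ge0 (y - z); have := sqr_ge0 (x - z); lra.
apply: le_trans (ler_expect p01 (fun S => sq3 _ _ _)) _.
rewrite expectZ !expectD.
set t := (ntriangles G)%:R; set d := (maxdeg G)%:R.
have [d0 t0] : 0 <= d :> R /\ 0 <= t :> R by rewrite !ler0n.
have pV0 : 0 <= p^-1 by rewrite invr_ge0 ltW.
have pn k : 0 <= p ^- k by rewrite invr_ge0 exprn_ge0 // ltW.
have p3 : p^-1 * p ^- 2 = p ^- 3 by rewrite -invfM -exprS.
have p2 : p * p ^- 2 = p^-1 by rewrite expr2 invfM mulrA divff ?mul1r // gt_eqF.
have light_le e : e \in edges G -> L (codeg G e) -> (codeg G e)%:R <= p^-1.
  by move=> _; rewrite /L -ler_pdivlMr // mul1r.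
have V1 : sample_expect p (fun S => (X1 S - c1) ^+ 2) <=
    1 / 4 * (3 * t * (p ^- 3 + 18 * d * p^-1)).
  apply: le_trans (variance_horvitz_thompson p01 (k := 1 / 2) _ _) _.
    by move=> j _; rewrite ger0_norm // divr_ge0.
  have -> : (1 / 2 : R) ^+ 2 = 1 / 4 by field.
  by rewrite -p3 ler_wpM2l ?divr_ge0 // overlap_light_flags.
have F0G : F0 \subset triangles G by apply/fintype.subsetP => T; rewrite ?mF0 ?mF2 => /andP[].
have F2G : F2 \subset triangles G by apply/fintype.subsetP => T; rewrite ?mF0 ?mF2 => /andP[].
have codeg_sub (F : {set {set 'I_n}}) (e : {set 'I_n}) : F \subset triangles G ->
    (#|[set T' in F | e \subset T']| <= codeg G e)%N.
  move=> FG; apply: subset_leq_card; apply/fintype.subsetP => T'.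
  by rewrite finset.in_set => /andP[/(fintype.subsetP FG) T'G eT']; rewrite finset.in_set T'G.
have V2 : sample_expect p (fun S => (X2 S - c2) ^+ 2) <=
    1 / 4 * (t * (p ^- 3 + 3 * p^-1 * p ^- 2 + 6 * d * p^-1)).
  apply: le_trans (variance_horvitz_thompson p01 (k := 1 / 2) _ _) _.
    by move=> j _; rewrite normrN ger0_norm // divr_ge0.
  have -> : (1 / 2 : R) ^+ 2 = 1 / 4 by field.
  rewrite ler_wpM2l ?divr_ge0 //.
  apply: le_trans (overlap_triangles p01 pG (mu := p^-1) F0G _) _; last first.
    by rewrite ler_wpM2r ?ler_nat ?subset_leq_card // !addr_ge0 ?mulr_ge0.
  move=> T e; rewrite mF0 => /andP[TG /eqP h0].
  rewrite finset.in_set => /andP[eG eT].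
  apply: le_trans (light_le e eG _); first by rewrite ler_nat codeg_sub.
  apply: contraT => hL; have : e \in finset.set0 by rewrite -(cards0_eq h0) !finset.in_set eG hL.
  by rewrite inE.
have N2 : #|F2|%:R <= 12 * t * p.
  have HG : heavy_edges L G \subset edges G.
    by apply/fintype.subsetP => e; rewrite finset.in_set => /andP[].
  apply: le_trans (_ : 4 * #|heavy_edges L G|%:R <= _).
    by rewrite -natrM ler_nat; apply: triangles_two_marked pG _ HG.
  have : #|heavy_edges L G|%:R * p^-1 <= 3 * t.
    rewrite -[3 * t]natrM -sum_edge_triangles (bigID (mem (heavy_edges L G))) /=.
    rewrite natrD; apply: ler_wpDr; first exact: ler0n.
    rewrite -sum1_card !natr_sum mulr_suml.
    rewrite [leRHS](eq_bigl (fun e => e \in heavy_edges L G)) => [|e]; last first.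
      by have [/(fintype.subsetP HG)->|] := boolP (e \in heavy_edges L G); rewrite ?andbF.
    apply: ler_sum => e; rewrite finset.in_set mul1r => /andP[_].
    by rewrite /L -ltNge -ltr_pdivrMr // mul1r => /ltW.
  by rewrite ler_pdivrMr // => h; lra.
have N2t : #|F2|%:R <= t by rewrite ler_nat subset_leq_card.
have V3 : sample_expect p (fun S => (X3 S - c3) ^+ 2) <=
    #|F2|%:R * (p ^- 3 + 3 * d * p ^- 2 + 6 * d * p^-1).
  apply: le_trans (variance_horvitz_thompson p01 (k := 1) _ _) _.
    move=> T; rewrite mF2 => /andP[TG h2]; rewrite /w.
    have h3 : (num_heavy L G T <= 3)%N by rewrite -(num_light_heavy L TG) leq_addl.
    have : 1 <= ((num_heavy L G T)%:R : R) <= 3 by rewrite ler1n ler_nat h3 ltnW.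
    by move=> /andP[h1 h4]; rewrite ger0_norm; lra.
  rewrite expr1n mul1r; apply: overlap_triangles => // T e _.
  rewrite finset.in_set => /andP[eG _]; rewrite ler_nat.
  by apply: leq_trans (codeg_sub F2 e F2G) _; apply: codeg_le_maxdeg.
apply: le_trans (ler_wpM2l _ (lerD V1 (lerD V2 V3))) _ => //.
rewrite -(mulrA 3 p^-1) p3.
have tp3 : 0 <= t * p ^- 3 by rewrite mulr_ge0.
have tdp : 0 <= t * d * p^-1 by rewrite !mulr_ge0.
have B1 : #|F2|%:R * p ^- 3 <= t * p ^- 3 by rewrite ler_wpM2r.
have B2 : #|F2|%:R * (d * p^-1) <= t * d * p^-1 by rewrite -mulrA ler_wpM2r ?mulr_ge0.
have B3 : #|F2|%:R * (d * p ^- 2) <= 12 * (t * d * p^-1).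
  apply: le_trans (ler_wpM2r _ N2) _; first by rewrite mulr_ge0.
  by rewrite -p2 le_eqVlt; apply/orP; left; apply/eqP; ring.
by move: tp3 tdp B1 B2 B3; move: (p ^- 2) (p ^- 3) (p^-1) #|F2|%:R => v3 v2 v1 N; lra.
Qed.

End Risks.

(** * The upper bound *)

Section UpperBound.

Variables (R : realType) (p : R) (d t : nat).
Hypothesis p01 : 0 < p <= 1.
Local Notation T := (t%:R : R).
Local Notation D := (d%:R : R).

Lemma minimax_risk_le (est : estimator R) (b : R) :
  (forall n (G : sgraph 'I_n), planar R G -> (maxdeg G <= d)%N ->
     (ntriangles G <= t)%N -> risk p est G <= b) ->
  (minimax_risk p d t <= b%:E)%E.
Proof.
move=> H; apply: (@le_trans _ _ (worst_risk p d t est)).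
  by apply: ereal_inf_lbound; exists est.
by apply: ge_ereal_sup => _ [n [G [pG dG tG ->]]]; rewrite lee_fin; apply: H.
Qed.

Lemma minimax_risk_le_sqr : (minimax_risk p d t <= (T ^+ 2)%:E)%E.
Proof.
apply: (minimax_risk_le (est := fun _ _ => 0)) => n G _ _ tG.
rewrite -[leRHS](@expect_cst R 'I_n p _); apply: ler_expect => // S.
by rewrite sub0r normrN ger0_norm // lerXn2r ?nnegrE // ler_nat.
Qed.

Lemma minimax_risk_le_ht : (minimax_risk p d t <= (7 * (T * D / p ^+ 2))%:E)%E.
Proof.
apply: (minimax_risk_le (est := ht_estimator p)) => n G pG dG tG.
apply: le_trans (risk_ht p01 pG) _; rewrite ler_wpM2l // ler_wpM2r //.
  by case/andP: p01 => p0 _; rewrite invr_ge0 exprn_ge0 // ltW.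
by rewrite ler_pM ?ler_nat.
Qed.

Lemma minimax_risk_le_adaptive :
  (minimax_risk p d t <= (200 * (T / p ^+ 3 + T * D / p))%:E)%E.
Proof.
have [p0 _] := andP p01.
apply: (minimax_risk_le (est := adaptive_estimator p)) => n G pG dG tG.
apply: le_trans (risk_adaptive p01 pG) _; rewrite ler_wpM2l // lerD //.
  by rewrite ler_wpM2r ?ler_nat // invr_ge0 exprn_ge0 // ltW.
by rewrite ler_wpM2r ?invr_ge0 ?(ltW p0) // ler_pM ?ler_nat.
Qed.

Theorem minimax_risk_upper : (minimax_risk p d t <=
  (400 * Num.min (Num.max (Num.min (T / p ^+ 3) (T * D / p ^+ 2)) (T * D / p))
                 (T ^+ 2))%:E)%E.
Proof.
have [p0 _] := andP p01.
have pV k : 0 <= p ^- k by rewrite invr_ge0 exprn_ge0 // ltW.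
have [a0 b0 c0] : [/\ 0 <= T / p ^+ 3, 0 <= T * D / p ^+ 2 & 0 <= T * D / p].
  have pV0 : 0 <= p^-1 by rewrite invr_ge0 ltW.
  by split; do ?apply: mulr_ge0; rewrite ?ler0n.
have T0 : 0 <= T ^+ 2 by rewrite sqr_ge0.
move: minimax_risk_le_sqr minimax_risk_le_ht minimax_risk_le_adaptive.
move: (T / p ^+ 3) (T * D / p ^+ 2) (T * D / p) (T ^+ 2) a0 b0 c0 T0.
move=> a b c s a0 b0 c0 s0 Hs Hb Hac.
have [_|_] := leP (Num.max (Num.min a b) c) s; last first.
  by apply: le_trans Hs _; rewrite lee_fin; lra.
have [ab|ba] := leP a b.
  apply: le_trans Hac _; rewrite lee_fin.
  by have [ac|ca] := leP a c; lra.
apply: le_trans Hb _; rewrite lee_fin.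
by have [ac|ca] := leP b c; lra.
Qed.

End UpperBound.

(** * Independent copies of two hypotheses *)

Section ProductLowerBound.

Variables (R : realType) (Y O : finType) (m : nat).
Variables (mu h : bool -> Y -> R) (obs : Y -> O) (tau : Y -> R).
Local Notation sg := (fun theta : bool => if theta then 1 else -1 : R).

Hypothesis mu_ge0 : forall theta y, 0 <= mu theta y.
Hypothesis mu_h1 : forall theta, \sum_y mu theta y * h theta y = 1.
Hypothesis kappa : forall o,
  \sum_(y | obs y == o) mu true y * h true y =
  \sum_(y | obs y == o) mu false y * h false y.

Definition product_mean (theta : bool) (X : {ffun 'I_m -> Y} -> R) : R :=
  \sum_(y : {ffun 'I_m -> Y}) (\prod_b mu theta (y b)) * X y.

Definition score_mean (theta : bool) : R := \sum_y mu theta y * h theta y * tau y.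

Lemma sum_over_observations (c : Y -> R) (g : {ffun 'I_m -> O} -> R) :
  \sum_(y : {ffun 'I_m -> Y}) (\prod_b c (y b)) * g [ffun b => obs (y b)] =
  \sum_(o : {ffun 'I_m -> O}) g o * \prod_b \sum_(z | obs z == o b) c z.
Proof.
under [RHS]eq_bigr => o _.
  under eq_bigr => b _ do rewrite big_mkcond.
  rewrite bigA_distr_bigA mulr_sumr; over.
rewrite exchange_big /=; apply: eq_bigr => y _.
rewrite (bigD1 [ffun b => obs (y b)]) //= [X in _ + X]big1 ?addr0 => [|o ne].
  by rewrite mulrC; congr (_ * _); apply: eq_bigr => b _; rewrite ffunE eqxx.
have [b ob] : exists b, obs (y b) != o b.
  apply/existsP; apply: contraNT ne; rewrite negb_exists => /forallP eqo.
  by apply/eqP/ffunP => b; rewrite ffunE; apply/esym/eqP; have := eqo b; rewrite negbK.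
by rewrite (bigD1 b) //= (negPf ob) mul0r mulr0.
Qed.

(** Reweighted by [h], the observations have the same law under both
   parameters, whence the estimator is uncorrelated with the signed product. *)
Lemma score_uncorrelated (g : {ffun 'I_m -> O} -> R) :
  let E theta := product_mean theta
    (fun y => \prod_b h theta (y b) * g [ffun b => obs (y b)]) in
  E true = E false.
Proof.
move=> E; rewrite /E /product_mean.
under eq_bigr => y _ do rewrite mulrA -big_split.
under [RHS]eq_bigr => y _ do rewrite mulrA -big_split.
rewrite (sum_over_observations (fun z => mu true z * h true z)).
rewrite (sum_over_observations (fun z => mu false z * h false z)).
by apply: eq_bigr => o _; congr (_ * _); apply: eq_bigr => b _; apply: kappa.
Qed.

Lemma score_total theta :
  product_mean theta (fun y => \prod_b h theta (y b) * \sum_b tau (y b)) =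
  m%:R * \sum_y mu theta y * h theta y * tau y.
Proof.
rewrite /product_mean; under eq_bigr => y _ do rewrite mulrA -big_split mulr_sumr.
rewrite exchange_big /= -[m in RHS]card_ord -sum1_card natr_sum mulr_suml.
apply: eq_bigr => b _; rewrite mul1r.
under eq_bigr => y _.
  have -> : (\prod_i (mu theta (y i) * h theta (y i))) * tau (y b) =
     \prod_i (mu theta (y i) * h theta (y i) * (if i == b then tau (y i) else 1)).
    rewrite [RHS]big_split /=; congr (_ * _).
    by rewrite -big_mkcond big_pred1_eq.
  over.
rewrite -(bigA_distr_bigA (fun i y =>
  mu theta y * h theta y * (if i == b then tau y else 1))) (bigD1 b) //=.
rewrite eqxx [X in _ * X]big1 ?mulr1 // => i /negPf->.
by under eq_bigr => y _ do rewrite mulr1; apply: mu_h1.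
Qed.

(** Test the error against the signed product of the weights [h]: by
   [score_uncorrelated] the estimator drops out, and the correlation that is left
   is the difference of the means of the estimand, while the second moment of
   the product is at most [B ^+ m]. *)
Theorem product_bayes_lower_bound (B : R) (g : {ffun 'I_m -> O} -> R) :
  0 < B -> (forall theta, \sum_y mu theta y * h theta y ^+ 2 <= B) ->
  (m%:R * (score_mean true - score_mean false) / 2) ^+ 2 / B ^+ m <=
  \sum_theta 2^-1 * product_mean theta
    (fun y => (g [ffun b => obs (y b)] - \sum_b tau (y b)) ^+ 2).
Proof.
move=> B0 hB; pose T := score_mean; rewrite -/T.
pose A := m%:R * (T true - T false) / 2.
pose lam := - A / B ^+ m.
have Bm0 : 0 < B ^+ m by rewrite exprn_gt0.
pose err y := g [ffun b => obs (y b)] - \sum_b tau (y b).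
pose H theta (y : {ffun 'I_m -> Y}) := \prod_b h theta (y b).
have pt theta y : 2 * lam * (sg theta * (H theta y * err y)) - lam ^+ 2 * H theta y ^+ 2
    <= err y ^+ 2.
  have : 0 <= (err y - lam * sg theta * H theta y) ^+ 2 by rewrite sqr_ge0.
  by case: theta => /=; nra.
have pm_ge0 theta (y : {ffun 'I_m -> Y}) : 0 <= \prod_b mu theta (y b).
  by apply: prodr_ge0.
have pmle theta : 2 * lam * sg theta * product_mean theta (fun y => H theta y * err y)
    - lam ^+ 2 * product_mean theta (fun y => H theta y ^+ 2)
    <= product_mean theta (fun y => err y ^+ 2).
  rewrite /product_mean !mulr_sumr -sumrB; apply: ler_sum => y _.
  apply: le_trans (ler_wpM2l (pm_ge0 theta y) (pt theta y)).
  by rewrite le_eqVlt; apply/orP; left; apply/eqP; ring.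
have HB theta : product_mean theta (fun y => H theta y ^+ 2) <= B ^+ m.
  rewrite /product_mean; under eq_bigr => y _ do rewrite -prodrXl -big_split.
  rewrite -(bigA_distr_bigA (fun (i : 'I_m) y => mu theta y * h theta y ^+ 2)).
  rewrite prodr_const card_ord lerXn2r ?nnegrE ?(ltW B0) //.
  by apply: sumr_ge0 => y _; rewrite mulr_ge0 // sqr_ge0.
have HE theta : product_mean theta (fun y => H theta y * err y) =
    product_mean theta (fun y => H theta y * g [ffun b => obs (y b)]) - m%:R * T theta.
  rewrite -score_total /product_mean -sumrB; apply: eq_bigr => y _.
  by rewrite /err !mulrBr.
rewrite big_bool /=.
have := pmle true; have := pmle false; rewrite !HE /=.
have /= -> := score_uncorrelated g.
set e := product_mean false _; rewrite -/A => p1 p2.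
have l2 : 0 <= lam ^+ 2 by rewrite sqr_ge0.
have h1 := ler_wpM2l l2 (HB true); have h2 := ler_wpM2l l2 (HB false).
have lamB : lam * B ^+ m = - A by rewrite /lam divfK // gt_eqF.
have -> : A ^+ 2 / B ^+ m = - lam * A by rewrite /lam expr2; ring.
have l3 : lam ^+ 2 * B ^+ m = - lam * A by rewrite expr2 -mulrA lamB; ring.
have Adef : 2 * A = m%:R * (T true - T false) by rewrite /A; field.
move: p1 p2 h1 h2; rewrite /err /H l3.
move: (product_mean true _) (product_mean true _) (product_mean false _)
  (product_mean false _) => a b c f p1 p2 h1 h2.
nra.
Qed.

End ProductLowerBound.

(** * Graphs of symmetric relations *)

Section RelationGraph.

Variable W : finType.
Implicit Types (r : rel W) (x y z : W) (f : {set W}).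

Definition rel_edges r : {set {set W}} :=
  [set f | [exists x, exists y, [&& x != y, r x y & f == [set x; y]]]].

Lemma rel_edges_card2 r : rel_edges r \subset [set f : {set W} | #|f| == 2%N].
Proof.
apply/fintype.subsetP => f; rewrite !finset.in_set.
by case/existsP => x /existsP[y /and3P[xy _ /eqP->]]; rewrite cards2 xy.
Qed.

Definition rel_graph r : sgraph W := SGraph (rel_edges_card2 r).

Lemma set2_inj x y x' y' : [set x; y] = [set x'; y'] ->
  (x = x' /\ y = y') \/ (x = y' /\ y = x').
Proof.
move=> E; have := set21 x' y'; have := set22 x' y'; rewrite -E !inE.
have := set21 x y; have := set22 x y; rewrite E !inE.
by move=> /orP[]/eqP a /orP[]/eqP b /orP[]/eqP c /orP[]/eqP d; subst; auto.
Qed.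

Lemma rel_graphE r x y :
  ([set x; y] \in edges (rel_graph r)) = (x != y) && (r x y || r y x).
Proof.
rewrite finset.in_set; apply/existsP/andP => [[x' /existsP[y' /and3P[ne rxy /eqP]]]|].
  by case/set2_inj => [[-> ->]|[-> ->]]; rewrite rxy ?orbT // eq_sym.
case=> ne /orP[rxy|ryx].
  by exists x; apply/existsP; exists y; rewrite ne rxy eqxx.
by exists y; apply/existsP; exists x; rewrite eq_sym ne ryx finset.setUC eqxx.
Qed.

Lemma nbhd_sample_rel_graph r (S : {set W}) :
  nbhd_sample (rel_graph r) S =
  (rel_graph (fun x y => r x y && ((x \in S) || (y \in S))), S).
Proof.
congr (_, _); apply: val_inj; apply/setP => f /=; rewrite [LHS]finset.in_set.
have meet x y : ([set x; y] :&: S != finset.set0) = (x \in S) || (y \in S).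
  apply/set0Pn/orP => [[z]|[xS|yS]].
  - by rewrite !inE => /andP[/orP[]/eqP-> ->]; auto.
  - by exists x; rewrite !inE eqxx.
  - by exists y; rewrite !inE eqxx orbT.
rewrite !finset.in_set; apply/andP/existsP.
  case=> /existsP[x /existsP[y /and3P[ne rxy /eqP->]]]; rewrite meet => m.
  by exists x; apply/existsP; exists y; rewrite ne rxy m eqxx.
case=> x /existsP[y /and3P[ne /andP[rxy m] /eqP->]]; rewrite meet m; split=> //.
by apply/existsP; exists x; apply/existsP; exists y; rewrite ne rxy eqxx.
Qed.

Variable r : rel W.
Hypothesis r_sym : symmetric r.
Hypothesis r_irr : irreflexive r.

Lemma rel_neq x y : r x y -> x != y.
Proof. by apply: contraTneq => ->; rewrite r_irr. Qed.

Lemma adj_rel_graph x y : adj (rel_graph r) x y = r x y.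
Proof.
rewrite /adj rel_graphE (r_sym y x) orbb.
by apply/andP/idP => [[]//|rxy]; rewrite rel_neq.
Qed.

Lemma deg_rel_graph x : deg (rel_graph r) x = #|[set y | r x y]|.
Proof.
rewrite /deg -(card_in_imset (f := fun y => [set x; y]) (D := mem [set y | r x y])).
  apply: eq_card => f; apply/idP/imsetP => [|[y ym ->]].
    rewrite inE => /andP[fG xf].
    have /eqP/cards2P[a [b [ab E]]] := card_edge fG.
    have [y fE] : exists y, f = [set x; y].
      move: xf; rewrite E !inE => /orP[]/eqP->; first by exists b.
      by exists a; rewrite finset.setUC.
    by exists y; rewrite // inE -adj_rel_graph /adj -fE.
  have xy : adj (rel_graph r) x y by move: ym; rewrite inE adj_rel_graph.
  by rewrite finset.in_set; apply/andP; split; rewrite // !inE eqxx.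
move=> y z; rewrite !inE => xy _ /set2_inj[[]//|[xz yx]].
by have := rel_neq xy; rewrite yx eqxx.
Qed.

Definition common_nbrs x y : nat := #|[set z | r x z && r y z]|.

Lemma codeg_rel_graph x y : r x y -> codeg (rel_graph r) [set x; y] = common_nbrs x y.
Proof.
move=> xy; rewrite /codeg /common_nbrs.
rewrite -(card_in_imset (f := fun z => z |: [set x; y]) (D := mem [set z | r x z && r y z])).
  apply: eq_card => T; apply/idP/imsetP => [|[z zm ->]].
    rewrite finset.in_set => /andP[/triangleP[T3 H] xyT].
    have : (0 < #|T :\: [set x; y]|)%N.
      by rewrite cardsD (finset.setIidPr xyT) T3 cards2 (rel_neq xy).
    case/card_gt0P => z; rewrite inE => /andP[zxy zT].
    have TE : T = z |: [set x; y].
      apply/eqP; rewrite eq_sym eqEcard T3 cardsU1 zxy cards2 (rel_neq xy) andbT.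
      by rewrite finset.subUset finset.sub1set zT.
    have inT a b : a \in T -> b \in T -> a != b -> r a b.
      move=> aT bT ab; rewrite -adj_rel_graph; apply: H; last by rewrite cards2 ab.
      by rewrite finset.subUset !finset.sub1set aT.
    exists z => //; move: xyT zxy; rewrite finset.subUset !finset.sub1set !inE negb_or.
    by move=> /andP[xT yT] /andP[zx zy]; rewrite !inT // eq_sym.
  have /andP[xz yz] : r x z && r y z by move: zm; rewrite inE.
  rewrite finset.in_set finset.subsetUr andbT.
  have zxy : z \notin [set x; y] by rewrite !inE negb_or !(eq_sym z) !rel_neq.
  apply/triangleP; split; first by rewrite cardsU1 zxy cards2 (rel_neq xy).
  move=> f fT /eqP/cards2P[a [b [ab E]]]; rewrite E -/(adj _ a b) adj_rel_graph.
  move: fT ab; rewrite E finset.subUset !finset.sub1set !inE.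
  move=> /andP[/or3P[]/eqP-> /or3P[]/eqP->]; rewrite ?eqxx // => _ //;
    by rewrite r_sym.
move=> z z'; rewrite !inE => /andP[xz yz] _ E.
have : z \in z' |: [set x; y] by rewrite -E !inE eqxx.
by rewrite !inE !(eq_sym z) (negPf (rel_neq xz)) (negPf (rel_neq yz)) !orbF => /eqP.
Qed.

(** Each triangle is counted at its six ordered pairs of vertices. *)
Lemma ntriangles_rel_graph :
  (6 * ntriangles (rel_graph r) = \sum_x \sum_(y | r x y) common_nbrs x y)%N.
Proof.
rewrite -[6%N]/(2 * 3)%N -mulnA -sum_edge_triangles big_distrr /=.
rewrite pair_big_dep /=.
rewrite (partition_big (fun xy : W * W => [set xy.1; xy.2]) (mem (edges (rel_graph r)))) /=.
  apply: eq_bigr => f fG.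
  have /eqP/cards2P[x [y [xy E]]] := card_edge (G := rel_graph r) fG.
  have rxy : r x y by rewrite -adj_rel_graph /adj -E.
  rewrite (bigD1 (x, y)) /= ?rxy ?E ?eqxx // (bigD1 (y, x)) /=; last first.
    by rewrite r_sym rxy finset.setUC eqxx /= xpair_eqE negb_and eq_sym xy.
  rewrite big1 ?addn0 => [|[a b] /= /andP[/andP[/andP[rab /eqP/set2_inj ab] n1] n2]]; last first.
    by case: ab n1 n2 => [] [-> ->]; rewrite ?eqxx.
  rewrite -!codeg_rel_graph ?(r_sym y) // (finset.setUC [set y]) mul2n addnn.
  by [].
by move=> [x y] /= rxy; have := rxy; rewrite -{1}adj_rel_graph.
Qed.

End RelationGraph.

(** * Book embeddings *)

(** A book embedding with two pages: the vertices are numbered by [pos], and no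
   two edges on the same page interleave. *)
Definition two_page (W : finType) (r : rel W) (pos : W -> nat)
    (page : W -> W -> bool) : Prop :=
  [/\ injective pos, forall x y, page x y = page y x &
      forall a b c d, r a b -> r c d -> page a b = page c d ->
        ~ [/\ (pos a < pos c)%N, (pos c < pos b)%N & (pos b < pos d)%N]].

Section TwoPagePlanar.

Variables (R : realType) (W : finType) (r : rel W).
Variables (pos : W -> nat) (page : W -> W -> bool).
Hypotheses (r_sym : symmetric r) (r_irr : irreflexive r).
Hypothesis book : two_page r pos page.

Let P (x : W) : R * R := ((pos x)%:R, 0).

(** The edge between [a] and [b] is the part of the parabola with zeros at [a]
   and [b] above or below the line of the vertices. *)
Definition parabola (a b : R) (up : bool) (s : R) : R * R :=
  (a + s * (b - a), (-1) ^+ up * (s * (1 - s) * (b - a) ^+ 2)).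

Let arc (f : {set W}) : R -> R * R :=
  if [pick xy : W * W | (f == [set xy.1; xy.2]) && (pos xy.1 < pos xy.2)%N]
    is Some xy then parabola (pos xy.1)%:R (pos xy.2)%:R (page xy.1 xy.2)
  else fun=> (0, 0).

Lemma parabola_continuous a b up : continuous (parabola a b up).
Proof.
have c1 : continuous (fun s : R => a + s * (b - a)).
  move=> s; apply: cvgD; first exact: cvg_cst.
  by apply: cvgM; [exact: cvg_id|exact: cvg_cst].
have c2 : continuous (fun s : R => (-1) ^+ up * (s * (1 - s) * (b - a) ^+ 2)).
  move=> s; apply: cvgM; first exact: cvg_cst.
  apply: cvgM; last exact: cvg_cst.
  apply: cvgM; first exact: cvg_id.
  by apply: cvgB; [exact: cvg_cst|exact: cvg_id].
by move=> s; exact: cvg_pair (c1 s) (c2 s).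
Qed.

Lemma arcE f : f \in edges (rel_graph r) -> exists x y, [/\ f = [set x; y], r x y,
  (pos x < pos y)%N & arc f = parabola (pos x)%:R (pos y)%:R (page x y)].
Proof.
case: book => pos_inj _ _ fG; have /eqP/cards2P[x [y [xy E]]] := card_edge fG.
rewrite /arc; case: pickP => [[a b] /= /andP[/eqP fE ab]|nope].
  by exists a, b; split=> //; rewrite -(adj_rel_graph r_sym r_irr) /adj -fE.
have ne : pos x != pos y by apply: contra xy => /eqP/pos_inj->.
have := nope (x, y); have := nope (y, x); rewrite /= E eqxx finset.setUC eqxx /=.
by case: ltngtP ne.
Qed.

Lemma nested_parabolas (a b c d X : R) : a <= c -> d <= b -> c < X < d ->
  (a < c) || (d < b) -> (X - c) * (d - X) < (X - a) * (b - X).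
Proof.
move=> ac db /andP[cX Xd] /orP[lt|lt].
  apply: lt_le_trans (_ : (X - a) * (d - X) <= _).
    by rewrite ltr_pM2r ?subr_gt0 // ltrD2l ltrN2.
  by rewrite ler_pM2l ?lerD2r // subr_gt0; lra.
apply: lt_le_trans (_ : (X - c) * (b - X) <= _).
  by rewrite ltr_pM2l ?subr_gt0 // ltrD2r.
by rewrite ler_pM2r ?lerD2l ?lerN2 // subr_gt0; lra.
Qed.

Lemma parabola_height (a b s : R) :
  s * (1 - s) * (b - a) ^+ 2 = (a + s * (b - a) - a) * (b - (a + s * (b - a))).
Proof. ring. Qed.

Lemma parabola_between (a b s : R) : a < b -> 0 < s < 1 -> a < a + s * (b - a) < b.
Proof. by move=> ab /andP[s0 s1]; apply/andP; split; nra. Qed.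

(** Edges on the same page are nested or apart, so their half-parabolas are
   disjoint. *)
Theorem two_page_planar : planar R (rel_graph r).
Proof.
have [pos_inj page_sym nocross] := book.
exists P, arc; split.
- by move=> x y [/eqP]; rewrite eqr_nat => /eqP/pos_inj.
- move=> f /arcE[x [y [_ _ _ ->]]]; apply: continuous_subspaceT.
  exact: parabola_continuous.
- move=> f /arcE[x [y [_ _ xy ->]]] s u _ _ [/addrI + _].
  by apply: mulIf; rewrite subr_eq0 eqr_nat gt_eqF.
- move=> f /arcE[x [y [-> _ _ ->]]]; exists x, y; split=> //.
    by rewrite /parabola /P !mul0r mulr0 addr0.
  by rewrite /parabola /P subrr mulr0 mul0r mulr0 mul1r addrC subrK.
- move=> f s z /arcE[x [y [_ _ xy ->]]] s01 [_ /eqP].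
  have xy' : (pos x)%:R < (pos y)%:R :> R by rewrite ltr_nat.
  have [s0 s1] := andP s01; apply/negP; rewrite mulf_neq0 ?signr_eq0 //.
  rewrite mulf_neq0 ?expf_neq0 ?subr_eq0 ?(gt_eqF xy') //.
  by rewrite mulf_neq0 // gt_eqF // subr_gt0.
move=> e f s u /arcE[a [b [eE rab ab ->]]] /arcE[c [d [fE rcd cd ->]]] ef s01 u01.
have ab' : (pos a)%:R < (pos b)%:R :> R by rewrite ltr_nat.
have cd' : (pos c)%:R < (pos d)%:R :> R by rewrite ltr_nat.
have := parabola_between ab' s01; have := parabola_between cd' u01.
rewrite /parabola => + + [EX EY]; rewrite -EX; rewrite !parabola_height -EX in EY.
move: ((pos a)%:R + _) EY {EX} => X EY /andP[cX Xd] /andP[aX Xb].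
have pgE : page a b = page c d.
  have h1 : 0 < (X - (pos a)%:R) * ((pos b)%:R - X) by rewrite mulr_gt0 // subr_gt0.
  have h2 : 0 < (X - (pos c)%:R) * ((pos d)%:R - X) by rewrite mulr_gt0 // subr_gt0.
  by move: EY; case: (page a b) (page c d) => [] [] //; rewrite expr0 expr1; lra.
rewrite pgE in EY.
have {}EY : (X - (pos a)%:R) * ((pos b)%:R - X) = (X - (pos c)%:R) * ((pos d)%:R - X).
  by apply: mulfI EY; rewrite signr_eq0.
have cb : (pos c < pos b)%N by rewrite -(ltr_nat R) (lt_trans cX).
have ad : (pos a < pos d)%N by rewrite -(ltr_nat R) (lt_trans aX).
have n1 : ~ [/\ (pos a < pos c)%N, (pos c < pos b)%N & (pos b < pos d)%N].
  exact: nocross.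
have n2 : ~ [/\ (pos c < pos a)%N, (pos a < pos d)%N & (pos d < pos b)%N].
  exact: nocross.
have ne : (pos a != pos c) || (pos b != pos d).
  apply: contraNT ef; rewrite negb_or !negbK => /andP[/eqP/pos_inj ac /eqP/pos_inj bd].
  by rewrite eE fE ac bd.
have [h|h] : ((pos a <= pos c)%N /\ (pos d <= pos b)%N) \/
             ((pos c <= pos a)%N /\ (pos b <= pos d)%N).
- move: cb ad => cb ad; have /and3P m1 := n1; have /and3P m2 := n2.
  by move/negP: m1; move/negP: m2; rewrite cb ad; clear; lia.
  have := @nested_parabolas (pos a)%:R (pos b)%:R (pos c)%:R (pos d)%:R X.
  rewrite !ler_nat !ltr_nat cX Xd EY ltxx => H.
  by have : false by apply: H; move: h ne; clear; lia.
have := @nested_parabolas (pos c)%:R (pos d)%:R (pos a)%:R (pos b)%:R X.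
rewrite !ler_nat !ltr_nat aX Xb EY ltxx => H.
by have : false by apply: H; move: h ne; clear; lia.
Qed.

End TwoPagePlanar.

(** Embeddings of the parts [comp] of a graph are placed one after the other along
   the spine, in intervals of length [K]. *)
Lemma two_page_stack (W : finType) (r : rel W) (comp inner : W -> nat) page K :
  (forall x, inner x < K)%N -> (forall x y, r x y -> comp x = comp y) ->
  (forall x y, comp x = comp y -> inner x = inner y -> x = y) ->
  (forall x y, page x y = page y x) ->
  (forall a b c d, comp a = comp c -> r a b -> r c d -> page a b = page c d ->
     ~ [/\ (inner a < inner c)%N, (inner c < inner b)%N & (inner b < inner d)%N]) ->
  two_page r (fun x => comp x * K + inner x)%N page.
Proof.
move=> lt rc inj sym nc.
have eq_comp x y : (comp x * K + inner x = comp y * K + inner y)%N -> comp x = comp y.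
  move=> E; have K0 : (0 < K)%N by apply: leq_ltn_trans (lt x).
  by have := congr1 (divn^~ K) E; rewrite /= !divnMDl // !divn_small ?lt // !addn0.
have le_comp x y : (comp x * K + inner x < comp y * K + inner y)%N -> (comp x <= comp y)%N.
  have := lt x; have := lt y; case: (leqP (comp x) (comp y)) => // h.
  have : (comp y * K + K <= comp x * K)%N by rewrite addnC -mulSn leq_mul2r h orbT.
  by move: (comp x * K)%N (comp y * K)%N => u v; clear; lia.
split=> // [x y E|a b c d rab rcd pg [ac cb bd]].
  by have e := eq_comp _ _ E; apply: inj => //; move: E; rewrite e => /addnI.
have ab := rc _ _ rab; have cd := rc _ _ rcd.
have e : comp a = comp c.
  apply/eqP; rewrite eqn_leq le_comp //= ab; exact: le_comp.
apply: (nc a b c d e rab rcd pg); move: ac cb bd.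
by rewrite -ab -cd -e !ltn_add2l.
Qed.

(** * Disjoint unions of blocks *)

Lemma sum_ffun_pair (R : nmodType) (I A B : finType) (F : {ffun I -> A * B} -> R) :
  \sum_y F y = \sum_(w : {ffun I -> B}) \sum_(s : {ffun I -> A})
     F [ffun b => (s b, w b)].
Proof.
rewrite pair_bigA /= (reindex (fun ws : {ffun I -> B} * {ffun I -> A} =>
  [ffun b => (ws.2 b, ws.1 b)])) //=.
exists (fun y => ([ffun b => (y b).2], [ffun b => (y b).1])) => [[w s] _|y _] /=.
  by congr (_, _); apply/ffunP => b; rewrite !ffunE.
by apply/ffunP => b; rewrite !ffunE -surjective_pairing.
Qed.

Section BlockGraphs.

Variables (V Omega : finType) (e : bool * Omega -> rel V).
Hypothesis e_sym : forall w, symmetric (e w).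
Hypothesis e_irr : forall w, irreflexive (e w).

Variable m : nat.
Local Notation W := ('I_m * V)%type.
Local Notation n := #|{: 'I_m * V}|.

Definition block_rel (w : {ffun 'I_m -> bool * Omega}) : rel 'I_n := fun i j =>
  let x : W := enum_val i in let y : W := enum_val j in
  (x.1 == y.1) && e (w x.1) x.2 y.2.

Definition block_graph w : sgraph 'I_n := rel_graph (block_rel w).

Lemma block_rel_sym w : symmetric (block_rel w).
Proof.
by move=> i j; rewrite /block_rel eq_sym; case: eqP => //= ->; apply: e_sym.
Qed.

Lemma block_rel_irr w : irreflexive (block_rel w).
Proof. by move=> i; rewrite /block_rel e_irr andbF. Qed.

Lemma sum_vertices (R : nmodType) (F : W -> R) :
  \sum_(i < n) F (enum_val i) = \sum_b \sum_x F (b, x).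
Proof.
rewrite pair_bigA /= (reindex (@enum_rank {: 'I_m * V})) /=; last first.
  by exists enum_val => z _; rewrite ?enum_rankK ?enum_valK.
by apply: eq_bigr => -[b x] _; rewrite enum_rankK.
Qed.

Lemma card_in_block (P : pred V) b :
  #|[set j : 'I_n | ((enum_val j).1 == b) && P (enum_val j).2]| = #|[set y | P y]|.
Proof.
rewrite -(card_in_imset (f := fun y => enum_rank (b, y) : 'I_n) (D := mem [set y | P y])).
  apply: eq_card => j; apply/idP/imsetP => [|[y yP ->]].
    rewrite inE => /andP[/eqP jb Pxj]; exists (enum_val j).2; first by rewrite inE.
    by rewrite -jb -surjective_pairing enum_valK.
  by rewrite inE enum_rankK /= eqxx; move: yP; rewrite inE.
by move=> y z _ _ /enum_rank_inj[].
Qed.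

Lemma maxdeg_block_graph w d : (forall w' x, (#|[set y | e w' x y]| <= d)%N) ->
  (maxdeg (block_graph w) <= d)%N.
Proof.
move=> hd; apply/bigmax_leqP => i _.
rewrite (deg_rel_graph (@block_rel_sym w) (@block_rel_irr w)).
apply: leq_trans (hd (w (enum_val i).1) (enum_val i).2).
rewrite -(card_in_block (e (w (enum_val i).1) (enum_val i).2) (enum_val i).1).
apply: subset_leq_card; apply/fintype.subsetP => j.
by rewrite !inE /block_rel eq_sym.
Qed.

Lemma ntriangles_block_graph w (tc : bool -> nat) :
  (forall w', (6 * tc w'.1 = \sum_x \sum_(y | e w' x y) common_nbrs (e w') x y)%N) ->
  ntriangles (block_graph w) = (\sum_b tc (w b).1)%N.
Proof.
move=> htc; apply/eqP; rewrite -(eqn_pmul2l (isT : 0 < 6)%N) big_distrr /=.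
rewrite (ntriangles_rel_graph (@block_rel_sym w) (@block_rel_irr w)).
pose C (z : W) := (\sum_(y | e (w z.1) z.2 y) common_nbrs (e (w z.1)) z.2 y)%N.
rewrite (eq_bigr (fun i => C (enum_val i))) => [|i _].
  by rewrite (sum_vertices C); apply/eqP; apply: eq_bigr => b _; rewrite htc.
pose D (z : W) := if ((enum_val i).1 == z.1) && e (w (enum_val i).1) (enum_val i).2 z.2
  then common_nbrs (e (w (enum_val i).1)) (enum_val i).2 z.2 else 0%N.
rewrite big_mkcond /= (eq_bigr (fun j => D (enum_val j))) => [|j _].
  rewrite (sum_vertices D) (bigD1 (enum_val i).1) //= [X in _ + X]big1 => [|b ne].
    by rewrite addr0 /C [RHS]big_mkcond; apply: eq_bigr => y _; rewrite /D /= eqxx.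
  by apply: big1 => x _; rewrite /D eq_sym (negPf ne).
rewrite /D /block_rel; case: ifP => // /andP[/eqP ij _].
rewrite /common_nbrs -(card_in_block _ (enum_val i).1); apply: eq_card => k.
rewrite !inE -ij !(eq_sym _ (enum_val k).1).
by case: eqP => //= ->.
Qed.

(** What a sample shows of a block: the sampled vertices and the edges they
   meet. *)
Definition block_view (r : rel V) (S : {set V}) : {set V * V} :=
  [set xy | r xy.1 xy.2 && ((xy.1 \in S) || (xy.2 \in S))].

Definition assemble (o : {ffun 'I_m -> {set V} * {set V * V}}) : bicolored 'I_n :=
  (rel_graph (fun i j => let x : W := enum_val i in let y : W := enum_val j in
     (x.1 == y.1) && ((x.2, y.2) \in (o x.1).2)),
   [set i | (enum_val i : W).2 \in (o (enum_val i : W).1).1]).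

Definition join_samples (s : {ffun 'I_m -> {set V}}) : {set 'I_n} :=
  [set i | (enum_val i : W).2 \in s (enum_val i : W).1].

Lemma nbhd_sample_block_graph w s :
  nbhd_sample (block_graph w) (join_samples s) =
  assemble [ffun b => (s b, block_view (e (w b)) (s b))].
Proof.
rewrite nbhd_sample_rel_graph; congr (_, _); last first.
  by apply/setP => i; rewrite !finset.in_set ffunE.
apply: val_inj; apply/setP => f /=; rewrite !finset.in_set.
apply: eq_existsb => i; apply: eq_existsb => j; congr [&& _, _ & _].
rewrite /block_rel ffunE /= !finset.in_set /=.
by case: eqP => //= ->.
Qed.

Lemma sum_samples (R : nmodType) (F : {set 'I_n} -> R) :
  \sum_S F S = \sum_(s : {ffun 'I_m -> {set V}}) F (join_samples s).
Proof.
rewrite (reindex join_samples) //.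
exists (fun S : {set 'I_n} => [ffun b => [set x | (enum_rank (b, x) : 'I_n) \in S]]) => [s _|S _].
  by apply/ffunP => b; rewrite ffunE; apply/setP => x; rewrite !finset.in_set enum_rankK.
apply/setP => i; rewrite finset.in_set ffunE finset.in_set.
by rewrite -surjective_pairing enum_valK.
Qed.

Lemma sample_prob_join (R : realType) (p : R) (s : {ffun 'I_m -> {set V}}) :
  sample_prob p (join_samples s) = \prod_b sample_prob p (s b).
Proof.
rewrite /sample_prob pair_bigA /= (reindex (@enum_rank {: 'I_m * V})) /=; last first.
  by exists enum_val => z _; rewrite ?enum_rankK ?enum_valK.
by apply: eq_bigr => -[b x] _; rewrite finset.in_set enum_rankK.
Qed.

Lemma planar_block_graph (R : realType) w (K : nat) (pos : bool * Omega -> V -> nat)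
    (page : bool * Omega -> V -> V -> bool) :
  (forall w' x, (pos w' x < K)%N) ->
  (forall w', two_page (e w') (pos w') (page w')) -> planar R (block_graph w).
Proof.
move=> posK book.
pose ps (i : 'I_n) := let z : W := enum_val i in (z.1 * K + pos (w z.1) z.2)%N.
pose pg (i j : 'I_n) := let z : W := enum_val i in let z' : W := enum_val j in
  page (w z.1) z.2 z'.2.
apply: (@two_page_planar R _ (block_rel w) ps
  (fun i j => if block_rel w i j then pg i j else false)).
- exact: block_rel_sym.
- exact: block_rel_irr.
apply: (two_page_stack (comp := fun i : 'I_n => (enum_val i : W).1)
  (inner := fun i : 'I_n => let z : W := enum_val i in pos (w z.1) z.2)) => //.
- by move=> i j /andP[/eqP->].
- move=> i j /val_inj E; rewrite /= E; have [pinj _ _] := book (w (enum_val j).1).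
  move=> /pinj E2; apply: enum_val_inj.
  by rewrite (surjective_pairing (enum_val i)) E E2 -surjective_pairing.
- move=> i j; rewrite block_rel_sym; case: ifP => // /andP[/eqP ij _].
  by rewrite /pg -ij; have [_ psym _] := book (w (enum_val j).1); apply: psym.
move=> i j k l /val_inj ik ij kl; rewrite ij kl /= => pgE.
move: ij kl pgE => /andP[/eqP ij eij] /andP[/eqP kl ekl]; rewrite /pg /=.
rewrite -kl -ij -ik in ekl * => pgE.
by have [_ _ nc] := book (w (enum_val i).1); apply: nc.
Qed.

End BlockGraphs.

(** * Gadgets *)

(** A gadget graph in two shapes, each placed on its vertices according to a
   labelling: [tc] counts the triangles of a layout, and [rev S om] marks the
   samples that may tell the shapes apart.  On all other samples the views of
   the two shapes are equidistributed over the labellings. *)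
Record gadget (V Omega : finType) := Gadget {
  layout : bool * Omega -> rel V;
  tc : bool -> nat;
  rev : {set V} -> Omega -> bool;
  spine : bool * Omega -> V -> nat;
  page : bool * Omega -> V -> V -> bool;
  spine_bound : nat;
  layout_sym : forall w, symmetric (layout w);
  layout_irr : forall w, irreflexive (layout w);
  spine_lt : forall w x, (spine w x < spine_bound)%N;
  layout_book : forall w, two_page (layout w) (spine w) (page w);
  tcE : forall w, (6 * tc w.1 =
    \sum_x \sum_(y | layout w x y) common_nbrs (layout w) x y)%N;
  indist : forall S v,
    #|[set om | ~~ rev S om && (block_view (layout (true, om)) S == v)]| =
    #|[set om | ~~ rev S om && (block_view (layout (false, om)) S == v)]|;
  labels_gt0 : (0 < #|Omega|)%N
}.

Section BlockLowerBound.

Variables (R : realType) (p : R).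
Hypothesis p01 : 0 < p <= 1.
Variables (V Omega : finType) (B : gadget V Omega).
Local Notation e := (layout B).
Local Notation rev := (rev B).
Local Notation tc := (tc B).

Definition reveal_prob : R :=
  \sum_S sample_prob p S * (#|[set om | rev S om]|%:R / #|Omega|%:R).

Variable eps : R.
Hypothesis eps_le : eps ^+ 2 <= 1 / 8.
Hypothesis eps_ge0 : 0 <= eps.

(* The hypothesis [theta] favours the shape [beta = theta]. *)
Let q (theta beta : bool) : R := if theta == beta then 1 / 2 + eps else 1 / 2 - eps.

Let q_gt0 theta beta : 0 < q theta beta.
Proof.
have e2 : eps < 1 / 2.
  rewrite ltNge; apply/negP => h2.
  have : (1 / 2) ^+ 2 <= eps ^+ 2 by rewrite lerXn2r // nnegrE; lra.
  by move: eps_le; rewrite !expr2 => h1 h3; lra.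
by have e0 := eps_ge0; rewrite /q; case: ifP => _; lra.
Qed.

Let q_sum theta : q theta true + q theta false = 1.
Proof. by rewrite /q; case: theta => /=; lra. Qed.

Let Y := ({set V} * (bool * Omega))%type.

Let mu (theta : bool) (y : Y) : R :=
  sample_prob p y.1 * (q theta y.2.1 / #|Omega|%:R).

(* A revealed block counts as if both shapes were equally likely. *)
Let h (theta : bool) (y : Y) : R :=
  if rev y.1 y.2.2 then (2 * q theta y.2.1)^-1 else 1.

Let obs (y : Y) := (y.1, block_view (e y.2) y.1).

Let tau (y : Y) : R := (tc y.2.1)%:R.

Let OmegaR_gt0 : 0 < #|Omega|%:R :> R. Proof. by rewrite ltr0n (labels_gt0 B). Qed.

Let sum_prob : \sum_(S : {set V}) sample_prob p S = 1 :> R.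
Proof.
rewrite -[RHS](@expect_cst R V p 1) /sample_expect.
by apply: eq_bigr => S _; rewrite mulr1.
Qed.

Let sumY (F : Y -> R) : \sum_y F y =
  \sum_(S : {set V}) \sum_(om : Omega) (F (S, (true, om)) + F (S, (false, om))).
Proof.
transitivity (\sum_S \sum_(w : bool * Omega) F (S, w)); first by rewrite pair_bigA; apply: eq_bigr => -[].
apply: eq_bigr => S _; rewrite big_split /=.
transitivity (\sum_(beta : bool) \sum_om F (S, (beta, om))); first by rewrite pair_bigA; apply: eq_bigr => -[].
by rewrite big_bool.
Qed.

Let reveal_prob_sum : reveal_prob =
  \sum_S \sum_om sample_prob p S / #|Omega|%:R * (rev S om)%:R.
Proof.
apply: eq_bigr => S _; rewrite -mulr_sumr (sumr_indicator _ xpredT) -mulrA.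
by rewrite [X in _ * X]mulrC.
Qed.

Let sum_const : \sum_(S : {set V}) \sum_(om : Omega) sample_prob p S / #|Omega|%:R = 1 :> R.
Proof.
rewrite -[RHS]sum_prob; apply: eq_bigr => S _.
by rewrite sumr_const -[_ *+ _]mulr_natr divfK // gt_eqF.
Qed.

Let weight_ge0 (S : {set V}) : 0 <= sample_prob p S / #|Omega|%:R.
Proof. by rewrite divr_ge0 ?sample_prob_ge0. Qed.

Lemma reveal_prob_bounds : 0 <= reveal_prob <= 1.
Proof.
rewrite reveal_prob_sum -[X in _ <= _ <= X]sum_const; apply/andP; split.
  apply: sumr_ge0 => S _; apply: sumr_ge0 => om _.
  by rewrite mulr_ge0 ?weight_ge0.
apply: ler_sum => S _; apply: ler_sum => om _.
by rewrite ler_piMr ?weight_ge0 //; case: (rev S om).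
Qed.

Let reveal_prob_compl : 1 - reveal_prob =
  \sum_(S : {set V}) \sum_om sample_prob p S / #|Omega|%:R * (1 - (rev S om)%:R).
Proof.
rewrite reveal_prob_sum -[X in X - _]sum_const -sumrB; apply: eq_bigr => S _.
by rewrite -sumrB; apply: eq_bigr => om _; rewrite mulrBr mulr1.
Qed.

Let mu_ge0 theta y : 0 <= mu theta y.
Proof.
by rewrite /mu mulr_ge0 ?sample_prob_ge0 // divr_ge0 // ltW ?q_gt0.
Qed.

Let mu_h1 theta : \sum_y mu theta y * h theta y = 1.
Proof.
rewrite sumY -[RHS]sum_const; apply: eq_bigr => S _; apply: eq_bigr => om _.
rewrite /mu /h /=; have := q_sum theta; have := q_gt0 theta true; have := q_gt0 theta false.
move: (q theta true) (q theta false) => a b b0 a0 ab.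
case: (rev S om); last by rewrite !mulr1 -mulrDr -mulrDl ab mul1r.
rewrite -mulrA -[X in _ + X]mulrA -mulrDr; congr (_ * _); field.
by rewrite !gt_eqF.
Qed.

(* Reweighted revealed blocks have no bias, and the others show the same in both
   shapes, so their bias is averaged out. *)
Let kappa o : \sum_(y | obs y == o) mu true y * h true y =
  \sum_(y | obs y == o) mu false y * h false y.
Proof.
case: o => S0 v.
suff E theta : \sum_(y | obs y == (S0, v)) mu theta y * h theta y =
    sample_prob p S0 / #|Omega|%:R *
    (#|[set om | ~~ rev S0 om && (block_view (e (true, om)) S0 == v)]|%:R +
     \sum_om (rev S0 om)%:R / 2 * ((block_view (e (true, om)) S0 == v)%:R +
       (block_view (e (false, om)) S0 == v)%:R)).
  by rewrite !E.
rewrite big_mkcond sumY (bigD1 S0) //= [X in _ + X]big1 ?addr0 => [|S ne]; last first.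
  by apply: big1 => om _; rewrite /obs !xpair_eqE (negPf ne) /= addr0.
pose N := #|[set om | ~~ rev S0 om && (block_view (e (true, om)) S0 == v)]|.
rewrite -/N.
have N1 : N%:R = \sum_om (~~ rev S0 om && (block_view (e (true, om)) S0 == v))%:R :> R.
  by rewrite (sumr_indicator _ xpredT).
have N2 : N%:R = \sum_om (~~ rev S0 om && (block_view (e (false, om)) S0 == v))%:R :> R.
  by rewrite /N (indist B) (sumr_indicator _ xpredT).
have -> : N%:R = q theta true * N%:R + q theta false * N%:R.
  by rewrite -mulrDl q_sum mul1r.
rewrite {1}N1 N2 !mulr_sumr -!big_split /= mulr_sumr; apply: eq_bigr => om _.
rewrite /obs !xpair_eqE eqxx /= /mu /h /=.
have := q_gt0 theta true; have := q_gt0 theta false.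
move: (q theta true) (q theta false) => a b b0 a0.
have [a1 b1] : a != 0 /\ b != 0 by rewrite !gt_eqF.
have O0 : #|Omega|%:R != 0 :> R by rewrite gt_eqF.
case: (rev S0 om) => /=; case: eqP => _; case: eqP => _ /=; field; rewrite ?O0 ?a1 ?b1 //.
Qed.

Let second_moment theta : \sum_y mu theta y * h theta y ^+ 2 <=
  1 + 8 * reveal_prob * eps ^+ 2.
Proof.
rewrite sumY -[X in _ <= X + _]sum_const reveal_prob_sum mulr_sumr mulr_suml -big_split /=.
apply: ler_sum => S _; rewrite mulr_sumr mulr_suml -big_split /=.
apply: ler_sum => om _; rewrite /mu /h /=.
have := q_sum theta; have := q_gt0 theta true; have := q_gt0 theta false.
have : q theta true * q theta false = 1 / 4 - eps ^+ 2.
  by rewrite /q; case: theta => /=; field.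
move: (q theta true) (q theta false) => a b ab b0 a0 ab1.
have [a1 b1] : a != 0 /\ b != 0 by rewrite !gt_eqF.
have O0 : #|Omega|%:R != 0 :> R by rewrite gt_eqF.
case: (rev S om); rewrite /= ?expr1n ?mulr1; last first.
  by rewrite !(mulr0, mul0r, addr0) -mulrDr -mulrDl ab1 mul1r.
have -> : sample_prob p S * (a / #|Omega|%:R) * (2 * a)^-1 ^+ 2 +
    sample_prob p S * (b / #|Omega|%:R) * (2 * b)^-1 ^+ 2 =
    sample_prob p S / #|Omega|%:R * ((a + b) / (4 * (a * b))).
  by field; rewrite O0 a1 b1.
rewrite ab1 ab; have := weight_ge0 S.
move: (sample_prob p S / #|Omega|%:R) => w w0.
apply: (@le_trans _ _ (w * (1 + 8 * eps ^+ 2))); last first.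
  by rewrite le_eqVlt; apply/orP; left; apply/eqP; ring.
rewrite ler_wpM2l //; have e1 := eps_le.
have e0 : 0 <= eps ^+ 2 by rewrite sqr_ge0.
by rewrite ler_pdivrMr; nra.
Qed.

Let score_diff : score_mean mu h tau true - score_mean mu h tau false =
  2 * eps * (1 - reveal_prob) * ((tc true)%:R - (tc false)%:R).
Proof.
rewrite /score_mean !sumY -sumrB reveal_prob_compl.
rewrite [2 * eps * _]mulr_sumr mulr_suml; apply: eq_bigr => S _.
rewrite -sumrB mulr_sumr mulr_suml; apply: eq_bigr => om _.
rewrite /mu /h /tau /=.
have := q_gt0 true true; have := q_gt0 true false; rewrite /q /=.
have O0 : #|Omega|%:R != 0 :> R by rewrite gt_eqF.
set a := 1 / 2 + eps; set b := 1 / 2 - eps => b0 a0.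
have [a1 b1] : a != 0 /\ b != 0 by rewrite !gt_eqF.
have ab : a - b = 2 * eps by rewrite /a /b; ring.
rewrite -ab; case: (rev S om) => /=.
  by rewrite subrr mulr0 mulr0 mul0r; field; rewrite O0 a1 b1.
by rewrite subr0; field.
Qed.

Variables (d t m : nat).
Hypothesis deg_le : forall w x, (#|[set y | e w x y]| <= d)%N.
Hypothesis tri_le : (m * maxn (tc true) (tc false) <= t)%N.

Lemma product_mean_risk (est : estimator R) theta :
  product_mean mu theta (fun y : {ffun 'I_m -> Y} =>
    (est _ (assemble [ffun b => obs (y b)]) - \sum_b tau (y b)) ^+ 2) =
  \sum_(w : {ffun 'I_m -> bool * Omega})
    (\prod_b (q theta (w b).1 / #|Omega|%:R)) * risk p est (block_graph e w).
Proof.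
rewrite /product_mean sum_ffun_pair; apply: eq_bigr => w _.
rewrite /risk /sample_expect sum_samples mulr_sumr; apply: eq_bigr => s _.
rewrite sample_prob_join nbhd_sample_block_graph (ntriangles_block_graph (layout_sym B) (layout_irr B) _ (tcE B)).
under eq_bigr => b _ do rewrite /mu ffunE /=.
rewrite big_split /= -[LHS]mulrA [LHS]mulrCA; congr (_ * (_ * _)).
rewrite -normrX ger0_norm ?sqr_ge0 // natr_sum; congr ((est _ (assemble _) - _) ^+ 2).
  by apply/ffunP => b; rewrite !ffunE.
by apply: eq_bigr => b _; rewrite /tau ffunE.
Qed.

(** The risk in the worst case is at least the risk averaged over the shapes and
   labels of the blocks and over both hypotheses. *)
Theorem block_lower_bound :
  (((m%:R * ((1 - reveal_prob) * eps * ((tc true)%:R - (tc false)%:R))) ^+ 2 /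
     (1 + 8 * reveal_prob * eps ^+ 2) ^+ m)%:E <= minimax_risk p d t)%E.
Proof.
apply: le_ereal_inf_tmp => _ [est _ <-].
set LB := (_ / _).
have riskM (w : {ffun 'I_m -> bool * Omega}) : ((risk p est (block_graph e w))%:E <= worst_risk p d t est)%E.
  apply: ereal_sup_ubound; exists #|{: 'I_m * V}|, (block_graph e w); split=> //.
  - by apply: planar_block_graph (spine_lt B) (layout_book B); [exact: layout_sym|exact: layout_irr].
  - by apply: maxdeg_block_graph deg_le; [exact: layout_sym|exact: layout_irr].
  - rewrite (ntriangles_block_graph (layout_sym B) (layout_irr B) _ (tcE B)); apply: leq_trans tri_le.
    rewrite -[m in leqRHS]card_ord -sum_nat_const; apply: leq_sum => b _.
    by rewrite leq_max; case: (w b).1; rewrite leqnn ?orbT.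
have B0 : 0 < 1 + 8 * reveal_prob * eps ^+ 2.
  have /andP[r0 _] := reveal_prob_bounds.
  by rewrite ltr_wpDr // !mulr_ge0 // sqr_ge0.
have := product_bayes_lower_bound (m := m) tau mu_ge0 mu_h1 kappa
  (fun o => est _ (assemble o)) B0 second_moment.
rewrite score_diff.
have -> : (m%:R * (2 * eps * (1 - reveal_prob) * ((tc true)%:R - (tc false)%:R)) / 2)
   = m%:R * ((1 - reveal_prob) * eps * ((tc true)%:R - (tc false)%:R)) by field.
rewrite -/LB => LBle.
have om0 : Omega by have /card_gt0P/sigW[] := labels_gt0 B.
have := riskM [ffun=> (true, om0)].
case E : (worst_risk p d t est) => [M| |] // _; last by rewrite leey.
rewrite lee_fin; apply: le_trans LBle _.
rewrite (eq_bigr (fun theta => 2^-1 * \sum_(w : {ffun 'I_m -> bool * Omega})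
    (\prod_b (q theta (w b).1 / #|Omega|%:R)) * risk p est (block_graph e w))).
  have avg theta : \sum_(w : {ffun 'I_m -> bool * Omega})
    (\prod_b (q theta (w b).1 / #|Omega|%:R)) * risk p est (block_graph e w) <= M.
    have <- : \sum_(w : {ffun 'I_m -> bool * Omega})
      (\prod_b (q theta (w b).1 / #|Omega|%:R)) * M = M.
      rewrite -mulr_suml -(bigA_distr_bigA (fun (i : 'I_m) (w : bool * Omega) => q theta w.1 / #|Omega|%:R)).
      rewrite big1 ?mul1r // => b _.
      transitivity (\sum_beta \sum_(om : Omega) q theta beta / #|Omega|%:R).
        by rewrite pair_bigA; apply: eq_bigr => -[].
      rewrite big_bool /= !sumr_const -[X in X + _]mulr_natr -[X in _ + X]mulr_natr.
      by rewrite !divfK ?gt_eqF // q_sum.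
    apply: ler_sum => w _; apply: ler_wpM2l.
      by apply: prodr_ge0 => b _; rewrite divr_ge0 // ltW ?q_gt0.
    by have := riskM w; rewrite E lee_fin.
  by rewrite big_bool /=; have := avg true; have := avg false; lra.
by move=> theta _; rewrite product_mean_risk.
Qed.

End BlockLowerBound.

(** The best [eps] makes the factor [(1 + 8 rho eps^2)^m] at most [e]. *)
Theorem gadget_lower_bound (R : realType) (p : R) (V Omega : finType)
    (B : gadget V Omega) (d t m : nat) (rho kap : R) : 0 < p <= 1 ->
  (forall w x, (#|[set y | layout B w x y]| <= d)%N) ->
  (m * maxn (tc B true) (tc B false) <= t)%N ->
  reveal_prob p B <= rho -> 0 <= kap <= 1 - reveal_prob p B ->
  ((kap ^+ 2 * ((tc B true)%:R - (tc B false)%:R) ^+ 2 * m%:R ^+ 2 /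
      (8 * expR 1 * Num.max 1 (rho * m%:R)))%:E <= minimax_risk p d t)%E.
Proof.
move=> p01 hd ht hrho /andP[kap0 hkap].
have /andP[r0 r1] := reveal_prob_bounds p01 B.
set r := reveal_prob p B in hrho hkap r0 r1 *.
pose M := Num.max 1 (rho * m%:R).
have M1 : 1 <= M by rewrite le_max lexx.
have M0 : 0 < M by apply: lt_le_trans M1.
pose eps := Num.sqrt (1 / (8 * M)).
have eps2 : eps ^+ 2 = 1 / (8 * M) by rewrite sqr_sqrtr // divr_ge0 // mulr_ge0 // ltW.
have eps_le : eps ^+ 2 <= 1 / 8.
  by rewrite eps2 !div1r lef_pV2 ?posrE ?mulr_gt0 // ler_peMr.
apply: le_trans _ (block_lower_bound p01 eps_le (sqrtr_ge0 _) hd ht).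
rewrite lee_fin -/r; set D := (tc B true)%:R - (tc B false)%:R.
have e8 : 8 * r * eps ^+ 2 = r / M.
  by rewrite eps2; field; rewrite gt_eqF.
rewrite e8.
have rm : r / M * m%:R <= 1.
  rewrite mulrAC ler_pdivrMr // mul1r; apply: le_trans (_ : rho * m%:R <= _).
    by rewrite ler_wpM2r.
  by rewrite le_max lexx orbT.
have rM0 : 0 <= r / M by rewrite divr_ge0 // ltW.
have den : (1 + r / M) ^+ m <= expR 1.
  apply: le_trans (_ : expR (r / M) ^+ m <= _).
    by rewrite lerXn2r ?nnegrE ?expR_ge0 ?addr_ge0 // expR_ge1Dx.
  by rewrite -expRM_natr ler_expR.
have den0 : 0 < (1 + r / M) ^+ m by rewrite exprn_gt0 // ltr_pwDl.
have -> : (m%:R * ((1 - r) * eps * D)) ^+ 2 / (1 + r / M) ^+ m =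
    ((1 - r) ^+ 2 * D ^+ 2 * m%:R ^+ 2 / (8 * M)) / (1 + r / M) ^+ m.
  congr (_ / _); transitivity ((1 - r) ^+ 2 * D ^+ 2 * m%:R ^+ 2 * eps ^+ 2); first by ring.
  by rewrite eps2 mulrA mulr1.
have -> : kap ^+ 2 * D ^+ 2 * m%:R ^+ 2 / (8 * expR 1 * M) =
   (kap ^+ 2 * D ^+ 2 * m%:R ^+ 2 / (8 * M)) / expR 1.
  by field; rewrite !gt_eqF ?expR_gt0.
apply: ler_pM.
- apply: divr_ge0; last by rewrite mulr_ge0 // ltW.
  by do 2 (apply: mulr_ge0; last exact: sqr_ge0); exact: sqr_ge0.
- by rewrite invr_ge0 expR_ge0.
- rewrite ler_wpM2r ?invr_ge0 ?mulr_ge0 ?(ltW M0) //.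
  by rewrite ler_wpM2r ?sqr_ge0 // ler_wpM2r ?sqr_ge0 // lerXn2r ?nnegrE // subr_ge0.
- by rewrite lef_pV2 ?posrE ?expR_gt0.
Qed.

(** * Books with and without a spine *)

Section BookGadget.

Variable k : nat.
Local Notation V := (bool + 'I_k)%type.

Definition book_shape (w : bool * unit) : rel V := fun x y =>
  match x, y with
  | inl a, inl b => w.1 && (a != b)
  | inr _, inr _ => false
  | _, _ => true
  end.

Definition book_spine (w : bool * unit) (x : V) : nat :=
  match x with inl true => 0 | inl false => k.+1 | inr i => i.+1 end.

Definition book_page (w : bool * unit) (x y : V) : bool :=
  (x == inl true) || (y == inl true).

Lemma card_sum_type (A B : finType) (P : pred (A + B)) :
  #|[set z | P z]| = (#|[set a | P (inl a)]| + #|[set b | P (inr b)]|)%N.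
Proof.
by rewrite -!sum1dep_card big_mkcond big_sumType -!big_mkcond.
Qed.

Lemma card_set_bool (P : pred bool) : #|[set b | P b]| = (P true + P false)%N.
Proof. by rewrite -sum1dep_card big_mkcond big_bool /=; case: (P true); case: (P false). Qed.

Lemma card_set_pred0 (A : finType) (P : pred A) : P =1 xpred0 -> #|[set a | P a]| = 0%N.
Proof. by move=> P0; apply: eq_card0 => a; rewrite inE P0. Qed.

Lemma card_set_predT (A : finType) (P : pred A) : P =1 xpredT -> #|[set a | P a]| = #|A|.
Proof. by move=> PT; apply: eq_card => a; rewrite inE PT. Qed.

Lemma book_common_hubs w a b :
  common_nbrs (book_shape w) (inl a) (inl b) = ((w.1 && (a == b)) + k)%N.
Proof.
rewrite /common_nbrs card_sum_type (card_set_predT (A := 'I_k)) // card_ord card_set_bool /=.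
by case: w => [[] ?]; case: a; case: b.
Qed.

Lemma book_common_page w a i : common_nbrs (book_shape w) (inl a) (inr i) = w.1.
Proof.
rewrite /common_nbrs card_sum_type (card_set_pred0 (A := 'I_k)) // card_set_bool /=.
by case: w => [[] ?]; case: a.
Qed.

Lemma common_nbrsC (W : finType) (r : rel W) x y : common_nbrs r x y = common_nbrs r y x.
Proof. by apply: eq_card => z; rewrite !inE andbC. Qed.

Lemma book_tcE (w : bool * unit) : (6 * (if w.1 then k else 0) =
  \sum_x \sum_(y | book_shape w x y) common_nbrs (book_shape w) x y)%N.
Proof.
have hub a : (\sum_(y | book_shape w (inl a) y) common_nbrs (book_shape w) (inl a) y
    = w.1 * (2 * k))%N.
  rewrite big_mkcond big_sumType big_bool /=.
  under [X in (_ + X)%N = _]eq_bigr do rewrite book_common_page.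
  rewrite !book_common_hubs sum_nat_const card_ord.
  by case: w => [[] ?]; case: a => /=; lia.
have leaf i : (\sum_(y | book_shape w (inr i) y) common_nbrs (book_shape w) (inr i) y
    = w.1 * 2)%N.
  rewrite big_mkcond big_sumType big_bool /= big1 // !(common_nbrsC _ (inr i)).
  by rewrite !book_common_page; lia.
rewrite big_sumType big_bool /= !hub.
under eq_bigr do rewrite leaf.
by rewrite sum_nat_const card_ord; case: w.1; lia.
Qed.

Lemma book_two_page w : two_page (book_shape w) (book_spine w) (book_page w).
Proof.
split.
- move=> [[]|i] [[]|j] //=; rewrite /book_spine; try (by have := ltn_ord i; lia).
  + by have := ltn_ord j; lia.
  + by move=> [/val_inj->].
- by move=> x y; rewrite /book_page orbC.
- move=> [[]|a] [[]|b] [[]|c] [[]|d] //= _ _ _ [h1 h2 h3]; move: h1 h2 h3;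
  rewrite ?ltnn ?ltnS ?ltn0 //.
  all: try have := ltn_ord a; try have := ltn_ord b.
  all: try have := ltn_ord c; try have := ltn_ord d.
  all: lia.
Qed.

Definition book_rev (S : {set V}) (_ : unit) : bool :=
  (inl true \in S) || (inl false \in S).

(** The shapes differ by the edge between the two hubs only. *)
Lemma book_indist (S : {set V}) v :
  #|[set om | ~~ book_rev S om && (block_view (book_shape (true, om)) S == v)]| =
  #|[set om | ~~ book_rev S om && (block_view (book_shape (false, om)) S == v)]|.
Proof.
apply: eq_card => om; rewrite !inE; have [//|] := boolP (book_rev S om).
rewrite /book_rev negb_or => /andP[/negPf uS /negPf vS] /=; congr (_ == _).
apply/setP => -[[a|i] [b|j]]; rewrite !inE //=.
by case: a; case: b; rewrite /= ?uS ?vS.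
Qed.

Lemma book_shape_sym w : symmetric (book_shape w).
Proof. by move=> [a|i] [b|j] //=; rewrite eq_sym. Qed.

Lemma book_shape_irr w : irreflexive (book_shape w).
Proof. by move=> [a|i] //=; rewrite eqxx andbF. Qed.

Lemma book_spine_lt w x : (book_spine w x < k.+2)%N.
Proof. by case: x => [[]|i] //=; have := ltn_ord i; lia. Qed.

Definition book_gadget : gadget V unit :=
  Gadget (tc := fun b => if b then k else 0%N) book_shape_sym book_shape_irr
    book_spine_lt book_two_page book_tcE book_indist (eq_leq (esym card_unit)).

Lemma book_deg w x : (#|[set y | book_shape w x y]| <= maxn 2 k.+1)%N.
Proof.
rewrite card_sum_type card_set_bool; case: x => [a|i] /=.
  rewrite (card_set_predT (A := 'I_k)) // card_ord.
  by case: a; case: w.1 => /=; lia.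
by rewrite (card_set_pred0 (A := 'I_k)) //; lia.
Qed.

Lemma book_reveal_prob (R : realType) (p : R) :
  reveal_prob p book_gadget = 2 * p - p ^+ 2.
Proof.
transitivity (sample_expect p (fun S : {set V} => ([set inl true] \subset S)%:R +
    (([set inl false] \subset S)%:R + (-1) * ([set inl true; inl false] \subset S)%:R))).
  apply: eq_bigr => S _; congr (_ * _); rewrite card_unit divr1.
  rewrite finset.subUset !finset.sub1set.
  have [rS|rS] := boolP (book_rev S tt); rewrite /= ?cards0.
    rewrite (card_set_predT (A := unit)) => [|[]]; last exact: rS.
    move: rS; rewrite /book_rev card_unit; case: (_ \in S); case: (_ \in S) => //= _; lra.
  rewrite (card_set_pred0 (A := unit)) => [|[]]; last exact: negPf.
  by move: rS; rewrite /book_rev; case: (_ \in S); case: (_ \in S) => //= _; lra.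
rewrite !expectD expectZ !expect_subset !cards1 cards2 /=; ring.
Qed.

End BookGadget.

Lemma half_blocks (t k : nat) : (0 < k <= t)%N -> (t <= 2 * (t %/ k * k))%N.
Proof.
move=> /andP[k0 kt]; have : (1 <= t %/ k)%N by rewrite divn_gt0.
move=> m1; have := divn_eq t k; have := ltn_pmod t k0.
have : (k <= t %/ k * k)%N by rewrite leq_pmull.
by move: (t %/ k * k)%N (t %% k)%N => a b; lia.
Qed.

(** [m] blocks of size [k], of which a fraction [rho] is revealed. *)
Lemma block_rate (R : realFieldType) (k m rho A : R) : 0 <= k -> 0 < rho ->
  0 <= m -> A <= k * (k * m) / rho ->
  Num.min A ((k * m) ^+ 2) <= k ^+ 2 * m ^+ 2 / Num.max 1 (rho * m).
Proof.
move=> k0 r0 m0 hA; have [h|h] := leP (rho * m) 1.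
  by rewrite invr1 mulr1 -exprMn ge_min lexx orbT.
have m1 : 0 < m by rewrite -(pmulr_rgt0 _ r0); lra.
rewrite ge_min; apply/orP; left; apply: le_trans hA _.
by rewrite le_eqVlt; apply/orP; left; apply/eqP; field; rewrite !gt_eqF.
Qed.

Lemma vertex_rate (R : realFieldType) (K M T D p : R) : 0 < p <= 1 ->
  0 <= K -> 0 <= M -> 0 <= T -> 0 <= D -> T <= 2 * (K * M) -> D <= 2 * K \/ T <= K ->
  Num.min (T * D / p) (T ^+ 2) / 8 <= Num.min (K * (K * M) / (2 * p)) ((K * M) ^+ 2).
Proof.
move=> /andP[p0 p1] K0 M0 T0 D0; have X0 : 0 <= K * M by rewrite mulr_ge0.
move: (K * M) X0 => X X0 TX DK; have T20 := sqr_ge0 T.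
have m1 : Num.min (T * D / p) (T ^+ 2) <= T * D / p by rewrite ge_min lexx.
have m2 : Num.min (T * D / p) (T ^+ 2) <= T ^+ 2 by rewrite ge_min lexx orbT.
have KX0 : 0 <= K * X by rewrite mulr_ge0.
rewrite le_min; apply/andP; split; last by nra.
have -> : K * X / (2 * p) = (4 * (K * X) / p) / 8 by field; rewrite gt_eqF.
rewrite ler_pM2r ?invr_gt0 //; case: DK => h.
  by apply: le_trans m1 _; rewrite ler_pM2r ?invr_gt0 //; nra.
apply: le_trans m2 _; rewrite ler_pdivlMr //.
by apply: le_trans (_ : T ^+ 2 <= _); [rewrite ler_piMr|nra].
Qed.

Lemma minimax_risk_ge0 (R : realType) (p : R) (d t : nat) : 0 < p <= 1 ->
  (1 < d)%N -> (0 <= minimax_risk p d t)%E.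
Proof.
move=> p01 d1.
have := @gadget_lower_bound R p _ _ (book_gadget 1) d t 0
  (reveal_prob p (book_gadget 1)) 0 p01.
rewrite mul0n expr0n /= mul0r mul0r mul0r; apply=> //.
  by move=> w x; apply: leq_trans (book_deg _ _) _; rewrite maxnn.
have /andP[_ r1] := reveal_prob_bounds p01 (book_gadget 1).
by rewrite lexx subr_ge0.
Qed.

(** Blocks of [min (d - 1) t] triangles on a common edge. *)
Theorem minimax_risk_ge_vertex (R : realType) (p p0 : R) (d t : nat) :
  0 < p <= p0 -> p0 < 1 -> (1 < d)%N ->
  (((1 - p0) ^+ 4 / (64 * expR 1) *
     Num.min (t%:R * d%:R / p) (t%:R ^+ 2))%:E <= minimax_risk p d t)%E.
Proof.
move=> /andP[p_gt0 pp0] p01 d1.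
have p1 : 0 < p <= 1 by rewrite p_gt0 /= ltW // (le_lt_trans pp0).
have [->|t0] := posnP t.
  rewrite !mul0r expr0n /= minxx mulr0; exact: minimax_risk_ge0.
pose k := minn d.-1 t; have k0 : (0 < k)%N by rewrite leq_min t0 andbT; lia.
have kt : (k <= t)%N by rewrite geq_minr.
pose m := (t %/ k)%N.
have mk : (m * k <= t)%N by exact: leq_divM.
have tmk : (t <= 2 * (m * k))%N by apply: half_blocks; rewrite k0.
have kap : 0 <= (1 - p0) ^+ 2 <= 1 - reveal_prob p (book_gadget k).
  rewrite sqr_ge0 book_reveal_prob /=.
  have -> : 1 - (2 * p - p ^+ 2) = (1 - p) ^+ 2 by ring.
  by rewrite lerXn2r ?nnegrE; lra.
have rho : reveal_prob p (book_gadget k) <= 2 * p.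
  by rewrite book_reveal_prob gerBl sqr_ge0.
have hd w x : (#|[set y | layout (book_gadget k) w x y]| <= d)%N.
  apply: leq_trans (book_deg w x) _; rewrite geq_max d1 /=.
  by have : (k <= d.-1)%N by [rewrite geq_minl|]; lia.
have ht : (m * maxn (tc (book_gadget k) true) (tc (book_gadget k) false) <= t)%N.
  by rewrite /= maxn0.
apply: le_trans _ (gadget_lower_bound p1 hd ht rho kap).
rewrite lee_fin /= subr0.
have e0 : 0 < expR 1 :> R by rewrite expR_gt0.
set K := k%:R : R; set M := m%:R : R; set T := t%:R : R; set D := d%:R : R.
have K0 : 0 <= K by rewrite ler0n.
have M0 : 0 <= M by rewrite ler0n.
have T0 : 0 <= T by rewrite ler0n.
have TKM : T <= 2 * (K * M) by rewrite mulrC -!natrM ler_nat mulnC (mulnC k).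
have KD : D <= 2 * K \/ T <= K.
  rewrite /K /k /minn; case: ifP => _; [left|by right].
  by rewrite -natrM ler_nat; move: d1; clear; lia.
have rate : Num.min (T * D / p) (T ^+ 2) / 8 <= K ^+ 2 * M ^+ 2 / Num.max 1 (2 * p * M).
  apply: le_trans (block_rate K0 _ M0 (lexx (K * (K * M) / (2 * p)))); last by rewrite mulr_gt0.
  exact: vertex_rate.
rewrite (_ : _ / (8 * expR 1 * _) = ((1 - p0) ^+ 4 / (8 * expR 1)) *
    (K ^+ 2 * M ^+ 2 / Num.max 1 (2 * p * M))).
  rewrite (_ : _ / (64 * _) * _ = ((1 - p0) ^+ 4 / (8 * expR 1)) *
    (Num.min (T * D / p) (T ^+ 2) / 8)); last by field; rewrite gt_eqF.
  apply: ler_wpM2l rate; rewrite divr_ge0 ?exprn_ge0 ?mulr_ge0 ?(ltW e0) //.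
  by rewrite subr_ge0 ltW.
field; rewrite !gt_eqF //.
by rewrite lt_max ltr01.
Qed.

(** * Pairs of graphs under random labels *)

Lemma perm_of_colours (V : finType) (C : eqType) (c c' : V -> C) :
  (forall k, #|[set z | c z == k]| = #|[set z | c' z == k]|) ->
  exists tau : {perm V}, forall z, c' (tau z) = c z.
Proof.
move=> cnt; pose cl k := enum [set z | c z == k]; pose cl' k := enum [set z | c' z == k].
have sz k : size (cl k) = size (cl' k) by rewrite -!cardE cnt.
pose t z := nth z (cl' (c z)) (index z (cl (c z))).
have tlt z : (index z (cl (c z)) < size (cl' (c z)))%N.
  by rewrite -sz index_mem mem_enum inE.
have tc z : c' (t z) = c z.
  by have := mem_nth z (tlt z); rewrite mem_enum inE => /eqP.
have tinj : injective t.
  move=> z z' E; have ckk : c z = c z' by rewrite -!tc E.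
  have lt1 := tlt z; have := tlt z'; move: E; rewrite /t -ckk => E lt2.
  move: E; rewrite (set_nth_default z _ lt2) => /eqP; rewrite nth_uniq ?enum_uniq // => /eqP.
  by move/(congr1 (nth z (cl (c z)))); rewrite !nth_index ?mem_enum ?inE ?ckk ?eqxx.
by exists (perm tinj) => z; rewrite permE tc.
Qed.

Section Relabel.

Variables (V : finType) (g : bool -> rel V).
Hypothesis g_sym : forall beta, symmetric (g beta).
Hypothesis g_irr : forall beta, irreflexive (g beta).

Definition degree (r : rel V) x : nat := #|[set y | r x y]|.

Section Colours.

Variables (r : rel V) (a b : V).
Hypotheses (r_sym : symmetric r) (r_irr : irreflexive r).

Let colour z := (z == a, z == b, r a z, r b z).

Let N k1 k2 k3 k4 := #|[set z | colour z == (k1, k2, k3, k4)]|.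

(** The sizes of the sixteen classes of vertices, according to their equality and
   adjacency to [a] and [b], are functions of the data in the type of a pair. *)
Lemma colour_counts :
  [/\ forall k3 k4, N true true k3 k4 = [&& a == b, ~~ k3 & ~~ k4],
      forall k3 k4, N true false k3 k4 = [&& a != b, ~~ k3 & k4 == r a b],
      forall k3 k4, N false true k3 k4 = [&& a != b, k3 == r a b & ~~ k4],
      N false false true true = common_nbrs r a b &
      [/\ (N false false true false + common_nbrs r a b + r a b = degree r a)%N,
          (N false false false true + common_nbrs r a b + r a b = degree r b)%N &
          (N false false false false + N false false true false +
           N false false false true + common_nbrs r a b + (a != b).+1 = #|V|)%N]].
Proof.
have single (P : pred V) c : (forall z, P z -> z = c) -> #|[set z | P z]| = P c.
  move=> Pc; have [Pcc|Pcc] := boolP (P c).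
    rewrite -[RHS]/1%N -(cards1 c); apply: eq_card => z; rewrite !inE.
    by apply/idP/eqP => [/Pc//|->].
  by apply: eq_card0 => z; rewrite inE; apply: contraNF Pcc => Pz; rewrite -(Pc z Pz).
split.
- move=> k3 k4; rewrite /N (single _ a) => [|z /eqP[/eqP]//].
  rewrite /colour !xpair_eqE eqxx r_irr; case: (eqVneq a b) => [->|] //=.
  by rewrite r_irr; case: k3; case: k4.
- move=> k3 k4; rewrite /N (single _ a) => [|z /eqP[/eqP]//].
  rewrite /colour !xpair_eqE eqxx r_irr (r_sym b); case: (a == b) => //=.
  by rewrite (eq_sym k4); case: k3.
- move=> k3 k4; rewrite /N (single _ b) => [|z /eqP[_ /eqP]//].
  rewrite /colour !xpair_eqE eqxx r_irr (eq_sym b); case: (a == b) => //=.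
  by rewrite (eq_sym k3); case: k4; rewrite ?andbT ?andbF.
- apply: eq_card => z; rewrite !inE /colour !xpair_eqE.
  have [->|_] := eqVneq z a; first by rewrite r_irr.
  have [->|_] := eqVneq z b; first by rewrite r_irr andbF.
  by case: (r a z); case: (r b z).
have sumE (P : pred V) : #|[set z | P z]| = (\sum_z P z)%N.
  by rewrite -sum1dep_card big_mkcond; apply: eq_bigr => z _; case: (P z).
have adjE : (r a b : nat) = (\sum_z ((z == b) && r a b))%N.
  by rewrite -sumE (single _ b) ?eqxx // => z /andP[/eqP].
have adjE' : (r a b : nat) = (\sum_z ((z == a) && r a b))%N.
  by rewrite -sumE (single _ a) ?eqxx // => z /andP[/eqP].
split.
- rewrite {1}adjE /N /common_nbrs /degree !sumE -!big_split; apply: eq_bigr => z _ /=.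
  rewrite /colour !xpair_eqE; have [->|za] := eqVneq z a.
    by rewrite r_irr /=; have [->|] := eqVneq a b; rewrite ?r_irr.
  have [->|zb] := eqVneq z b; first by rewrite r_irr andbF; case: (r a b).
  by case: (r a z); case: (r b z).
- rewrite {1}adjE' /N /common_nbrs /degree !sumE -!big_split; apply: eq_bigr => z _ /=.
  rewrite /colour !xpair_eqE; have [->|za] := eqVneq z a.
    by rewrite r_irr (r_sym b) /=; case: (r a b).
  have [->|zb] := eqVneq z b; first by rewrite r_irr andbF.
  by case: (r a z); case: (r b z).
- have -> : ((a != b).+1 = \sum_z ((z == a) || (z == b)))%N.
    rewrite -sumE -cards2; apply: eq_card => z; by rewrite !inE.
  rewrite -cardsT /N /common_nbrs !sumE -!big_split; apply: eq_bigr => z _ /=.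
  rewrite /colour !xpair_eqE; have [->|za] := eqVneq z a.
    by rewrite r_irr.
  have [->|zb] := eqVneq z b; first by rewrite r_irr andbF.
  by case: (r a z); case: (r b z).
Qed.

End Colours.

(** Two vertices of a graph, together with their neighbourhoods, are determined
   up to a relabelling by these data. *)
Definition same_pair_type (r r' : rel V) (a b a' b' : V) : Prop :=
  [/\ (a == b) = (a' == b'), r a b = r' a' b',
      degree r a = degree r' a', degree r b = degree r' b' &
      common_nbrs r a b = common_nbrs r' a' b'].

Lemma pair_type_perm beta beta' a b a' b' :
  same_pair_type (g beta) (g beta') a b a' b' ->
  exists tau : {perm V}, [/\ tau a = a', tau b = b',
    forall z, g beta a z = g beta' a' (tau z) &
    forall z, g beta b z = g beta' b' (tau z)].
Proof.
case=> eqE adjE da db cE.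
have := colour_counts a b (g_sym beta) (g_irr beta).
have := colour_counts a' b' (g_sym beta') (g_irr beta').
set r := g beta in adjE da db cE *; set r' := g beta' in adjE da db cE *.
move=> [n1 n2 n3 n4 [n5 n6 n7]] [m1 m2 m3 m4 [m5 m6 m7]].
pose c z := (z == a, z == b, r a z, r b z).
pose c' z := (z == a', z == b', r' a' z, r' b' z).
have [tau tauE] : exists tau : {perm V}, forall z, c' (tau z) = c z.
  apply: perm_of_colours => -[[[[] []] k3] k4].
  - by rewrite m1 n1 eqE.
  - by rewrite m2 n2 eqE adjE.
  - by rewrite m3 n3 eqE adjE.
  move: n4 n5 n6 n7 m4 m5 m6 m7; rewrite -cE -da -db -adjE -eqE.
  rewrite /c /c' {c c'} /= => n4 n5 n6 n7 m4 m5 m6 m7.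
  have cancel u v x y e : (x + u + v)%N = e -> (y + u + v)%N = e -> x = y by lia.
  have e5 := cancel _ _ _ _ _ m5 n5; have e6 := cancel _ _ _ _ _ m6 n6.
  case: k3; case: k4 => //; first by rewrite m4 n4.
  move: m7; rewrite -n7 e5 e6 => /eqP.
  by rewrite !eqn_add2r => /eqP.
have t1 z : (tau z == a') = (z == a) by have [] := tauE z.
have t2 z : (tau z == b') = (z == b) by have [] := tauE z.
exists tau; split; first by apply/eqP; rewrite t1.
- by apply/eqP; rewrite t2.
- by move=> z; have [_ _ ->] := tauE z.
- by move=> z; have [_ _ _ ->] := tauE z.
Qed.

Variables (special : rel V) (Phi : V * V -> V * V).
Hypothesis special_sym : symmetric special.
Hypothesis special_irr : irreflexive special.
Hypothesis PhiK : involutive Phi.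
Hypothesis Phi_special : forall ab, special (Phi ab).1 (Phi ab).2 = special ab.1 ab.2.
Hypothesis Phi_type : forall beta a b, ~~ special a b ->
  same_pair_type (g beta) (g (~~ beta)) a b (Phi (a, b)).1 (Phi (a, b)).2.

Definition relabel_layout (w : bool * {perm V}) : rel V :=
  fun x y => g w.1 (w.2 x) (w.2 y).

(** Three samples may reveal anything. *)
Definition relabel_rev (S : {set V}) (pi : {perm V}) : bool :=
  (2 < #|S|)%N || [exists x in S, exists y in S, special (pi x) (pi y)].

(** At most two vertices of a block are sampled, at places [a] and [b] of the
   unlabelled graph.  Composing the labelling with a permutation that carries
   the neighbourhoods of [a] and [b] to those of [Phi (a, b)] in the graph of the
   other shape keeps the view; it is injective because [Phi] is. *)
Lemma relabel_view_le beta S v :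
  (#|[set pi | ~~ relabel_rev S pi && (block_view (relabel_layout (beta, pi)) S == v)]| <=
   #|[set pi | ~~ relabel_rev S pi && (block_view (relabel_layout (~~ beta, pi)) S == v)]|)%N.
Proof.
have [S3|S2] := ltnP 2 #|S|.
  by rewrite (eq_card0 (A := mem [set _ | _])) // => pi; rewrite inE /relabel_rev S3.
have [[x [y SE]]|S0] : (exists x y, S = [set x; y]) \/ S = finset.set0.
  have [/eqP S0|] := eqVneq #|S| 0%N; first by right; apply/eqP; rewrite -cards_eq0.
  case E : #|S| S2 => [|[|[|//]]] // _ _; left.
    by have /eqP/cards1P[x ->] := E; exists x, x; rewrite finset.setUid.
  by have /eqP/cards2P[x [y [_ ->]]] := E; exists x, y.
pose good a b (tau : {perm V}) := [&& tau a == (Phi (a, b)).1, tau b == (Phi (a, b)).2,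
    [forall z, g beta a z == g (~~ beta) (tau a) (tau z)] &
    [forall z, g beta b z == g (~~ beta) (tau b) (tau z)]].
pose tau a b : {perm V} := odflt 1%g [pick s | good a b s].
have tauP a b : ~~ special a b -> good a b (tau a b).
  move=> ab; rewrite /tau; case: pickP => //= none.
  have [s [s1 s2 s3 s4]] := pair_type_perm (Phi_type beta ab).
  have := none s; rewrite /good s1 s2 !eqxx /=.
  by case/negP; apply/andP; split; apply/forallP => z; rewrite -?s3 -?s4.
have inS z : z \in S -> z = x \/ z = y by rewrite SE !inE => /orP[]/eqP->; auto.
have [xS yS] : x \in S /\ y \in S by rewrite SE !inE !eqxx orbT.
have revE pi : relabel_rev S pi = special (pi x) (pi y).
  rewrite /relabel_rev ltnNge S2 /=; apply/exists_inP/idP => [[z zS /exists_inP[z' z'S]]|sp].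
    case: (inS z zS) => ->; case: (inS z' z'S) => ->; rewrite ?special_irr //.
    by rewrite special_sym.
  by exists x => //; apply/exists_inP; exists y.
pose f (pi : {perm V}) : {perm V} := (pi * tau (pi x) (pi y))%g.
have fE pi z : f pi z = tau (pi x) (pi y) (pi z) by rewrite permM.
have fP pi : ~~ relabel_rev S pi -> [/\ (f pi x, f pi y) = Phi (pi x, pi y),
    forall z, g beta (pi x) (pi z) = g (~~ beta) (f pi x) (f pi z) &
    forall z, g beta (pi y) (pi z) = g (~~ beta) (f pi y) (f pi z)].
  rewrite revE => /tauP/and4P[/eqP t1 /eqP t2 /forallP t3 /forallP t4].
  split; first by rewrite !fE t1 t2 -surjective_pairing.
    by move=> z; rewrite !fE (eqP (t3 (pi z))).
  by move=> z; rewrite !fE (eqP (t4 (pi z))).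
have finj : {in [set pi | ~~ relabel_rev S pi] &, injective f}.
  move=> pi pi'; rewrite !inE => rpi rpi' E.
  have [e1 _ _] := fP pi rpi; have [e2 _ _] := fP pi' rpi'.
  have : Phi (pi x, pi y) = Phi (pi' x, pi' y) by rewrite -e1 -e2 E.
  move/(inv_inj PhiK) => [ex ey]; apply/permP => z.
  have : f pi z = f pi' z by rewrite E.
  by rewrite !fE ex ey => /perm_inj.
rewrite -(card_in_imset (f := f) (D := mem [set pi | ~~ relabel_rev S pi &&
    (block_view (relabel_layout (beta, pi)) S == v)])); last first.
  by move=> pi pi'; rewrite !inE => /andP[r _] /andP[r' _]; apply: finj; rewrite inE.
apply: subset_leq_card; apply/fintype.subsetP => _ /imsetP[pi + ->].
rewrite !inE => /andP[rpi /eqP <-]; have [e1 e2 e3] := fP pi rpi; apply/andP; split.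
  rewrite revE; have := Phi_special (pi x, pi y); rewrite -e1 /= => ->.
  by rewrite -revE.
apply/eqP/setP => -[z z']; rewrite !inE /relabel_layout /=.
have eS u u' : u \in S -> g (~~ beta) (f pi u) (f pi u') = g beta (pi u) (pi u').
  by case/inS => ->; rewrite -?e2 -?e3.
have [zS|zS] := boolP (z \in S); first by rewrite eS.
have [z'S|z'S] := boolP (z' \in S); last by rewrite !andbF.
by rewrite g_sym eS // g_sym.
- rewrite S0; apply: subset_leq_card; apply/fintype.subsetP => pi; rewrite !inE.
  move=> /andP[-> /eqP <-]; apply/eqP/setP => z; by rewrite !inE !andbF.
Qed.

Lemma relabel_indist S v :
  #|[set pi | ~~ relabel_rev S pi && (block_view (relabel_layout (true, pi)) S == v)]| =
  #|[set pi | ~~ relabel_rev S pi && (block_view (relabel_layout (false, pi)) S == v)]|.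
Proof. by apply/eqP; rewrite eqn_leq !relabel_view_le. Qed.

Lemma relabel_card (P : pred V) (pi : {perm V}) : #|[set z | P (pi z)]| = #|[set z | P z]|.
Proof.
rewrite -(card_imset _ (@perm_inj _ pi)); apply: eq_card => z; rewrite inE.
apply/imsetP/idP => [[z' + ->]|Pz]; first by rewrite inE.
by exists (pi^-1 z)%g; rewrite ?inE permKV.
Qed.

Lemma relabel_tcE (w : bool * {perm V}) : (6 * ntriangles (rel_graph (g w.1)) =
  \sum_x \sum_(y | relabel_layout w x y) common_nbrs (relabel_layout w) x y)%N.
Proof.
rewrite (ntriangles_rel_graph (@g_sym _) (@g_irr _)).
rewrite (reindex_inj (@perm_inj _ w.2)) /=; apply: eq_bigr => x _.
rewrite (reindex_inj (@perm_inj _ w.2)) /=; apply: eq_bigr => y _.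
by rewrite /common_nbrs -(relabel_card _ w.2).
Qed.

Variables (K : nat) (sp : bool -> V -> nat) (pg : bool -> V -> V -> bool).
Hypothesis sp_lt : forall beta x, (sp beta x < K)%N.
Hypothesis g_book : forall beta, two_page (g beta) (sp beta) (pg beta).

Definition relabel_spine (w : bool * {perm V}) (x : V) : nat := sp w.1 (w.2 x).

Definition relabel_page (w : bool * {perm V}) (x y : V) : bool :=
  pg w.1 (w.2 x) (w.2 y).

Lemma relabel_book w :
  two_page (relabel_layout w) (relabel_spine w) (relabel_page w).
Proof.
have [inj sym nc] := g_book w.1; split=> [x y /inj/perm_inj//|x y|a b c d rab rcd].
  exact: sym.
exact: nc.
Qed.

Lemma relabel_sym w : symmetric (relabel_layout w).
Proof. by move=> x y; apply: g_sym. Qed.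

Lemma relabel_irr w : irreflexive (relabel_layout w).
Proof. by move=> x; apply: g_irr. Qed.

Lemma relabel_spine_lt w x : (relabel_spine w x < K)%N.
Proof. exact: sp_lt. Qed.

Lemma card_perm_gt0 : (0 < #|{perm V}|)%N.
Proof. by apply/card_gt0P; exists 1%g. Qed.

Definition relabel_gadget : gadget V {perm V} :=
  Gadget (tc := fun beta => ntriangles (rel_graph (g beta))) relabel_sym relabel_irr relabel_spine_lt relabel_book relabel_tcE
    relabel_indist card_perm_gt0.

Lemma relabel_degree w x : #|[set y | layout relabel_gadget w x y]| = degree (g w.1) (w.2 x).
Proof. exact: relabel_card. Qed.

Lemma relabel_reveal_prob (R : realType) (p : R) : 0 < p <= 1 ->
  reveal_prob p relabel_gadget <=
  #|V|%:R ^+ 3 * p ^+ 3 + #|[set ab : V * V | special ab.1 ab.2]|%:R * p ^+ 2.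
Proof.
move=> p01.
have E : reveal_prob p relabel_gadget =
    \sum_(pi : {perm V}) #|{perm V}|%:R^-1 * sample_expect p (fun S => (relabel_rev S pi)%:R).
  rewrite /sample_expect; under [RHS]eq_bigr do rewrite mulr_sumr.
  rewrite exchange_big /=; apply: eq_bigr => S _.
  rewrite -(sumr_indicator _ xpredT) mulr_suml mulr_sumr; apply: eq_bigr => pi _ /=.
  by rewrite mulrA mulrC.
have n0 : #|{perm V}|%:R != 0 :> R.
  by rewrite pnatr_eq0 -lt0n card_perm_gt0.
set b := leRHS; rewrite E; apply: le_trans (_ : \sum_(pi : {perm V}) #|{perm V}|%:R^-1 * b <= _); last first.
  by rewrite sumr_const -[_ *+ _]mulr_natl mulrA mulfV // mul1r.
apply: ler_sum => pi _; apply: ler_wpM2l; first by rewrite invr_ge0.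
pose X3 (S : {set V}) : R := \sum_(A : {set V} | #|A| == 3%N) (A \subset S)%:R.
pose X2 (S : {set V}) : R := \sum_(ab : V * V | special ab.1 ab.2)
   ([set (pi^-1)%g ab.1; (pi^-1)%g ab.2] \subset S)%:R.
apply: le_trans (_ : sample_expect p (fun S => X3 S + X2 S) <= _).
  apply: ler_expect => // S; rewrite /relabel_rev.
  have X20 : 0 <= X2 S by apply: sumr_ge0.
  have X30 : 0 <= X3 S by apply: sumr_ge0.
  have [S3|_] := ltnP 2 #|S|.
    apply: ler_wpDr => //; have [A AS A3] : exists2 A : {set V}, A \subset S & #|A| = 3%N.
      have : (0 < #|[set A : {set V} | (A \subset S) && (#|A| == 3%N)]|)%N.
        by rewrite cards_draws bin_gt0.
      by case/card_gt0P => A; rewrite inE => /andP[? /eqP ?]; exists A.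
    by rewrite /X3 (bigD1 A) ?A3 //= AS lerDl sumr_ge0.
  have [/exists_inP[x xS /exists_inP[y yS xy]]|_] 
    := boolP [exists x in S, exists y in S, special (pi x) (pi y)]; last first.
    by rewrite addr_ge0.
  apply: ler_wpDl => //; rewrite /X2 (bigD1 (pi x, pi y)) //=.
  by rewrite !permK finset.subUset !finset.sub1set xS yS lerDl sumr_ge0.
rewrite expectD /b !expect_sum; apply: lerD.
  rewrite (eq_bigr (fun=> p ^+ 3)) => [|A /eqP A3]; last by rewrite expect_subset A3.
  rewrite sumr_const_card card_draws ler_wpM2r ?exprn_ge0 //; first by case/andP: p01 => /ltW.
  rewrite -natrX ler_nat; apply: leq_trans (_ : #|V| ^_ 3 <= _)%N.
    by rewrite -bin_ffact leq_pmulr.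
  rewrite !ffactnS ffactn0 muln1 !expnS expn0 muln1 !leq_mul //; lia.
rewrite (eq_bigr (fun=> p ^+ 2)) => [|[x y] /= xy]; first by rewrite sumr_const_card.
rewrite expect_subset cards2 (inj_eq perm_inj).
by have -> : x != y by apply: contraTneq xy => ->; rewrite special_irr.
Qed.

End Relabel.

(** * Two triangles against a hexagon *)

Lemma two_neighbours (V : finType) (r : rel V) (n1 n2 q : V) : n1 != n2 ->
  (forall z, r q z = (z == n1) || (z == n2)) ->
  degree r q = 2%N /\ forall p, common_nbrs r p q = (r p n1 + r p n2)%N.
Proof.
move=> n12 qE; split.
  apply: (@etrans _ _ #|[set n1; n2]|); last by rewrite cards2 n12.
  by apply: eq_card => z; rewrite !inE qE.
move=> p; rewrite /common_nbrs -sum1dep_card big_mkcond (bigD1 n1) // (bigD1 n2) /=.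
  rewrite !qE !eqxx orbT !andbT big1 ?addn0 => [|z /andP[z1 z2]].
    by case: (r p n1); case: (r p n2).
  by rewrite qE (negPf z1) (negPf z2) andbF.
by rewrite eq_sym.
Qed.

Definition Z3 : finType := option bool.

Definition next3 (k : Z3) : Z3 :=
  match k with None => Some true | Some true => Some false | Some false => None end.

Definition rank3 (k : Z3) : nat :=
  match k with None => 0 | Some true => 1 | Some false => 2 end.

(** Two triangles if [beta], and otherwise the hexagon that covers a triangle
   twice. *)
Definition hex_rel (beta : bool) : rel (bool * Z3) := fun x y =>
  (x.2 != y.2) && ((x.1 == y.1) == beta).

(** Both triangles, or the hexagon, in cyclic order along the spine; one page is
   enough. *)
Definition hex_spine (beta : bool) (x : bool * Z3) : nat :=
  if beta then (3 * x.1 + rank3 x.2)%N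
  else if odd (rank3 x.2) == x.1 then rank3 x.2 else (rank3 x.2 + 3)%N.

Lemma hex_sym beta : symmetric (hex_rel beta).
Proof. by move=> x y; rewrite /hex_rel eq_sym (eq_sym y.1). Qed.

Lemma hex_irr beta : irreflexive (hex_rel beta).
Proof. by move=> x; rewrite /hex_rel eqxx. Qed.

Lemma hex_book beta : two_page (hex_rel beta) (hex_spine beta) (fun _ _ => true).
Proof.
split=> //.
  by case: beta => -[[] [[]|]] [[] [[]|]].
move=> a b c d rab rcd _ [].
by move: a b c d rab rcd; case: beta => -[[] [[]|]] [[] [[]|]] [[] [[]|]] [[] [[]|]].
Qed.

Lemma hex_neighbours beta q z : hex_rel beta q z =
  (z == (q.1 == beta, next3 q.2)) || (z == (q.1 == beta, next3 (next3 q.2))).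
Proof. by case: q z beta => [[] [[]|]] [[] [[]|]] []. Qed.

Lemma next3_neq (A : eqType) (a : A) k : (a, next3 k) != (a, next3 (next3 k)).
Proof. by rewrite xpair_eqE eqxx; case: k => [[]|]. Qed.

Lemma hex_degree beta q : degree (hex_rel beta) q = 2%N.
Proof. by have [] := two_neighbours (next3_neq _ _) (hex_neighbours beta q). Qed.

Lemma hex_common beta p q : common_nbrs (hex_rel beta) p q =
  (hex_rel beta p (q.1 == beta, next3 q.2) +
   hex_rel beta p (q.1 == beta, next3 (next3 q.2)))%N.
Proof. by have [_ ->] := two_neighbours (next3_neq _ _) (hex_neighbours beta q). Qed.

Lemma ntriangles_hex beta : ntriangles (rel_graph (hex_rel beta)) = (2 * beta)%N.
Proof.
apply/eqP; rewrite -(eqn_pmul2l (isT : 0 < 6)%N).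
rewrite (ntriangles_rel_graph (hex_sym _) (hex_irr _)).
rewrite (eq_bigr (fun=> (2 * beta)%N)) => [|x _].
  by rewrite sum_nat_const card_prod card_option card_bool; case: beta.
rewrite (eq_bigr (fun=> beta : nat)) => [|y].
  by rewrite sum_nat_const -(hex_degree beta x) /degree cardsE.
by rewrite hex_common; case: beta x y => [] [[] [[]|]] [[] [[]|]].
Qed.

Lemma hex_pair_type beta (a b : bool * Z3) : ~~ (a != b) ->
  same_pair_type (hex_rel beta) (hex_rel (~~ beta)) a b a b.
Proof.
rewrite negbK => /eqP <-; split; rewrite ?hex_irr ?hex_degree //.
have E r : common_nbrs r a a = degree r a by apply: eq_card => z; rewrite !inE andbb.
by rewrite !E !hex_degree.
Qed.

Lemma hex_spine_lt beta x : (hex_spine beta x < 6)%N.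
Proof. by case: beta x => [] [[] [[]|]]. Qed.

Definition neq_rel (V : eqType) : rel V := fun x y => x != y.

Lemma neq_rel_sym (V : eqType) : symmetric (@neq_rel V).
Proof. by move=> x y; rewrite /neq_rel eq_sym. Qed.

Lemma neq_rel_irr (V : eqType) : irreflexive (@neq_rel V).
Proof. by move=> x; rewrite /neq_rel eqxx. Qed.

Lemma id_involutive (T : Type) : involutive (@id T). Proof. by []. Qed.

(** Two triangles against a hexagon: one sampled vertex shows a path in either
   case, so two samples in a block are needed. *)
Definition hex_gadget : gadget (bool * Z3)%type {perm (bool * Z3)} :=
  relabel_gadget hex_sym hex_irr (@neq_rel_sym _) (@neq_rel_irr _)
    (@id_involutive (bool * Z3 * (bool * Z3))) (fun ab => erefl) hex_pair_type
    hex_spine_lt hex_book.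

(** Blocks with [126 * e] triangles at most, [e] of them in doubt, which are
   revealed with probability of order [p^2]. *)
Lemma minimax_risk_ge_pair (R : realType) (V Omega : finType)
    (B : gadget V Omega) (p L : R) (d t e : nat) :
  0 < p <= 1 -> (forall w x, (#|[set y | layout B w x y]| <= d)%N) ->
  (0 < e)%N -> (126 * e <= t)%N ->
  (maxn (tc B true) (tc B false) <= 126 * e)%N -> (tc B false + e <= tc B true)%N ->
  reveal_prob p B <= L * p ^+ 2 -> 1 <= L -> L * p ^+ 2 <= 1 / 2 ->
  (((32 * expR 1 * 252 ^+ 2 * L)^-1 *
     Num.min (e%:R * t%:R / p ^+ 2) (t%:R ^+ 2))%:E <= minimax_risk p d t)%E.
Proof.
move=> p01 hd e0 et htc gap hr L1 hL; have /andP[p0 _] := p01.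
pose m := (t %/ (126 * e))%N.
have kap : 0 <= (1 / 2 : R) <= 1 - reveal_prob p B by apply/andP; split; lra.
have ht : (m * maxn (tc B true) (tc B false) <= t)%N.
  by apply: leq_trans (leq_divM t (126 * e)); rewrite leq_mul2l htc orbT.
apply: le_trans _ (gadget_lower_bound p01 hd ht hr kap); rewrite lee_fin.
have tm : (t <= 252 * (e * m))%N.
  have /half_blocks : (0 < 126 * e <= t)%N by rewrite muln_gt0 e0.
  by rewrite -/m; move: (m) => n; clear; lia.
have e1 : 0 < expR 1 :> R by rewrite expR_gt0.
have gapR : e%:R <= (tc B true)%:R - (tc B false)%:R :> R.
  by rewrite lerBrDl -natrD ler_nat.
have TM : t%:R <= 252 * (e%:R * m%:R) :> R by rewrite -!natrM ler_nat.
have E0 : 0 <= e%:R :> R by rewrite ler0n.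
have M0 : 0 <= m%:R :> R by rewrite ler0n.
have T0 : 0 <= t%:R :> R by rewrite ler0n.
move: (_ - _) gapR => g gapR; move: (e%:R) (m%:R) (t%:R) E0 M0 T0 gapR TM.
have : 1 <= 252 :> R by rewrite ler1n.
move: (252 : R) => q q1; clear -p0 L1 e1 q1 => E M T E0 M0 T0 gapR TM.
have P0 : 0 < p ^+ 2 by rewrite exprn_gt0.
have L0 : 0 < L by lra.
have rho0 : 0 < L * p ^+ 2 by rewrite mulr_gt0.
have rate : (q ^+ 2 * L)^-1 * Num.min (E * T / p ^+ 2) (T ^+ 2) <=
    E ^+ 2 * M ^+ 2 / Num.max 1 (L * p ^+ 2 * M).
  apply: le_trans (block_rate E0 rho0 M0 (lexx _)).
  have q0 : 0 < q by lra.
  have C0 : 0 < q ^+ 2 * L by rewrite mulr_gt0 // exprn_gt0.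
  rewrite [leLHS]mulrC ler_pdivrMr // minr_pMl ?(ltW C0) // le_min !ge_min; apply/andP; split; apply/orP.
  - left; have -> : E * (E * M) / (L * p ^+ 2) * (q ^+ 2 * L) =
      q * (E * (q * (E * M))) / p ^+ 2 by field; rewrite !gt_eqF.
    rewrite ler_pM2r ?invr_gt0 //; apply: le_trans (_ : E * (q * (E * M)) <= _).
      exact: ler_wpM2l.
    by rewrite ler_peMl ?mulr_ge0 //; lra.
  - right; apply: le_trans (_ : (q * (E * M)) ^+ 2 <= _).
      by rewrite lerXn2r ?nnegrE ?mulr_ge0 // ltW.
    have -> : (E * M) ^+ 2 * (q ^+ 2 * L) = (q * (E * M)) ^+ 2 * L by ring.
    by rewrite ler_peMr ?sqr_ge0.
apply: le_trans (_ : (32 * expR 1)^-1 * (E ^+ 2 * M ^+ 2 / Num.max 1 (L * p ^+ 2 * M)) <= _).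
  have -> : (32 * expR 1 * q ^+ 2 * L)^-1 = (32 * expR 1)^-1 * (q ^+ 2 * L)^-1.
    by rewrite !invfM; ring.
  by rewrite -mulrA ler_wpM2l // invr_ge0 mulr_ge0 ?ltW.
have X0 : 0 < Num.max 1 (L * p ^+ 2 * M) by rewrite lt_max ltr01.
move: (Num.max _ _) X0 => X X0.
have -> : (1 / 2) ^+ 2 * g ^+ 2 * M ^+ 2 / (8 * expR 1 * X) =
   (32 * expR 1)^-1 * (g ^+ 2 * M ^+ 2 / X) by field; rewrite !gt_eqF.
rewrite ler_wpM2l ?invr_ge0 ?mulr_ge0 ?(ltW e1) // ler_wpM2r ?invr_ge0 ?(ltW X0) //.
by rewrite ler_wpM2r ?sqr_ge0 // lerXn2r ?nnegrE //; lra.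
Qed.

(** One sampled vertex of a hexagon or of two triangles only shows two of its
   neighbours, so with [m] blocks about [m * p^2] of them are recognized. *)
Lemma minimax_risk_ge_hexagon (R : realType) (p : R) (d t : nat) :
  0 < p -> p <= 1 / 600 -> (1 < d)%N -> (252 <= t)%N ->
  (((32 * expR 1 * 252 ^+ 2 * 252)^-1 *
     Num.min (2 * t%:R / p ^+ 2) (t%:R ^+ 2))%:E <= minimax_risk p d t)%E.
Proof.
move=> p0 p1 d1 t1; have p01 : 0 < p <= 1 by rewrite p0; lra.
apply: (minimax_risk_ge_pair (B := hex_gadget)) => //.
- by move=> w x; rewrite relabel_degree hex_degree.
- by rewrite /= !ntriangles_hex.
- by rewrite /= !ntriangles_hex.
- apply: le_trans (relabel_reveal_prob _ _ _ _ _ _ _ _ _ p01) _.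
  have n6 : #|((bool * Z3)%type : finType)| = 6%N by rewrite card_prod card_option !card_bool.
  rewrite n6; apply: le_trans (_ : 216 * p ^+ 3 + 36 * p ^+ 2 <= _).
    apply: lerD; first by rewrite -natrX ler_wpM2r ?exprn_ge0 ?(ltW p0).
    rewrite ler_wpM2r ?exprn_ge0 ?(ltW p0) // ler_nat; apply: leq_trans (max_card _) _.
    by rewrite card_prod n6.
  by move: p0 p1; clear=> p0 p1; rewrite exprS; have := sqr_ge0 p; nra.
- by rewrite ler1n.
- nra.
Qed.

(** * Books, windmills and triangles *)

(** The ambiguity of the triangle count of a relabelled pair of graphs is
   carried by the special pairs of vertices. *)
Lemma ntriangles_special (V : finType) (g : bool -> rel V) (special : rel V)
    (Phi : V * V -> V * V) :
  (forall beta, symmetric (g beta)) -> (forall beta, irreflexive (g beta)) ->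
  involutive Phi ->
  (forall ab, special (Phi ab).1 (Phi ab).2 = special ab.1 ab.2) ->
  (forall beta a b, ~~ special a b ->
     same_pair_type (g beta) (g (~~ beta)) a b (Phi (a, b)).1 (Phi (a, b)).2) ->
  let sum beta := (\sum_(ab | special ab.1 ab.2)
     g beta ab.1 ab.2 * common_nbrs (g beta) ab.1 ab.2)%N in
  (6 * ntriangles (rel_graph (g true)) + sum false =
   6 * ntriangles (rel_graph (g false)) + sum true)%N.
Proof.
move=> gs gi PhiK Phis Phit /=.
have E beta : (6 * ntriangles (rel_graph (g beta)) =
    \sum_(ab | special ab.1 ab.2) g beta ab.1 ab.2 * common_nbrs (g beta) ab.1 ab.2 +
    \sum_(ab | ~~ special ab.1 ab.2) g beta ab.1 ab.2 * common_nbrs (g beta) ab.1 ab.2)%N.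
  rewrite (ntriangles_rel_graph (gs _) (gi _)).
  rewrite -(bigID (fun ab => special ab.1 ab.2) xpredT (fun ab => g beta ab.1 ab.2 * common_nbrs (g beta) ab.1 ab.2)%N).
  rewrite (eq_bigr (fun x => \sum_y g beta x y * common_nbrs (g beta) x y)%N).
    by rewrite pair_bigA.
  move=> x _; rewrite big_mkcond; apply: eq_bigr => y _.
  by case: (g beta x y); rewrite ?mul1n ?mul0n.
rewrite !E addnAC [RHS]addnAC [X in (X + _ = _)%N]addnC; congr (_ + _)%N.
rewrite [LHS](reindex_inj (inv_inj PhiK)) /=; apply: eq_big => [ab|ab].
  by rewrite Phis.
rewrite Phis; case: ab => a b /= /(Phit false)[_ adj _ _ com].
by rewrite -adj -com.
Qed.

Section FanGadget.

Variable l : nat.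

(** The name [(h, j, k)] stands for the edge [k] of the triangle [j] of kind [h].
   A triangle has two copies of each vertex, so that its edges are lifted either
   to two triangles or to a hexagon.  To each name belong also a page of the
   books and a pair of blades of the windmills, again with two copies. *)
Definition edge_name : finType := (bool * 'I_l * Z3)%type.

Definition next_name (e : edge_name) : edge_name := (e.1, next3 e.2).

(** Book hubs [(false, i, a)], where the books [a] have the hubs [i = false] and
   [i = true], and windmill hubs [(true, h, a)]. *)
Definition hub : finType := (bool * bool * bool)%type.

(** The pair of booleans encodes pages [(false, false)], triangle vertices
   [(false, true)] and the blades [(true, s)]. *)
Definition low : finType := ((bool * bool) * edge_name * bool)%type.

Definition fan_vertex : finType := (hub + low)%type.

Notation Book i a := (inl (false, i, a) : fan_vertex).
Notation Wind h a := (inl (true, h, a) : fan_vertex).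
Notation Page e a := (inr ((false, false), e, a) : fan_vertex).
Notation Tri e a := (inr ((false, true), e, a) : fan_vertex).
Notation Blade s e a := (inr ((true, s), e, a) : fan_vertex).

Definition hub_low (x : hub) (y : low) : bool :=
  match x, y with
  | (false, i, a), ((false, false), e, b) => a == b
  | (true, h, a), ((true, s), e, b) => (h == e.1.1) && (a == b)
  | _, _ => false
  end.

(** In the shape [beta = true] the spines join the two hubs of the same book, which
   closes its triangles; the blades of a name are joined across copies, which
   leaves the windmills open; and the triangles are lifted to triangles.  In the
   other shape the spines join hubs of different books, the blades of a name
   close triangles with their hub, and the lifts are hexagons.  The three changes
   balance: every kind of pair, other than two hubs, that becomes rarer in one
   place becomes as much more frequent in another. *)
Definition fan_rel (beta : bool) : rel fan_vertex := fun x y =>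
  match x, y with
  | inl (k, i, a), inl (k', i', a') =>
      [&& k == k', i != i' & (a == a') == (k || beta)]
  | inl u, inr v => hub_low u v
  | inr v, inl u => hub_low u v
  | inr ((c, s), e, a), inr ((c', s'), e', a') =>
      if c then [&& c', s != s', e == e' & (a == a') == ~~ beta]
      else [&& s, s', ~~ c', e.1 == e'.1, e.2 != e'.2 & (a == a') == beta]
  end.

Definition low_nbr1 (beta : bool) (v : low) : fan_vertex :=
  match v with
  | ((false, false), e, a) => Book false a
  | ((false, true), e, a) => Tri (next_name e) (a == beta)
  | ((true, s), e, a) => Wind e.1.1 a
  end.

Definition low_nbr2 (beta : bool) (v : low) : fan_vertex :=
  match v with
  | ((false, false), e, a) => Book true a
  | ((false, true), e, a) => Tri (next_name (next_name e)) (a == beta)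
  | ((true, s), e, a) => Blade (~~ s) e (a == ~~ beta)
  end.

Lemma fan_sym beta : symmetric (fan_rel beta).
Proof.
move=> [[[k i] a]|[[[c s] e] a]] [[[k' i'] a']|[[[c' s'] e'] a']] //=.
  by rewrite (eq_sym k') (eq_sym i') (eq_sym a'); case: eqVneq => // ->.
rewrite (eq_sym e') (eq_sym a') (eq_sym s') (eq_sym e'.1) (eq_sym e'.2).
by case: c; case: c'; case: s; case: s'; rewrite ?andbF.
Qed.

Lemma fan_irr beta : irreflexive (fan_rel beta).
Proof.
move=> [[[k i] a]|[[[c s] e] a]] /=; rewrite !eqxx ?andbF //.
by case: c; rewrite ?andbF.
Qed.

Lemma low_neighbours beta (v : low) z : fan_rel beta (inr v) z =
  (z == low_nbr1 beta v) || (z == low_nbr2 beta v).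
Proof.
case: v z => [[[c s] [[h j] k]] a] [[[k' i'] a']|[[[c' s'] [[h' j'] k']] a']].
  by case: c; case: s; case: k'; case: i'; case: a; case: a'; case: h.
have ne : (k' == next3 k) || (k' == next3 (next3 k)) = (k != k').
  by case: k k' => [[]|] [[]|].
have Z (u v : low) : (inr u == inr v :> fan_vertex) = (u == v) by [].
case: c; case: s; rewrite /= ?Z ?xpair_eqE /=; try by case: c'.
- by rewrite (eq_sym h') (eq_sym j') (eq_sym k'); case: c' s' a a' beta => [] [] [] [] [];
    rewrite ?andbT ?andbF.
- by rewrite (eq_sym h') (eq_sym j') (eq_sym k'); case: c' s' a a' beta => [] [] [] [] [];
    rewrite ?andbT ?andbF.
rewrite (eq_sym h') (eq_sym j') -ne.
case: (h == h'); case: (j == j') => //=; rewrite ?andbF //.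
by case: c' s' a a' beta => [] [] [] [] [] //=; rewrite ?andbT ?andbF.
Qed.

Lemma low_nbr_neq beta v : low_nbr1 beta v != low_nbr2 beta v.
Proof. by case: v => [[[[] []] [[h j] [[]|]]] a]; rewrite /= /eq_op //= ?xpair_eqE /= ?andbF. Qed.

Lemma low_degree beta v : degree (fan_rel beta) (inr v) = 2%N.
Proof. by have [] := two_neighbours (low_nbr_neq beta v) (low_neighbours beta v). Qed.

Lemma low_common beta x v : common_nbrs (fan_rel beta) x (inr v) =
  (fan_rel beta x (low_nbr1 beta v) + fan_rel beta x (low_nbr2 beta v))%N.
Proof. by have [_ ->] := two_neighbours (low_nbr_neq beta v) (low_neighbours beta v). Qed.

Lemma card_low_nbrs (x : hub) : #|[set v | hub_low x v]| = (6 * l)%N.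
Proof.
have fan_card : #|((bool * 'I_l * Z3)%type : finType)| = (6 * l)%N.
  by rewrite !card_prod card_option card_bool card_ord mulnAC.
rewrite -fan_card; case: x => [[[] i] a].
  rewrite -(card_imset predT (f := fun u => ((true, u.1.1), (i, u.1.2, u.2), a) : low)).
    apply: eq_card => -[[[c s] [[h j] k]] b]; rewrite inE; apply/idP/imsetP.
      by case: c s => [] [] //= /andP[/eqP-> /eqP->];
        [exists (true, j, k)|exists (false, j, k)].
    by case=> -[[s' j'] k'] _ [-> -> -> -> -> ->] /=; rewrite !eqxx.
  by move=> [[s1 j1] k1] [[s2 j2] k2] [-> -> ->].
rewrite -(card_imset predT (f := fun e => ((false, false), e, a) : low)).
  apply: eq_card => -[[[c s] e] b]; rewrite inE; apply/idP/imsetP.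
    by case: c s => [] [] //= /eqP->; exists e.
  by case=> e' _ [-> -> _ ->] /=; rewrite eqxx.
by move=> e1 e2 [].
Qed.

Lemma hub_degree beta (x : hub) : degree (fan_rel beta) (inl x) = (6 * l).+1.
Proof.
case: x => [[k i] a]; rewrite /degree card_sum_type -[RHS]add1n.
congr (_ + _)%N; last exact: (card_low_nbrs (k, i, a)).
apply: (@etrans _ _ #|[set ((k, ~~ i, a == (k || beta)) : hub)]|); last exact: cards1.
by apply: eq_card => -[[k' i'] a']; rewrite !inE !xpair_eqE /=; case: k i a k' i' a' beta =>
  [] [] [] [] [] [] [].
Qed.

Definition special_hubs : rel fan_vertex := fun x y =>
  if (x, y) is (inl u, inl v) then u != v else false.

Lemma special_hubs_sym : symmetric special_hubs.
Proof. by move=> [u|u] [v|v] //; rewrite /special_hubs eq_sym. Qed.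

Lemma special_hubs_irr : irreflexive special_hubs.
Proof. by move=> [u|u] //; rewrite /special_hubs eqxx. Qed.

(** The side of a book triangle between a page and its hub corresponds to the
   side of a windmill triangle between a blade and the hub, and the third side
   of the windmill triangle to a side of a loose triangle. *)
Definition fan_swap (xy : fan_vertex * fan_vertex) : fan_vertex * fan_vertex :=
  match xy with
  | (inl u, inr v) =>
    match u, v with
    | (false, i, a), ((false, false), e, b) => (Wind e.1.1 a, Blade i e b)
    | (true, h, a), ((true, s), e, b) =>
        if h == e.1.1 then (Book s a, Page e b) else xy
    | _, _ => xy
    end
  | (inr v, inl u) =>
    match u, v with
    | (false, i, a), ((false, false), e, b) => (Blade i e b, Wind e.1.1 a)
    | (true, h, a), ((true, s), e, b) =>
        if h == e.1.1 then (Page e b, Book s a) else xy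
    | _, _ => xy
    end
  | (inr ((true, s), e, a), inr ((true, s'), e', b)) =>
      if (s != s') && (e == e') then
        if s then (Tri e a, Tri (next_name e) b) else (Tri (next_name e) a, Tri e b)
      else xy
  | (inr ((false, true), e, a), inr ((false, true), e', b)) =>
      if e' == next_name e then (Blade true e a, Blade false e b)
      else if e == next_name e' then (Blade false e' a, Blade true e' b)
      else xy
  | _ => xy
  end.

Lemma next_name2_irr e : (e == next_name (next_name e)) = false.
Proof. by case: e => [[h j] [[]|]]; rewrite !xpair_eqE /= ?andbF. Qed.

Lemma fan_swapK : involutive fan_swap.
Proof.
case=> [[[[k i] a]|[[[c s] e] a]] [[[k' i'] a']|[[[c' s'] e'] a']]] //=.
- case: k; case: c'; case: s' => //=; rewrite ?eqxx //.
    by case: eqP => [->//|/eqP/negPf/=->].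
  by case: eqP => [->//|/eqP/negPf/=->].
- case: k'; case: c; case: s => //=; rewrite ?eqxx //.
    by case: eqP => [->//|/eqP/negPf/=->].
  by case: eqP => [->//|/eqP/negPf/=->].
case: c; case: c'; case: s; case: s' => //=.
- by case: eqP => [<-|/eqP/negPf ne] /=; rewrite ?eqxx ?ne.
- case: eqP => [<-|/eqP/negPf ne] /=; rewrite ?ne //.
  by rewrite next_name2_irr eqxx.
case: eqP => [->|/eqP/negPf ne] /=; rewrite ?eqxx //.
by case: eqP => [->|/eqP/negPf ne'] /=; rewrite ?eqxx ?ne ?ne'.
Qed.

Lemma fan_swap_special xy :
  special_hubs (fan_swap xy).1 (fan_swap xy).2 = special_hubs xy.1 xy.2.
Proof.
case: xy => [[[[k i] a]|[[[c s] e] a]] [[[k' i'] a']|[[[c' s'] e'] a']]] //=.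
- by case: k; case: c'; case: s' => //=; case: ifP.
- by case: k'; case: c; case: s => //=; case: ifP.
by case: c; case: c'; case: s; case: s' => //=; repeat case: ifP.
Qed.

Lemma fan_type_hub_low beta (u : hub) (v : low) :
  same_pair_type (fan_rel beta) (fan_rel (~~ beta)) (inl u) (inr v)
    (fan_swap (inl u, inr v)).1 (fan_swap (inl u, inr v)).2.
Proof.
case: u v => [[k i] a] [[[c s] [[h j] t]] b].
case: k; case: c; case: s => /=; try (case: eqP => [->|/eqP ih] /=).
all: split; rewrite ?hub_degree ?low_degree ?low_common //= ?eqxx ?(negPf ih) //=.
all: try by case: i a b beta h => [] [] [] [] [].
Qed.

Lemma fan_type_tri beta e e' a b :
  same_pair_type (fan_rel beta) (fan_rel (~~ beta)) (Tri e a) (Tri e' b)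
    (fan_swap (Tri e a, Tri e' b)).1 (fan_swap (Tri e a, Tri e' b)).2.
Proof.
have Z (u v : low) : (inr u == inr v :> fan_vertex) = (u == v) by [].
case: e e' => [hj k] [hj' k']; rewrite /fan_swap /next_name !xpair_eqE (eq_sym hj') /=.
have [<-|ne] /= := eqVneq hj hj'; last first.
  by split; rewrite ?low_degree ?low_common ?Z ?xpair_eqE //= ?(negPf ne).
case: k k' => [[]|] [[]|] /=.
all: split; rewrite ?low_degree ?low_common ?Z ?xpair_eqE //= ?eqxx ?andbF ?andbT //=.
all: by case: a b beta => [] [] [].
Qed.

Lemma fan_type_low_low beta (u v : low) :
  same_pair_type (fan_rel beta) (fan_rel (~~ beta)) (inr u) (inr v)
    (fan_swap (inr u, inr v)).1 (fan_swap (inr u, inr v)).2.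
Proof.
case: u v => [[[c s] e] a] [[[c' s'] e'] b].
have Z (u v : low) : (inr u == inr v :> fan_vertex) = (u == v) by [].
case: c; case: s; case: c'; case: s'; try exact: fan_type_tri.
all: rewrite /fan_swap /=; try (case: (eqVneq e e') => [<-|ne] /=).
all: split; rewrite ?low_degree ?low_common ?Z ?xpair_eqE //= ?eqxx ?andbF ?andbT //=.
all: rewrite ?(negPf ne) ?andbF //=.
all: try by case: a b beta => [] [] [].
all: by case: e a b beta => [hj [[]|]] [] [] []; rewrite /= ?xpair_eqE /= ?andbF.
Qed.

(** Pairs of hubs are excluded: in one shape adjacent book hubs have [6 * l] common
   neighbours, and in the other none. *)
Lemma fan_type beta x y : ~~ special_hubs x y ->
  same_pair_type (fan_rel beta) (fan_rel (~~ beta)) x y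
    (fan_swap (x, y)).1 (fan_swap (x, y)).2.
Proof.
case: x y => [u|u] [v|v]; last by move=> _; apply: fan_type_low_low.
- rewrite negbK => /eqP <- /=.
  have E (r : rel fan_vertex) x : common_nbrs r x x = degree r x by apply: eq_card => z; rewrite !inE andbb.
  by split; rewrite ?E ?hub_degree ?fan_irr.
- by move=> _; apply: fan_type_hub_low.
move=> _; have [e1 e2 e3 e4 e5] := fan_type_hub_low beta v u.
have -> : fan_swap (inr u, inl v) =
    ((fan_swap (inl v, inr u)).2, (fan_swap (inl v, inr u)).1).
  by case: v u {e1 e2 e3 e4 e5} => [[[] i] a] [[[[] []] e] b] //=; case: ifP.
by split; rewrite 1?fan_sym /= 1?eq_sym 1?common_nbrsC ?e1 ?e2 ?e3 ?e4 ?e5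
  1?fan_sym 1?eq_sym 1?common_nbrsC.
Qed.

Let N := #|edge_name|.

Let rk (e : edge_name) : nat := enum_rank e.

Lemma rk_lt e : (rk e < N)%N. Proof. exact: ltn_ord. Qed.

(** The two books follow each other.  The windmill hubs with [a = false] are
   outermost and those with [a = true] innermost, around the blades of the first
   and of the second pair of windmills; adjacent blades are consecutive. *)
Definition fan_inner (beta : bool) (x : fan_vertex) : nat :=
  match x with
  | inl (false, i, a) => (a * (N + 2) + i * (N + 1))%N
  | inl (true, false, a) => (a * (4 * N + 1))%N
  | inl (true, true, a) => if a then (4 * N + 2)%N else (8 * N + 3)%N
  | inr ((false, false), e, a) => (a * (N + 2) + rk e + 1)%N
  | inr ((true, s), e, a) =>
      ((if e.1.1 then 4 * N + 3 else 1) + 4 * rk e +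
       (if beta then 2 * (s (+) a) + a else 2 * a + s))%N
  | inr ((false, true), e, a) => hex_spine beta (a, e.2)
  end.

Definition fan_comp (x : fan_vertex) : nat :=
  match x with
  | inl (k, _, _) => k
  | inr ((true, _), _, _) => 1
  | inr ((false, false), _, _) => 0
  | inr ((false, true), e, _) => (2 + enum_rank e.1)%N
  end.

Definition fan_page (x y : fan_vertex) : bool :=
  match x, y with
  | inl (k, i, a), inr _ | inr _, inl (k, i, a) => if k then a else i
  | _, _ => false
  end.

Lemma fan_inner_lt beta x : (fan_inner beta x < 8 * N + 6)%N.
Proof.
case: x => [[[[] []] []]|[[[[] s] e] a]] /=; try lia.
  have := rk_lt e; case: e.1.1; case: beta; case: s; case: a => /=; lia.
case: s; last by have := rk_lt e; case: a => /=; lia.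
by apply: leq_trans (hex_spine_lt _ _) _; lia.
Qed.

Lemma fan_comp_edge beta x y : fan_rel beta x y -> fan_comp x = fan_comp y.
Proof.
case: x y => [[[k i] a]|[[[c s] e] a]] [[[k' i'] a']|[[[c' s'] e'] a']] /=.
- by case/and3P => /eqP->.
- by case: k; case: c'; case: s'.
- by case: k'; case: c; case: s.
by case: c s c' s' => [] [] [] [] //= /andP[/eqP->].
Qed.

Lemma fan_page_sym x y : fan_page x y = fan_page y x.
Proof. by case: x y => [u|u] [v|v] //; case: u v => [[k i] a] [[k' i'] a']. Qed.

Lemma fan_inner_inj beta x y : fan_comp x = fan_comp y ->
  fan_inner beta x = fan_inner beta y -> x = y.
Proof.
have rk_inj e e' : rk e = rk e' -> e = e' by move/ord_inj/enum_rank_inj.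
have rank_inj (u v : bool * 'I_l) : (2 + enum_rank u = 2 + enum_rank v)%N -> u = v.
  by move=> /addnI/ord_inj/enum_rank_inj.
case: x y => [[[k i] a]|[[[c s] e] a]] [[[k' i'] a']|[[[c' s'] e'] a']].
- case: k k' => [] [] //= _; case: i a i' a' => [] [] [] [] //=; lia.
- case: k c' s' => [] [] [] //= _; have := rk_lt e'; case: i a a' => [] [] [] //=;
    case: e'.1.1; case: beta => /=; lia.
- case: c s k' => [] [] [] //= _; have := rk_lt e; case: i' a a' => [] [] [] //=;
    case: e.1.1; case: beta => /=; lia.
have := rk_lt e; have := rk_lt e'.
case: c s c' s' => [] [] [] [] //= r' r E H.
- have [/rk_inj -> ->] : rk e = rk e' /\ a = a' by move: r r' H;
    case: beta; case: a a' => [] [] /=; case: e.1.1; case: e'.1.1; lia.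
  by [].
- by exfalso; move: r r' H; case: beta; case: a a' => [] [] /=; case: e.1.1; case: e'.1.1; lia.
- by exfalso; move: r r' H; case: beta; case: a a' => [] [] /=; case: e.1.1; case: e'.1.1; lia.
- have [/rk_inj -> ->] : rk e = rk e' /\ a = a' by move: r r' H;
    case: beta; case: a a' => [] [] /=; case: e.1.1; case: e'.1.1; lia.
  by [].
- have {}E := rank_inj _ _ E; have [inj _ _] := hex_book beta.
  by have [-> E2] := inj (a, e.2) (a', e'.2) H; rewrite (surjective_pairing e) E E2 -surjective_pairing.
- have [/rk_inj -> ->] : rk e = rk e' /\ a = a' by move: r r' H; case: a a' => [] [] /=; lia.
  by [].
Qed.

(** Where the edges of the books ([k = false]) and of the windmills begin and end
   along the spine, on either page. *)
Definition fan_edge_shape (k page : bool) (lo hi : nat) : Prop :=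
  match k, page with
  | true, true => hi = (4 * N + 1)%N \/ lo = (4 * N + 2)%N
  | true, false => (hi <= 8 * N + 3)%N /\
      (lo = 0 /\ (hi <= 4 * N)%N \/
       hi = (8 * N + 3)%N /\ (lo = 0 \/ (4 * N + 3 <= lo)%N) \/ hi = lo.+1)
  | false, true => hi = (N + 1)%N \/ hi = (2 * N + 3)%N /\ (N + 2 <= lo)%N
  | false, false => (hi <= 2 * N + 3)%N /\
      (lo = 0 /\ ((hi <= N + 1)%N \/ hi = (2 * N + 3)%N) \/ lo = (N + 2)%N \/ hi = lo.+1)
  end.

(** In this form two edges on the same page visibly do not interleave. *)
Lemma fan_edge_shapeP beta (k : bool) a b : fan_rel beta a b -> fan_comp a = k ->
  (fan_inner beta a < fan_inner beta b)%N ->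
  fan_edge_shape k (fan_page a b) (fan_inner beta a) (fan_inner beta b).
Proof.
rewrite /fan_edge_shape; case: a b => [[[u i] a]|[[[u s] e] a]] [[[v i'] b]|[[[v s'] e'] b]].
- case: u v k => [] [] [] // + _; case: i a i' b => [] [] [] [] //=; case: beta => //= _; lia.
- have := rk_lt e'; case: u v s' k => [] [] [] [] // re + _ //=; first 2 last.
  + by move/eqP<-; case: i a => [] []; lia.
  + by move=> /andP[/eqP <- /eqP <-]; case: i a beta => [] [] [] /=; lia.
  + by move=> /andP[/eqP <- /eqP <-]; case: i a beta => [] [] [] /=; lia.
- have := rk_lt e; case: v u s k => [] [] [] [] // re + _ //=; first 2 last.
  + by move/eqP<-; case: i' b => [] []; lia.
  + by move=> /andP[/eqP <- /eqP <-]; case: i' b beta => [] [] [] /=; lia.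
  + by move=> /andP[/eqP <- /eqP <-]; case: i' b beta => [] [] [] /=; lia.
have := rk_lt e; case: u s v s' k => [] [] [] [] [] re //=.
- by move=> /andP[/eqP <- ab] _; move: ab; case: a b beta => [] [] [] //= _; case: e.1.1; lia.
by move=> /andP[/eqP <- ab] _; move: ab; case: a b beta => [] [] [] //= _; case: e.1.1; lia.
Qed.

Lemma fan_nocross beta a b c d : fan_comp a = fan_comp c ->
  fan_rel beta a b -> fan_rel beta c d -> fan_page a b = fan_page c d ->
  ~ [/\ (fan_inner beta a < fan_inner beta c)%N,
        (fan_inner beta c < fan_inner beta b)%N &
        (fan_inner beta b < fan_inner beta d)%N].
Proof.
move=> ac rab rcd pg [lt1 lt2 lt3].
have [tri|] := leqP 2 (fan_comp a).
  have triP x : (2 <= fan_comp x)%N -> exists e u, x = Tri e u.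
    by case: x => [[[[] i] u]|[[[[] []] e] u]] //= _; exists e, u.
  have := fan_comp_edge rab; have := fan_comp_edge rcd; rewrite -ac => ad ab.
  have [ea [ua Ea]] := triP a tri; have [eb [ub Eb]] : exists e u, b = Tri e u.
    by apply: triP; rewrite -ab.
  have [ec [uc Ec]] : exists e u, c = Tri e u by apply: triP; rewrite -ac.
  have [ed [ud Ed]] : exists e u, d = Tri e u by apply: triP; rewrite -ad.
  subst a b c d; move: rab rcd lt1 lt2 lt3 => /= /andP[_ rab] /andP[_ rcd] lt1 lt2 lt3.
  have [_ _ nc] := hex_book beta.
  by apply: (nc (ua, ea.2) (ub, eb.2) (uc, ec.2) (ud, ed.2)).
move=> comp2; have [k ka] : exists k : bool, fan_comp a = k.
  by case: (fan_comp a) comp2 => [|[|]] // _; [exists false|exists true].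
have := fan_edge_shapeP rab ka (ltn_trans lt1 lt2).
have := fan_edge_shapeP rcd (etrans (esym ac) ka) (ltn_trans lt2 lt3).
move: lt1 lt2 lt3; rewrite -pg /fan_edge_shape.
move: (fan_inner _ _) (fan_inner _ _) (fan_inner _ _) (fan_inner _ _) (fan_page _ _).
by clear => p1 p2 p3 p4 pg; case: k; case: pg; lia.
Qed.

Definition fan_spine_bound : nat := ((2 + #|((bool * 'I_l)%type : finType)|) * (8 * N + 6))%N.

Definition fan_spine (beta : bool) (x : fan_vertex) : nat :=
  (fan_comp x * (8 * N + 6) + fan_inner beta x)%N.

Lemma fan_spine_lt beta x : (fan_spine beta x < fan_spine_bound)%N.
Proof.
have c : (fan_comp x < 2 + #|((bool * 'I_l)%type : finType)|)%N.
  case: x => [[[[] i] a]|[[[[] []] e] a]] //=; by rewrite ltn_add2l ltn_ord.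
apply: leq_trans (leq_mul c (leqnn _)).
by rewrite /fan_spine mulSn addnC ltn_add2r fan_inner_lt.
Qed.

Lemma fan_book beta : two_page (fan_rel beta) (fan_spine beta) fan_page.
Proof.
apply: two_page_stack; [exact: fan_inner_lt|exact: fan_comp_edge|exact: fan_inner_inj
  |exact: fan_page_sym|exact: fan_nocross].
Qed.

Definition fan_gadget : gadget fan_vertex {perm fan_vertex} :=
  relabel_gadget fan_sym fan_irr special_hubs_sym special_hubs_irr fan_swapK
    fan_swap_special fan_type fan_spine_lt fan_book.

Lemma card_hub : #|hub| = 8%N.
Proof. by rewrite !card_prod card_bool. Qed.

Lemma card_low : #|low| = (48 * l)%N.
Proof. by rewrite !card_prod card_option card_bool card_ord; lia. Qed.

Lemma card_special : (#|[set xy : fan_vertex * fan_vertex | special_hubs xy.1 xy.2]| <= 64)%N.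
Proof.
have <- : #|((hub * hub)%type : finType)| = 64%N by rewrite card_prod card_hub.
pose f (uv : hub * hub) : fan_vertex * fan_vertex := (inl uv.1, inl uv.2).
apply: leq_trans (leq_imset_card f predT); apply: subset_leq_card.
apply/fintype.subsetP => -[[u|u] [v|v]]; rewrite inE //= => _.
by apply/imsetP; exists (u, v).
Qed.

Lemma hub_common_book a i :
  common_nbrs (fan_rel true) (Book i a) (Book (~~ i) a) = (6 * l)%N.
Proof.
rewrite /common_nbrs card_sum_type -[RHS]add0n; congr (_ + _)%N.
  by apply: eq_card0 => -[[k' i'] a']; rewrite inE /=; case: i i' k' => [] [] []; rewrite ?andbF.
by rewrite -(card_low_nbrs (false, i, a)); apply: eq_card => -[[[[] []] e] b]; rewrite !inE /= ?andbb.
Qed.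

Lemma hub_common_open (u v : hub) : fan_rel false (inl u) (inl v) ->
  common_nbrs (fan_rel false) (inl u) (inl v) = 0%N.
Proof.
move=> uv; apply: eq_card0 => -[[[k' i'] a']|[[[c s] e] b]]; rewrite inE; move: uv;
  case: u v => [[k i] a] [[k2 i2] a2] /=.
  by case: k k2 k' i i2 i' => [] [] [] [] [] [] //=; rewrite ?andbF.
case: k k2 c s => [] [] [] [] //=; case: i i2 => [] [] //=; case: e.1.1 => //=.
all: by case: a a2 b => [] [] [].
Qed.

(** Adjacent hubs have common neighbours in closed books only. *)
Lemma fan_gap : (tc fan_gadget false + l <= tc fan_gadget true)%N.
Proof.
have open0 (u v : hub) : (fan_rel false (inl u) (inl v) *
    common_nbrs (fan_rel false) (inl u) (inl v) = 0)%N.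
  have [/hub_common_open ->|_] := boolP (fan_rel false (inl u) (inl v)); first by rewrite muln0.
  exact: mul0n.
have sum0 : (\sum_(xy | special_hubs xy.1 xy.2)
    fan_rel false xy.1 xy.2 * common_nbrs (fan_rel false) xy.1 xy.2 = 0)%N.
  by apply: big1 => -[[u|u] [v|v]] // _; exact: open0.
have /= := ntriangles_special fan_sym fan_irr fan_swapK fan_swap_special fan_type.
rewrite sum0 (bigD1 (Book false true, Book true true)) //.
rewrite [(_, _).1]/= [(_, _).2]/= hub_common_book.
move: (\sum_(_ | _) _)%N (ntriangles _) (ntriangles _) => x y z /=.
by rewrite mul1n; clear; lia.
Qed.

Lemma fan_common_le beta x y :
  (common_nbrs (fan_rel beta) x y <= minn (degree (fan_rel beta) x) (degree (fan_rel beta) y))%N.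
Proof.
rewrite leq_min; apply/andP; split; apply: subset_leq_card; apply/fintype.subsetP => z;
  by rewrite !inE => /andP[].
Qed.

Lemma fan_ntriangles beta : (0 < l)%N -> (tc fan_gadget beta <= 126 * l)%N.
Proof.
move=> l0; rewrite -(leq_pmul2l (isT : 0 < 6)%N) /=.
rewrite (ntriangles_rel_graph (fan_sym beta) (fan_irr beta)).
have lowE (x : fan_vertex) v : (common_nbrs (fan_rel beta) x (inr v) <= 2)%N.
  by apply: leq_trans (fan_common_le _ _ _) _; rewrite low_degree geq_minr.
have lowE' v (x : fan_vertex) : (common_nbrs (fan_rel beta) (inr v) x <= 2)%N.
  by rewrite common_nbrsC lowE.
rewrite big_sumType; apply: (@leq_trans (8 * (70 * l) + 48 * l * 4)); last by lia.
apply: leq_add.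
  apply: (@leq_trans (\sum_(u : hub) 70 * l)); last by rewrite sum_nat_const card_hub.
  apply: leq_sum => u _.
  rewrite big_sumType; apply: (@leq_trans (8 * (6 * l).+1 + 6 * l * 2)); last by lia.
  apply: leq_add.
    apply: leq_trans (_ : \sum_(v : hub) (6 * l).+1 <= _)%N; last first.
      by rewrite sum_nat_const card_hub.
    rewrite big_mkcond; apply: leq_sum => v _; case: ifP => // _.
    by apply: leq_trans (fan_common_le _ _ _) _; rewrite !hub_degree minnn.
  apply: leq_trans (_ : \sum_(v | fan_rel beta (inl u) (inr v)) 2 <= _)%N.
    by apply: leq_sum.
  rewrite sum_nat_const leq_mul2r -(card_low_nbrs u) cardsE.
  by apply/orP; right; apply: subset_leq_card; apply/fintype.subsetP => v; case: u => [[k i] a].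
rewrite -card_low -sum_nat_const; apply: leq_sum => v _.
apply: leq_trans (_ : \sum_(y | fan_rel beta (inr v) y) 2 <= _)%N.
  by apply: leq_sum.
by have := low_degree beta v; rewrite /degree cardsE sum_nat_const => ->.
Qed.

Lemma fan_reveal (R : realType) (p : R) : (0 < l)%N -> 0 < p <= 1 ->
  l%:R ^+ 3 * p <= 1 -> reveal_prob p fan_gadget <= (56 ^+ 3 + 64) * p ^+ 2.
Proof.
move=> l0 p01 lp; apply: le_trans (relabel_reveal_prob _ _ _ _ _ _ _ _ _ p01) _.
have p2 : 0 <= p ^+ 2 by exact: sqr_ge0.
rewrite mulrDl.
apply: lerD; last by rewrite ler_wpM2r // ler_nat card_special.
have n56 : #|{: fan_vertex}|%:R <= 56 * l%:R :> R.
  by rewrite -natrM ler_nat card_sum card_hub card_low; lia.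
have l0' : 0 <= l%:R :> R by rewrite ler0n.
apply: le_trans (_ : (56 * l%:R) ^+ 3 * p ^+ 3 <= _).
  by rewrite ler_wpM2r ?lerXn2r ?nnegrE ?mulr_ge0 ?exprn_ge0 //; case/andP: p01 => /ltW.
have -> : (56 * l%:R) ^+ 3 * p ^+ 3 = 56 ^+ 3 * p ^+ 2 * (l%:R ^+ 3 * p) by ring.
by rewrite ler_piMr // mulr_ge0 // exprn_ge0.
Qed.

Lemma fan_degree_le w x : (#|[set y | layout fan_gadget w x y]| <= maxn 2 (6 * l).+1)%N.
Proof.
rewrite relabel_degree; case: (w.2 x) => v; rewrite ?hub_degree ?low_degree leq_max leqnn //.
by rewrite orbT.
Qed.

End FanGadget.

(** * The lower bound *)

(** With [l ^ 3 * p <= 1], three samples in a block are, up to constants, no more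
   likely than a pair of hubs. *)
Lemma minimax_risk_ge_fan (R : realType) (p : R) (d t l : nat) :
  0 < p -> p <= 1 / 600 -> (0 < l)%N -> (6 * l < d)%N -> (126 * l <= t)%N ->
  l%:R ^+ 3 * p <= 1 ->
  (((32 * expR 1 * 252 ^+ 2 * (56 ^+ 3 + 64))^-1 *
     Num.min (l%:R * t%:R / p ^+ 2) (t%:R ^+ 2))%:E <= minimax_risk p d t)%E.
Proof.
move=> p0 p1 l0 ld lt lp; have p01 : 0 < p <= 1 by rewrite p0; lra.
apply: (minimax_risk_ge_pair (B := fan_gadget l)) => //.
- move=> w x; apply: leq_trans (fan_degree_le w x) _.
  by rewrite geq_max ld andbT; move: l0 ld; clear; lia.
- by rewrite geq_max; apply/andP; split; apply: fan_ntriangles.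
- exact: fan_gap.
- exact: fan_reveal.
- lra.
- by move: p0 p1; clear=> p0 p1; nra.
Qed.

Lemma nat_below (R : realType) (x y z : R) : 1 <= x -> 1 <= y -> 1 <= z ->
  exists l : nat, [/\ (0 < l)%N, l%:R <= x, l%:R <= y & l%:R <= z /\
    Num.min x (Num.min y z) <= 2 * l%:R].
Proof.
move=> x1 y1 z1; set w := Num.min x (Num.min y z).
have w1 : 1 <= w by rewrite !le_min x1 y1.
have [n1 n2] : (Num.truncn w)%:R <= w /\ w < (Num.truncn w).+1%:R.
  by have /andP[] := Num.Theory.truncn_itv (le_trans ler01 w1).
exists (Num.truncn w); have l0 : (0 < Num.truncn w)%N.
  by rewrite -ltnS -(ltr_nat R) (le_lt_trans w1).
move: (n1); rewrite !le_min => /and3P[-> -> ->]; split=> //; split=> //.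
have : 1 <= (Num.truncn w)%:R :> R by rewrite ler1n.
by move: n2; rewrite -natr1; lra.
Qed.

Lemma powR73 (R : realType) (p : R) : 0 < p ->
  0 < p `^ (7 / 3) /\ (p `^ (7 / 3)) ^+ 3 = p ^+ 7.
Proof.
move=> p0; split; first exact: powR_gt0.
by rewrite -!powR_mulrn ?powR_ge0 ?(ltW p0) // -powRrM; congr (_ `^ _); field.
Qed.

(** The inverse of the constant in [minimax_risk_ge_fan]; it dominates the one in
   [minimax_risk_ge_hexagon]. *)
Definition pair_const (R : realType) : R := 32 * expR 1 * 252 ^+ 2 * (56 ^+ 3 + 64).

Lemma pair_const_gt0 (R : realType) : 0 < pair_const R.
Proof.
have n0 (n : nat) : 0 < n.+1%:R :> R by rewrite ltr0n.
apply: mulr_gt0; last by apply: addr_gt0 (n0 _); apply: exprn_gt0 (n0 _).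
apply: mulr_gt0; last by apply: exprn_gt0 (n0 _).
exact: mulr_gt0 (n0 _) (expR_gt0 _).
Qed.

(** The choice of [l] balances the degree, the number of vertices that may be
   sampled in a block, and the number of triangles. *)
Lemma minimax_risk_ge_dense (R : realType) (p : R) (d t : nat) :
  0 < p -> p <= 1 / 600 -> (6 < d)%N -> (252 <= t)%N ->
  (((252 * pair_const R)^-1 *
     Num.min (Num.min (t%:R / p `^ (7 / 3)) (t%:R * d%:R / p ^+ 2)) (t%:R ^+ 2))%:E
   <= minimax_risk p d t)%E.
Proof.
move=> p0 p1 d6 t1; have [w0 w3] := powR73 p0; move: (p `^ _) w0 w3 => w w0 w3.
have p2 : 0 < p ^+ 2 by rewrite exprn_gt0.
(* This is [p] to the power [- 1 / 3]. *)
pose s := p ^+ 2 / w; have s0 : 0 < s by rewrite divr_gt0.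
have s3 : s ^+ 3 * p = 1.
  by rewrite expr_div_n w3; field; rewrite gt_eqF.
have s1 : 1 <= s.
  rewrite leNgt; apply/negP => lt1; have : s ^+ 3 < 1 by rewrite exprn_ilt1 ?ltW.
  have : s ^+ 3 <= s ^+ 3 / p by rewrite ler_peMr ?exprn_ge0 ?(ltW s0) // invf_ge1 //; lra.
  have -> : s ^+ 3 / p = 1 / p ^+ 2 by rewrite -s3; field; rewrite gt_eqF.
  have : 1 <= s ^+ 3 by rewrite -(mulfK (lt0r_neq0 p0) (s ^+ 3)) s3 div1r invf_ge1 //; lra.
  by lra.
have y1 : 1 <= (d%:R - 1) / 6 :> R.
  have : 7 <= d%:R :> R by rewrite ler_nat.
  lra.
have z1 : 1 <= t%:R / 126 :> R.
  have : 252 <= t%:R :> R by rewrite ler_nat.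
  lra.
have [l [l0 ls ld [lt lmin]]] := nat_below s1 y1 z1.
have L0 : 0 < l%:R :> R by rewrite ltr0n.
have lp : l%:R ^+ 3 * p <= 1.
  apply: le_trans (_ : s ^+ 3 * p <= _); last by rewrite s3.
  by rewrite ler_wpM2r ?(ltW p0) // lerXn2r ?nnegrE ?(ltW L0) ?(ltW s0).
have hd : (6 * l < d)%N.
  by rewrite -(ler_nat R) -natr1 natrM; lra.
have ht : (126 * l <= t)%N by rewrite -(ler_nat R) natrM; lra.
apply: le_trans (minimax_risk_ge_fan p0 p1 l0 hd ht lp).
rewrite lee_fin -/(pair_const R) [(252 * _)^-1]invfM [252^-1 * _]mulrC -[_ / 252 * _]mulrA.
rewrite ler_pM2l ?invr_gt0 ?pair_const_gt0 // mulrC ler_pdivrMr ?ltr0n //.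
have T1 : 252 <= t%:R :> R by rewrite ler_nat.
have D1 : 7 <= d%:R :> R by rewrite ler_nat.
have -> : t%:R / w = s * t%:R / p ^+ 2 by rewrite /s; field; rewrite !gt_eqF.
move: (t%:R) (d%:R) (l%:R) T1 D1 L0 lmin ls; clear -p0 p1 p2 s0.
move=> T D l T1 D1 L0 lmin ls.
have q1 : 1 <= (p ^+ 2)^-1 by rewrite invf_ge1 // expr_le1 //; lra.
move: (p ^+ 2)^-1 q1 => q q1.
have T20 : 0 <= T ^+ 2 by exact: sqr_ge0.
have lT0 : 0 <= l * T by rewrite mulr_ge0; lra.
have key : [\/ s <= 2 * l, D <= 24 * l | T <= 252 * l].
  by move: lmin; rewrite !ge_min => /orP[|/orP[]] h; [apply: Or31|apply: Or32|apply: Or33]; lra.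
rewrite minr_pMl ?ler0n // le_min; apply/andP; split; last first.
  by rewrite ge_min; apply/orP; right; rewrite ler_peMr // ler1n.
case: key => h.
- rewrite 2!ge_min; apply/orP; left; apply/orP; left.
  rewrite [leRHS]mulrAC ler_wpM2r //; first by lra.
  have : s * T <= 2 * l * T by rewrite ler_wpM2r //; lra.
  by move: (s * T) => u hu; nra.
- rewrite 2!ge_min; apply/orP; left; apply/orP; right.
  rewrite [leRHS]mulrAC ler_wpM2r //; first by lra.
  have : D * T <= 24 * l * T by rewrite ler_wpM2r //; lra.
  by rewrite mulrC; move: (T * D) => u hu; nra.
rewrite ge_min; apply/orP; right; rewrite expr2 [leRHS]mulrAC.
apply: le_trans (_ : 252 * l * T <= _); first by rewrite ler_wpM2r //; lra.
have -> : l * T * 252 * q = 252 * l * T * q by ring.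
have n : 0 <= 252 * l * T by rewrite -mulrA; exact: mulr_ge0 (ler0n _ _) lT0.
by rewrite (ler_peMr n q1).
Qed.

(** For [d <= 6] the fans do not fit, but [d] is then a constant. *)
Lemma minimax_risk_ge_pairs (R : realType) (p : R) (d t : nat) :
  0 < p -> p <= 1 / 600 -> (1 < d)%N -> (252 <= t)%N ->
  (((252 * pair_const R)^-1 *
     Num.min (Num.min (t%:R / p `^ (7 / 3)) (t%:R * d%:R / p ^+ 2)) (t%:R ^+ 2))%:E
   <= minimax_risk p d t)%E.
Proof.
move=> p0 p1 d1 t1; have [d6|d6] := ltnP 6 d; first exact: minimax_risk_ge_dense.
apply: le_trans (minimax_risk_ge_hexagon p0 p1 d1 t1); rewrite lee_fin.
have e0 : 0 < expR 1 :> R by rewrite expR_gt0.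
have p2 : 0 < p ^+ 2 by rewrite exprn_gt0.
have D6 : d%:R <= 6 :> R by rewrite ler_nat.
have T0 : 0 <= t%:R :> R by rewrite ler0n.
have m3 : Num.min (Num.min (t%:R / p `^ (7 / 3)) (t%:R * d%:R / p ^+ 2)) (t%:R ^+ 2) <=
    3 * Num.min (2 * t%:R / p ^+ 2) (t%:R ^+ 2).
  rewrite minr_pMr ?ler0n // le_min !ge_min; apply/andP; split.
    apply/orP; left; apply/orP; right.
    by rewrite [leRHS]mulrA ler_wpM2r ?invr_ge0 ?(ltW p2) //; nra.
  by apply/orP; right; rewrite ler_peMl ?sqr_ge0 // ler1n.
have M0 : 0 <= Num.min (2 * t%:R / p ^+ 2) (t%:R ^+ 2) :> R.
  rewrite le_min sqr_ge0 andbT; exact: divr_ge0 (mulr_ge0 (ler0n _ _) T0) (ltW p2).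
apply: le_trans (ler_wpM2l _ m3) _.
  by rewrite invr_ge0 mulr_ge0 ?ler0n ?ltW ?pair_const_gt0.
rewrite mulrA; apply: ler_wpM2r => //; rewrite /pair_const.
have : 0 < 32 * expR 1 * 252 ^+ 2 :> R by rewrite !mulr_gt0 ?exprn_gt0 ?ltr0n.
move: (32 * expR 1 * 252 ^+ 2) => A A0.
rewrite [leLHS]mulrC ler_pdivrMr ?mulr_gt0 ?addr_gt0 ?exprn_gt0 ?ltr0n //.
have -> : (A * 252)^-1 * (252 * (A * (56 ^+ 3 + 64))) = 56 ^+ 3 + 64.
  by field; rewrite gt_eqF.
by apply: le_trans (_ : 64 <= _); [rewrite ler_nat|rewrite lerDr exprn_ge0].
Qed.

(** For [p] above an absolute constant, or few triangles, the books alone attain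
   the rate.  Otherwise the maximum of two rates is attained by books or by the
   blocks that take a pair of samples. *)
Theorem minimax_risk_lower (R : realType) (p0 : R) : 0 < p0 < 1 ->
  exists2 c : R, 0 < c & forall (p : R) (d t : nat), 0 < p <= p0 -> (1 < d)%N ->
    ((c * Num.min (Num.max (Num.min (t%:R / p `^ (7 / 3)) (t%:R * d%:R / p ^+ 2))
        (t%:R * d%:R / p)) (t%:R ^+ 2))%:E <= minimax_risk p d t)%E.
Proof.
move=> /andP[p0_gt0 p0_lt1]; have e0 : 0 < expR 1 :> R by rewrite expR_gt0.
pose cv := (1 - p0) ^+ 4 / (64 * expR 1); pose cp := (252 * pair_const R)^-1.
have cv0 : 0 < cv by rewrite divr_gt0 ?exprn_gt0 ?mulr_gt0 ?ltr0n // subr_gt0.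
have cp0 : 0 < cp.
  by rewrite invr_gt0; apply: mulr_gt0 (pair_const_gt0 R); rewrite ltr0n.
have cv0' : 0 < cv / 600 by apply: divr_gt0 cv0 _; rewrite ltr0n.
exists (Num.min (cv / 600) cp); first by rewrite lt_min cv0' cp0.
move=> p d t pp0 d1; have [p_gt0 p_le] := andP pp0.
set c := Num.min _ _.
have [c0 ccv ccp] : [/\ 0 <= c, c <= cv / 600 & c <= cp].
  by rewrite /c le_min !ge_min !lexx orbT (ltW cv0') (ltW cp0).
have lv := @minimax_risk_ge_vertex R p p0 d t pp0 p0_lt1 d1; rewrite -/cv in lv.
have T0 : 0 <= t%:R :> R by rewrite ler0n.
have D0 : 2 <= d%:R :> R by rewrite ler_nat.
set Q := t%:R ^+ 2 in lv *; set B := t%:R * d%:R / p in lv *.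
set X := Num.min _ (_ / p ^+ 2).
have Q0 : 0 <= Q by exact: sqr_ge0.
have B0 : 0 <= B by rewrite divr_ge0 ?mulr_ge0 ?(ltW p_gt0).
have X0 : 0 <= X by rewrite le_min !divr_ge0 ?mulr_ge0 ?powR_ge0 ?exprn_ge0 ?(ltW p_gt0).
have weak : Num.min (Num.max X B) Q <= 600 * Num.min B Q ->
    ((c * Num.min (Num.max X B) Q)%:E <= minimax_risk p d t)%E.
  move=> h; apply: le_trans lv; rewrite lee_fin.
  apply: le_trans (ler_wpM2l c0 h) _; rewrite mulrA ler_wpM2r ?le_min ?B0 //; lra.
have [p1|p1] := leP p (1 / 600); last first.
  apply: weak; rewrite minr_pMr ?ler0n // le_min !ge_min !ge_max.
  apply/andP; split; apply/orP; [left|right]; last by rewrite ler_peMl ?ler1n.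
  apply/andP; split; last by rewrite ler_peMl ?ler1n.
  rewrite ge_min; apply/orP; right.
  have -> : t%:R * d%:R / p ^+ 2 = p^-1 * B by rewrite /B; field; rewrite gt_eqF.
  rewrite ler_wpM2r // -[leRHS]invrK lef_pV2 ?posrE ?invr_gt0 ?ltr0n //; lra.
have [t1|t1] := ltnP t 252.
  apply: weak; have QB : Q <= B.
    rewrite /Q /B expr2 -mulrA ler_wpM2l // ler_pdivlMr //.
    have : t%:R <= 252 :> R by rewrite ler_nat ltnW.
    by move: (t%:R) T0 p1 p_gt0 D0; clear; move=> T T0 p1 p0 D0 T1; nra.
  rewrite (min_idPr QB); apply: le_trans (_ : Q <= _); first by rewrite ge_min lexx orbT.
  by rewrite ler_peMl ?ler1n.
have lx := minimax_risk_ge_pairs p_gt0 p1 d1 t1; rewrite -/cp -/X -/Q in lx.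
have [XB|BX] := leP X B.
  apply: le_trans lv; rewrite lee_fin; apply: ler_wpM2r; first by rewrite le_min B0.
  lra.
by apply: le_trans lx; rewrite lee_fin; apply: ler_wpM2r; rewrite // le_min X0.
Qed.

(** * The minimax rate *)

Theorem theorem13 (R : realType) (p0 : R) (hp0 : 0 < p0 < 1) :
  exists c C : R, [/\ 0 < c, 0 < C &
    forall (p : R) (d t : nat), 0 < p <= p0 ->
      let T : R := t%:R in
      let D : R := d%:R in
      ((1 < d)%N ->
        ((c * Num.min
               (Num.max (Num.min (T / p `^ (7 / 3)) (T * D / p ^+ 2))
                        (T * D / p))
               (T ^+ 2))%:E <= minimax_risk p d t)%E) /\
      (minimax_risk p d t <=
        (C * Num.min
               (Num.max (Num.min (T / p ^+ 3) (T * D / p ^+ 2))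
                        (T * D / p))
               (T ^+ 2))%:E)%E].
Proof.
have [p0_gt0 p0_lt1] := andP hp0; have [c c0 lower] := minimax_risk_lower hp0.
exists c, 400; split=> //.
move=> p d t pp0 T D; have [p_gt0 p_le] := andP pp0; split; first exact: lower.
by apply: minimax_risk_upper; rewrite p_gt0 (le_trans p_le) ?ltW.
Qed.
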